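(* Let $f\in\mathcal{P}_n$ and let $C$ be an origin-symmetric convex body in $\mathbb{R}^m$, $m\ge1$. If $p\in(-1,0)$ and $n/|p|\in\mathbb{N}$, then $$|Z^\diamondsuit_{p,C}(f)|\le|Z^\diamondsuit_{p,C}(f^* )|.$$ Furthermore, let $N>n$, let $\mathcal{F}=(f_{ij})_{i\in[N],j\in[m_i]}\subseteq\mathcal{P}_n$ and $\mathcal{C}=(C_1,\dots,C_N)$, where each $C_i$ is an origin-symmetric convex body in $\mathbb{R}^{m_i}$ with $m_i\ge n+1$. If $p\in[-1,0)$ and $n/|p|\in\mathbb{N}$, then $$\mathbb{E}\,|\mathcal{Z}^\diamondsuit_{p,\mathcal{C}}(\mathcal{F})|\le\mathbb{E}\,|\mathcal{Z}^\diamondsuit_{p,\mathcal{C}}(\mathcal{F}^\#)|.$$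
   Context: $\mathcal{P}_n$ is the set of measurable $f:\mathbb{R}^n\to[0,\infty)$ with $\int f=1$ and $\|f\|_\infty<\infty$. For measurable $A\subseteq\mathbb{R}^n$ of finite volume, $A^*$ is the open centered Euclidean ball with $|A^*|=|A|$; $f^*(x)=\int_0^\infty\chi_{\{f>t\}^*}(x)\,dt$. Star-shaped sets are given by radial functions $\rho(K,u)=\sup\{\lambda\ge0:\lambda u\in K\}\in[0,\infty]$ on $S^{n-1}$, with volume $|K|=\omega_n\int_{S^{n-1}}\rho(K,u)^n\,d\sigma(u)\in[0,\infty]$ ($\sigma$ normalized surface measure, $\omega_n=|B_2^n|$). $h(C,y)=\sup_{c\in C}\langle c,y\rangle$. Convention $0^q=+\infty$ for $q<0$. For $f\in\mathcal{P}_n$, $C\subseteq\mathbb{R}^m$ origin-symmetric convex body and $p\neq 0$, $Z^\diamondsuit_{p,C}(f)$ is the star-shaped set with $\rho^{-p}(Z^\diamondsuit_{p,C}(f),u)=\int_{(\mathbb{R}^n)^m}h^p(C,(\langle x_i,u\rangle)_{i=1}^m)\prod_{i=1}^mf(x_i)\,dx_1\cdots dx_m$. Empirical version: for $\mathcal{C}=(C_1,\dots,C_N)$, $C_i\subseteq\mathbb{R}^{m_i}$ origin-symmetric convex bodies, and $\mathcal{F}=(f_{ij})\subseteq\mathcal{P}_n$, let $X_{ij}$ ($i\in[N],j\in[m_i]$) be independent random vectors with densities $f_{ij}$, ${\bf X}_i^Tu=(\langle X_{ij},u\rangle)_{j=1}^{m_i}$; for $p\ne0$, $\mathcal{Z}^\diamondsuit_{p,\mathcal{C}}(\mathcal{F})$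 is the random star-shaped set with $\rho^{-p}(\mathcal{Z}^\diamondsuit_{p,\mathcal{C}}(\mathcal{F}),u)=\frac1N\sum_{i=1}^Nh^p(C_i,{\bf X}_i^Tu)$. $\mathcal{F}^\#=(f^*_{ij})$. *)

(* Defs.v *)
From HB Require Import structures.
From mathcomp Require Import all_boot all_order all_algebra.
From mathcomp Require Import all_classical all_reals all_analysis.

Set Implicit Arguments.
Unset Strict Implicit.
Unset Printing Implicit Defensive.

Import Order.TTheory GRing.Theory Num.Theory.
Import numFieldTopology.Exports numFieldNormedType.Exports.
Local Open Scope classical_set_scope.
Local Open Scope ring_scope.

Section Defs.
Context {R : realType}.

Definition dotv (k : nat) (x y : 'rV[R]_k) : R := \sum_(i < k) x 0 i * y 0 i.
Definition normE (k : nat) (x : 'rV[R]_k) : R := Num.sqrt (dotv x x).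

(* Iterated one-dimensional Lebesgue integrals over the coordinates listed
   in s (Tonelli: equals the integral w.r.t. n-dimensional Lebesgue measure). *)
Fixpoint int_coords (n : nat) (s : seq 'I_n) (g : 'rV[R]_n -> \bar R)
    (x0 : 'rV[R]_n) : \bar R :=
  match s with
  | [::] => g x0
  | i :: s' => (\int[@lebesgue_measure R]_t
                  int_coords s' g
                    (\row_k (if k == i then (t : R) else x0 ord0 k)%R))%E
  end.

Definition intRn (n : nat) (g : 'rV[R]_n -> \bar R) : \bar R :=
  int_coords (enum 'I_n) g 0.

Fixpoint int_fam (n : nat) (I : finType) (s : seq I)
    (G : (I -> 'rV[R]_n) -> \bar R) (x0 : I -> 'rV[R]_n) : \bar R :=
  match s with
  | [::] => G x0
  | i :: s' => intRn (fun v : 'rV[R]_n =>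
                 int_fam s' G (fun j => if j == i then v else x0 j))
  end.

Definition intRnI (n : nat) (I : finType) (G : (I -> 'rV[R]_n) -> \bar R)
  : \bar R := int_fam (enum I) G (fun _ => 0).

Definition volRn (n : nat) (A : set 'rV[R]_n) : \bar R :=
  intRn (fun x => (\1_A x)%:E).

Definition borelRn (n : nat) (A : set 'rV[R]_n) : Prop :=
  <<s (@open 'rV[R]_n) >> A.

Definition lebesgue_measurableRn (n : nat) (A : set 'rV[R]_n) : Prop :=
  exists B Z : set 'rV[R]_n, [/\ borelRn B, borelRn Z, volRn Z = 0%E &
    (A `\` B) `|` (B `\` A) `<=` Z].

Definition measurable_fun_Rn (n : nat) (f : 'rV[R]_n -> R) : Prop :=
  forall B : set R, measurable B -> lebesgue_measurableRn (f @^-1` B).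

Definition in_Pn (n : nat) (f : 'rV[R]_n -> R) : Prop :=
  [/\ measurable_fun_Rn f,
      (forall x, 0 <= f x),
      intRn (fun x => (f x)%:E) = 1%E &
      exists M : R, volRn [set x | M < f x] = 0%E].

Definition unit_ballRn (n : nat) : set 'rV[R]_n := [set x | normE x < 1].

Definition omega (n : nat) : R := fine (volRn (@unit_ballRn n)).

(* A^* : open centered Euclidean ball with |A^*| = |A|
   (= {x | omega_n |x|^n < |A|}; the whole space if |A| = +oo) *)
Definition sym_rearr_set (n : nat) (A : set 'rV[R]_n) : set 'rV[R]_n :=
  [set x | ((omega n * normE x ^+ n)%R%:E < volRn A)%E].

Definition sym_rearr (n : nat) (f : 'rV[R]_n -> R) : 'rV[R]_n -> R :=
  fun x => fine (\int[@lebesgue_measure R]_(t in [set t : R | (0 <= t)%R])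
                   (\1_(sym_rearr_set [set y | (t < f y)%R]) x)%:E)%E.

(* normalized surface measure on S^{n-1}, realized as the (normalized) cone
   measure:  int_{S^{n-1}} g dsigma = omega_n^{-1} int_{B_2^n \ {0}} g(x/|x|) dx *)
Definition sphere_int (n : nat) (g : 'rV[R]_n -> \bar R) : \bar R :=
  (((omega n)^-1)%R%:E *
   intRn (fun x : 'rV[R]_n => if ((normE x < 1) && (x != 0))%R then g (((normE x)^-1) *: x)%R
                   else 0%E))%E.

(* volume of the star-shaped set with radial function rho : S^{n-1} -> [0,oo]
   |K| = omega_n int_{S^{n-1}} rho^n dsigma *)
Definition star_vol (n : nat) (rho : 'rV[R]_n -> \bar R) : \bar R :=
  ((omega n)%:E * sphere_int (fun u => rho u ^+ n))%E.

Definition convex_setRn (m : nat) (C : set 'rV[R]_m) : Prop :=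
  forall x y t, C x -> C y -> 0 <= t <= 1 -> C (t *: x + (1 - t) *: y).

Definition sym_convex_body (m : nat) (C : set 'rV[R]_m) : Prop :=
  [/\ convex_setRn C, compact C, C° !=set0 & forall x, C x -> C (- x)].

Definition supp_fun (m : nat) (C : set 'rV[R]_m) (y : 'rV[R]_m) : R :=
  sup [set dotv c y | c in C].

(* t^q in [0,+oo] for t >= 0, with the convention 0^q = +oo for q < 0 *)
Definition epow (t q : R) : \bar R :=
  if (t == 0) && (q < 0) then +oo%E else (t `^ q)%:E.

Definition Zdiam_rhop (n m : nat) (p : R) (C : set 'rV[R]_m)
    (f : 'rV[R]_n -> R) (u : 'rV[R]_n) : \bar R :=
  intRnI (fun xs : 'I_m -> 'rV[R]_n =>
    (epow (supp_fun C (\row_(i < m) dotv (xs i) u)) p *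
     (\prod_(i < m) f (xs i))%:E)%E).

Definition Zdiam_rho (n m : nat) (p : R) (C : set 'rV[R]_m)
    (f : 'rV[R]_n -> R) (u : 'rV[R]_n) : \bar R :=
  poweR (Zdiam_rhop p C f u) (- p^-1).

Definition emp_index (N : nat) (m : 'I_N -> nat) : finType :=
  {i : 'I_N & 'I_(m i)}.

Definition ZdiamE_rho (n N : nat) (m : 'I_N -> nat) (p : R)
    (C : forall i : 'I_N, set 'rV[R]_(m i))
    (X : emp_index m -> 'rV[R]_n) (u : 'rV[R]_n) : \bar R :=
  poweR (((N%:R)^-1)%:E *
         \sum_(i < N) epow (supp_fun (C i)
                (\row_(j < m i) dotv (X (Tagged (fun i => 'I_(m i)) j)) u)) p)%E
        (- p^-1).

(* E |Z^diamond_{p,C}(F)| with independent X_ij of densities F i j *)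
Definition exp_vol_ZdiamE (n N : nat) (m : 'I_N -> nat) (p : R)
    (C : forall i : 'I_N, set 'rV[R]_(m i))
    (F : forall i : 'I_N, 'I_(m i) -> 'rV[R]_n -> R) : \bar R :=
  intRnI (fun X : emp_index m -> 'rV[R]_n =>
    (star_vol (ZdiamE_rho p C X) *
     (\prod_(k : emp_index m) F (tag k) (tagged k) (X k))%:E)%E).

End Defs.

(* Main.v *)
Require Import Defs.
From HB Require Import structures.
From mathcomp Require Import all_boot all_order all_algebra.
From mathcomp Require Import all_classical all_reals all_analysis.
From mathcomp Require Import measurable_realfun ring lra.

(** Writing q = -p and n = q k, the integrand rho^n is the k-th power of a sum
    (resp. an integral) of terms h(C, X^T u)^(-q).  Expanding the power and using
    independence reduces both inequalities to one statement: for seminorms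
    N_1, ..., N_k the functional
      E [ int_{S^{n-1}} N_1(X^T u)^(-q) ... N_k(X^T u)^(-q) du ]
    does not decrease when all densities are symmetrically rearranged.

    Replace N_l(X^T u) by M_l = N_l(X^T u) + eps |u|.  The product of the M_l^(-q)
    is homogeneous of degree -n in u, so averaging over dilations turns the
    integral over the sphere into a constant multiple of the integral over
    {M_1 < 1} of the product of the other M_l^(-q).  By the layer-cake formula this
    is a mixture of volumes of sections of sets that, with the other coordinates
    fixed, are convex and symmetric in one coordinate of every X_e jointly with all
    but that coordinate of u.  Hence the functional increases under Steiner
    symmetrization: the one-dimensional inequality is proved by sliding and merging
    intervals, where sliding is monotone because marginals of symmetric convex sets
    decrease along rays.

    The functional is rotation invariant, so one may symmetrize in any direction.
    For bounded sets a greedy choice of directions makes the distance to the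
    centred balls of the same volume arbitrarily small.  Letting eps tend to 0,
    exhausting unbounded sets, and the layer-cake formula in each density finish
    the proof. *)

Set Implicit Arguments.
Unset Strict Implicit.
Unset Printing Implicit Defensive.

Import Order.TTheory GRing.Theory Num.Theory.
Import numFieldTopology.Exports numFieldNormedType.Exports.
Local Open Scope classical_set_scope.
Local Open Scope ring_scope.

(** * Iterated integrals *)

(** The inner products [<X_e, u>] are bilinear, so no set in the proof is convex in [X] and [u]
    together. Freeze [u_i0] and the entries [X_e,k] with [k != i0]: then every [<X_e, u>] is affine
    in the remaining variables, and it changes sign when all of them do. This is why one coordinate
    of the points is paired with the complementary coordinates of [u]. The constraint [|u| = 1]
    would spoil the convexity in those coordinates, whereas [M_1 < 1] respects it.

    The seminorms can vanish at [X^T u] with [u != 0], for instance when all the points are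
    orthogonal to [u], and the negative powers are then infinite. The term [eps |u|] keeps the
    kernels bounded. This is what makes the functional insensitive to changes of small volume, and
    such changes are made twice: when measurable sets of reals are replaced by intervals, and when
    sets close to balls are replaced by balls. *)

Definition vec (R : realType) (J : finType) : Type := J -> R.

HB.instance Definition _ (R : realType) (J : finType) :=
  Pointed.copy (vec R J) (J -> R).

Definition vec_display : measure_display.
Proof. exact: default_measure_display. Qed.

Section vec_measurable.
Context (R : realType) (J : finType).

(** Generators of the product sigma-algebra. [vec R J] is a name of its own for [J -> R], to which
    this structure can be attached. *)
Definition vec_cyl : set (set (vec R J)) :=
  [set A | exists i B, measurable B /\ A = (fun x : vec R J => x i) @^-1` B].

Definition vec_meas : set (set (vec R J)) := <<s vec_cyl >>.

Let m0 : vec_meas set0. Proof. exact: sigma_algebra0. Qed.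
Let mC A : vec_meas A -> vec_meas (~` A). Proof. exact: sigma_algebraC. Qed.
Let mU (F : _^nat) : (forall i, vec_meas (F i)) -> vec_meas (\bigcup_i F i).
Proof. exact: sigma_algebra_bigcup. Qed.

HB.instance Definition _ :=
  @isMeasurable.Build vec_display (vec R J) vec_meas m0 mC mU.

Lemma measurable_coord (i : J) : measurable_fun setT (fun x : vec R J => x i).
Proof.
by move=> _ B mB; rewrite setTI; apply: sub_sigma_algebra; exists i, B.
Qed.

Lemma measurable_vec d (T : measurableType d) (f : T -> vec R J) :
  (forall i, measurable_fun setT (fun x => f x i)) -> measurable_fun setT f.
Proof.
move=> mf; apply: (measurability vec_cyl) => // A [B [i [C [mC0 ->]]] <-].
exact: mf.
Qed.

Definition upd (x : vec R J) (i : J) (t : R) : vec R J :=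
  fun j => if j == i then t else x j.

Lemma updE x i t : upd x i t i = t. Proof. by rewrite /upd eqxx. Qed.

Lemma updN x i t j : j != i -> upd x i t j = x j.
Proof. by rewrite /upd => /negbTE ->. Qed.

Lemma upd_upd x i s t : upd (upd x i s) i t = upd x i t.
Proof. by apply/funext => j; rewrite /upd; case: (j == i). Qed.

Lemma updC x i j s t : i != j -> upd (upd x i s) j t = upd (upd x j t) i s.
Proof.
by move=> ij; apply/funext => k; rewrite /upd; case: (eqVneq k j) => // ->;
  rewrite eq_sym (negbTE ij).
Qed.

Lemma measurable_upd d (T : measurableType d) (f : T -> vec R J) i (g : T -> R) :
  measurable_fun setT f -> measurable_fun setT g ->
  measurable_fun setT (fun x => upd (f x) i (g x)).
Proof.
move=> mf mg; apply: measurable_vec => j; rewrite /upd; case: (j == i) => //.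
exact: (measurableT_comp (measurable_coord j) mf).
Qed.

End vec_measurable.
#[global] Hint Extern 0 (measurable_fun _ (fun x => x _)) =>
  solve [exact: measurable_coord] : core.

Section itint_def.
Context (R : realType) (J : finType).
Local Open Scope ereal_scope.

Implicit Types (s : seq J) (g h : vec R J -> \bar R) (x : vec R J).

(** The coordinates outside [s] keep the values they have in [x]. The result is thus again a
    function on [vec R J], which lets integrals be nested and partial integrals serve as kernels. *)
Fixpoint itint (s : seq J) (g : vec R J -> \bar R) (x : vec R J) : \bar R :=
  match s with
  | [::] => g x
  | i :: s' => \int[@lebesgue_measure R]_t itint s' g (upd x i t)
  end.

Lemma itint_cat s1 s2 g x : itint (s1 ++ s2) g x = itint s1 (itint s2 g) x.
Proof.
by elim: s1 x => [//|i s IH] x /=; apply: eq_integral => t _; exact: IH.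
Qed.

Lemma eq_itint s g h x :
  (forall y, (forall j, j \notin s -> y j = x j) -> g y = h y) ->
  itint s g x = itint s h x.
Proof.
elim: s x => [|i s IH] x gh /=; first exact: gh.
apply: eq_integral => t _; apply: IH => y yx; apply: gh => j.
by rewrite inE negb_or => /andP[ji js]; rewrite yx// updN.
Qed.

Lemma itint_ge0 s g x : (forall y, 0 <= g y) -> 0 <= itint s g x.
Proof.
move=> g0; elim: s x => [|i s IH] x //=.
by apply: integral_ge0 => t _; exact: IH.
Qed.

(** Measurability is proved jointly in the parameter and the base point, because the base point
    itself varies under the next integral. *)
Lemma measurable_itint2 d (Y : measurableType d) s (g : Y * vec R J -> \bar R) :
  measurable_fun setT g -> (forall p, 0 <= g p) ->
  measurable_fun setT (fun p : Y * vec R J => itint s (fun x => g (p.1, x)) p.2).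
Proof.
move=> mg g0; elim: s => [|i s IH] /=.
  by under eq_fun do rewrite -surjective_pairing.
apply: (measurable_fun_fubini_tonelli_F (m2 := lebesgue_measure)
  (fun q : (Y * vec R J) * R =>
     itint s (fun x => g (q.1.1, x)) (upd q.1.2 i q.2))) => [|q]; last first.
  exact: itint_ge0.
pose h (q : (Y * vec R J) * R) := (q.1.1, upd q.1.2 i q.2).
have mh : measurable_fun setT h.
  apply: measurable_fun_pair => /=.
    by apply: measurableT_comp => //; exact: measurable_fst.
  apply: measurable_upd => //.
  by apply: measurableT_comp; [exact: measurable_snd|exact: measurable_fst].
exact: (measurableT_comp IH mh).
Qed.

Lemma measurable_itint d (Y : measurableType d) s (g : Y * vec R J -> \bar R)
    (z : Y -> vec R J) :
  measurable_fun setT g -> (forall p, 0 <= g p) -> measurable_fun setT z ->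
  measurable_fun setT (fun y => itint s (fun x => g (y, x)) (z y)).
Proof.
move=> mg g0 mz; have := measurable_itint2 s mg g0 => mG.
have mh : measurable_fun setT (fun y : Y => (y, z y)).
  exact: measurable_fun_pair.
exact: (measurableT_comp mG mh).
Qed.

Lemma measurable_itint1 s (g : vec R J -> \bar R) :
  measurable_fun setT g -> (forall x, 0 <= g x) ->
  measurable_fun setT (itint s g).
Proof.
move=> mg g0.
apply: (@measurable_itint _ (vec R J) s (fun p => g p.2) (fun x => x)) => //.
by apply: measurableT_comp => //; exact: measurable_snd.
Qed.

Lemma measurable_itint_upd s (g : vec R J -> \bar R) x i :
  measurable_fun setT g -> (forall x, 0 <= g x) ->
  measurable_fun setT (fun t => itint s g (upd x i t)).
Proof.
move=> mg g0; apply: (measurableT_comp (measurable_itint1 s mg g0)).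
by apply: measurable_upd.
Qed.

Lemma le_itint s g h x :
  measurable_fun setT g -> measurable_fun setT h ->
  (forall y, 0 <= g y) ->
  (forall y, (forall j, j \notin s -> y j = x j) -> g y <= h y) ->
  (forall y, 0 <= h y) ->
  itint s g x <= itint s h x.
Proof.
move=> mg mh g0 gh h0.
elim: s x gh => [|i s IH] x gh /=; first exact: gh.
apply: ge0_le_integral => //.
- by move=> t _; exact: itint_ge0.
- exact: measurable_itint_upd.
- exact: measurable_itint_upd.
- move=> t _; apply: IH => y yx; apply: gh => j.
  by rewrite inE negb_or => /andP[ji js]; rewrite yx// updN.
Qed.

Lemma itintD s g h x : measurable_fun setT g -> measurable_fun setT h ->
  (forall y, 0 <= g y) -> (forall y, 0 <= h y) ->
  itint s (fun y => g y + h y) x = itint s g x + itint s h x.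
Proof.
move=> mg mh g0 h0; elim: s x => [//|i s IH] x /=.
under eq_integral do rewrite IH.
by rewrite ge0_integralD//; [move=> t _; exact: itint_ge0|
  exact: measurable_itint_upd|move=> t _; exact: itint_ge0|
  exact: measurable_itint_upd].
Qed.

Lemma itint_sum s (I : Type) (r : seq I) (g : I -> vec R J -> \bar R) x :
  (forall i, measurable_fun setT (g i)) -> (forall i y, 0 <= g i y) ->
  itint s (fun y => \sum_(i <- r) g i y) x = \sum_(i <- r) itint s (g i) x.
Proof.
move=> mg g0; elim: s x => [//|i s IH] x /=.
under eq_integral do rewrite IH.
rewrite ge0_integral_sum// => [k|k t _]; last exact: itint_ge0.
exact: measurable_itint_upd.
Qed.

Lemma itintZ s c g x : measurable_fun setT g -> (forall y, 0 <= g y) ->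
  0 <= c -> itint s (fun y => c * g y) x = c * itint s g x.
Proof.
move=> mg g0 c0; elim: s x => [//|i s IH] x /=.
under eq_integral do rewrite IH.
rewrite ge0_integralZl//; [exact: measurable_itint_upd|].
by move=> t _; exact: itint_ge0.
Qed.

Lemma itint0 s x : itint s (fun=> 0) x = 0.
Proof.
elim: s x => [//|i s IH] x /=.
by under eq_integral do rewrite IH; rewrite integral0.
Qed.

Lemma cvg_itint s (g : (vec R J -> \bar R)^nat) (f : vec R J -> \bar R) x :
  (forall n, measurable_fun setT (g n)) -> (forall n y, 0 <= g n y) ->
  (forall y, nondecreasing_seq (g ^~ y)) ->
  (forall y, g n y @[n --> \oo] --> f y) ->
  itint s (g n) x @[n --> \oo] --> itint s f x.
Proof.
move=> mg g0 ndg gf.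
elim: s x => [|i s IH] x /=; first exact: gf.
have -> : (fun t => itint s f (upd x i t)) =
    fun t => limn (fun n => itint s (g n) (upd x i t)).
  by apply/funext => t; apply/esym/cvg_lim => //; exact: IH.
apply: cvg_monotone_convergence => //.
- by move=> n; exact: measurable_itint_upd.
- by move=> n t _; exact: itint_ge0.
- move=> t _ m n mn; apply: le_itint => // y _; exact: ndg.
Qed.

Lemma itint_integral d (Y : measurableType d)
    (nu : {sigma_finite_measure set Y -> \bar R}) s (g : Y * vec R J -> \bar R) x :
  measurable_fun setT g -> (forall p, 0 <= g p) ->
  \int[nu]_y itint s (fun x => g (y, x)) x =
  itint s (fun x => \int[nu]_y g (y, x)) x.
Proof.
move=> mg g0; elim: s x => [//|i s IH] x /=.
under [RHS]eq_integral do rewrite -IH.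
apply: (fubini_tonelli (m1 := nu) (m2 := lebesgue_measure) (fun p : Y * R =>
   itint s (fun x => g (p.1, x)) (upd x i p.2))) => [|p]; last first.
  exact: itint_ge0.
pose h (q : Y * R) := (q.1, upd x i q.2).
have mh : measurable_fun setT h.
  by apply: measurable_fun_pair => //; exact: measurable_upd.
exact: (measurableT_comp (measurable_itint2 s mg g0) mh).
Qed.

End itint_def.

Lemma itintC (R : realType) (J K : finType) s s' (g : vec R J * vec R K -> \bar R)
    x z : measurable_fun setT g -> (forall p, 0 <= g p)%E ->
  itint s (fun y => itint s' (fun w => g (y, w)) z) x =
  itint s' (fun w => itint s (fun y => g (y, w)) x) z.
Proof.
move=> mg g0; elim: s' z => [//|i s' IH] z /=.
under eq_integral do rewrite -IH.
symmetry; apply: (itint_integral lebesgue_measure _ (g := fun p : R * vec R J =>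
    itint s' (fun w => g (p.2, w)) (upd z i p.1))) => [|p]; last first.
  exact: itint_ge0.
pose h (q : R * vec R J) := (q.2, upd z i q.1).
have mh : measurable_fun setT h.
  by apply: measurable_fun_pair => //; exact: measurable_upd.
exact: (measurableT_comp (measurable_itint2 s' mg g0) mh).
Qed.
Section itint_perm.
Context (R : realType) (J : finType).
Local Open Scope ereal_scope.
Implicit Types (s : seq J) (g h : vec R J -> \bar R) (x : vec R J).

Lemma itint_swap i j s g x : measurable_fun setT g -> (forall y, 0 <= g y) ->
  i != j -> itint (i :: j :: s) g x = itint (j :: i :: s) g x.
Proof.
move=> mg g0 ij /=.
under [RHS]eq_integral do under eq_integral do rewrite updC 1?eq_sym//.
apply: (fubini_tonelli (m1 := lebesgue_measure) (m2 := lebesgue_measure)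
  (fun p : R * R => itint s g (upd (upd x i p.1) j p.2))) => [|p]; last first.
  exact: itint_ge0.
apply: (measurableT_comp (measurable_itint1 s mg g0)).
by do 2 apply: measurable_upd => //.
Qed.

Lemma itint_rem i s g x : measurable_fun setT g -> (forall y, 0 <= g y) ->
  uniq s -> i \in s -> itint s g x = itint (i :: rem i s) g x.
Proof.
move=> mg g0; elim: s x => [//|j s IH] x /= /andP[js us].
rewrite inE; case: eqVneq => [->//|ij /= si].
transitivity (itint (j :: i :: rem i s) g x).
  by apply: eq_integral => t _; rewrite IH.
by rewrite eq_sym in ij; rewrite itint_swap.
Qed.

(** Tonelli for neighbouring coordinates, extended to all reorderings. It serves to bring chosen
    coordinates innermost before a one-dimensional or fibrewise estimate. *)
Lemma perm_itint s s' g x : measurable_fun setT g -> (forall y, 0 <= g y) ->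
  uniq s -> perm_eq s s' -> itint s g x = itint s' g x.
Proof.
move=> mg g0; elim: s s' x => [|i s IH] s' x us ss'.
  by move: ss'; rewrite perm_sym => /perm_nilP ->.
have us' : uniq s' by rewrite -(perm_uniq ss').
have si : i \in s' by rewrite -(perm_mem ss') mem_head.
rewrite (itint_rem _ mg g0 us' si) /=.
apply: eq_integral => t _; apply: IH; first by case/andP: us.
by rewrite -(perm_cons i) (perm_trans ss')// perm_to_rem.
Qed.

Lemma eq_itint_base s g x z : (forall j, j \notin s -> x j = z j) ->
  itint s g x = itint s g z.
Proof.
elim: s x z => [|i s IH] x z xz /=; first by congr g; apply/funext => j; exact: xz.
apply: eq_integral => t _; apply: IH => j js; rewrite /upd.
by case: eqVneq => // ji; apply: xz; rewrite inE negb_or ji.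
Qed.

End itint_perm.

(** [G] only has to turn an update at [i] into an update at [phi i]. It need not be onto:
    coordinates outside the image of [phi] may stay frozen at values built into [G]. *)
Lemma itint_map (R : realType) (J K : finType) (phi : K -> J) (s : seq K)
    (G : vec R K -> vec R J) (g : vec R J -> \bar R) x :
  (forall x i t, i \in s -> G (upd x i t) = upd (G x) (phi i) t) ->
  itint (map phi s) g (G x) = itint s (g \o G) x.
Proof.
elim: s x => [//|i s IH] x HG /=.
apply: eq_integral => t _; rewrite -HG ?mem_head// IH// => y j r js.
by apply: HG; rewrite inE js orbT.
Qed.

(** * Affine changes of variable *)

Section affine.
Context (R : realType).
Local Open Scope ereal_scope.
Notation mu := (@lebesgue_measure R).

Let affine (a b : R) : measurableTypeR R -> measurableTypeR R :=
  fun t => (a * t + b)%R.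

Let affine_mfun (a b : R) : measurable_fun setT (affine a b).
Proof. by apply: measurable_funD => //; exact: measurable_funM. Qed.

Lemma lebesgue_affine (a b : R) (A : set R) : (a != 0)%R -> measurable A ->
  mu A = `|a|%:E * mu ((fun t => a * t + b)%R @^-1` A).
Proof.
move=> a0 mA.
have a_gt0 : (0 < `|a|)%R by rewrite normr_gt0.
pose nu : {measure set (measurableTypeR R) -> \bar R} :=
  mscale (NngNum (ltW a_gt0)) (pushforward mu (affine a b)).
suff -> : mu A = nu (affine_mfun a b) A by [].
apply: lebesgue_measure_unique => // _ [[x y] _ <-].
rewrite /nu /mscale/= /mscale /pushforward/=.
(* For [a < 0] the preimage of a half-open interval is half-open at the other end. *)
rewrite [X in _ * lebesgue_measure X](_ : _ = if (0 < a)%R then `]((x - b) / a)%R, ((y - b) / a)%R]%classic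
    else `[((y - b) / a)%R, ((x - b) / a)%R[%classic); last first.
  apply/seteqP; split=> t; rewrite /preimage/= !in_itv/=; case: ifPn => a_gt /=;
    rewrite !in_itv/=.
  - by rewrite ltr_pdivrMr// ler_pdivlMr// mulrC ltrBlDr lerBrDr.
  - have an : (a < 0)%R by rewrite lt_neqAle a0 leNgt.
    by rewrite ler_ndivrMr// ltr_ndivlMr// mulrC lerBrDr ltrBlDr andbC.
  - by rewrite ltr_pdivrMr// ler_pdivlMr// mulrC ltrBlDr lerBrDr.
  - have an : (a < 0)%R by rewrite lt_neqAle a0 leNgt.
    by rewrite ler_ndivrMr// ltr_ndivlMr// mulrC lerBrDr ltrBlDr andbC.
case: (boolP (0 < a)%R) => a_gt; rewrite !lebesgue_measure_itv/= !lte_fin.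
- rewrite ltr_pM2r ?invr_gt0// ltrD2r; case: ifP => _; last by rewrite mule0.
  by rewrite gtr0_norm// -!EFinB -EFinM; congr EFin; field.
- have an : (a < 0)%R by rewrite lt_neqAle a0 leNgt.
  rewrite ltr_nM2r ?invr_lt0// ltrD2r; case: ifP => _; last by rewrite mule0.
  by rewrite ltr0_norm// -!EFinB -EFinM; congr EFin; field.
Qed.

Lemma integral_affine (a b : R) (g : R -> \bar R) : (a != 0)%R ->
  measurable_fun setT g -> (forall t, 0 <= g t) ->
  `|a|%:E * \int[mu]_t g (a * t + b)%R = \int[mu]_t g t.
Proof.
move=> a0 mg g0.
have a_gt0 : (0 < `|a|)%R by rewrite normr_gt0.
pose nu : {measure set (measurableTypeR R) -> \bar R} :=
  mscale (NngNum (ltW a_gt0)) (pushforward mu (affine a b)).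
transitivity (\int[nu (affine_mfun a b)]_t g t).
  by rewrite ge0_integral_mscale//= ge0_integral_pushforward//=;
    exact: affine_mfun.
by apply: eq_measure_integral => A mA _; rewrite [RHS](@lebesgue_affine a b).
Qed.

Lemma integral_shift (b : R) (g : R -> \bar R) :
  measurable_fun setT g -> (forall t, 0 <= g t) ->
  \int[mu]_t g (t + b)%R = \int[mu]_t g t.
Proof.
move=> mg g0; rewrite -[RHS](@integral_affine 1 b)// normr1 mul1e.
by apply: eq_integral => t _; rewrite mul1r.
Qed.

End affine.

Section itint_affine.
Context (R : realType) (J : finType).
Local Open Scope ereal_scope.
Implicit Types (s : seq J) (g h : vec R J -> \bar R) (x : vec R J).

Definition vadd (x y : vec R J) : vec R J := fun j => (x j + y j)%R.
Definition vscale (a : R) (x : vec R J) : vec R J := fun j => (a * x j)%R.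

Lemma itint_shift s g x a : measurable_fun setT g -> (forall y, 0 <= g y) ->
  itint s (fun y => g (vadd y a)) x = itint s g (vadd x a).
Proof.
move=> mg g0; elim: s x => [//|i s IH] x /=.
rewrite -[RHS](integral_shift (a i)); [|exact: measurable_itint_upd|
  by move=> t; exact: itint_ge0].
apply: eq_integral => t _; rewrite IH; congr itint.
by apply/funext => j; rewrite /vadd /upd; case: eqVneq => // ->.
Qed.

Lemma itint_scale s g x c : measurable_fun setT g -> (forall y, 0 <= g y) ->
  (0 < c)%R ->
  (c ^+ size s)%:E * itint s (fun y => g (vscale c y)) x = itint s g (vscale c x).
Proof.
move=> mg g0 c0; elim: s x => [|i s IH] x /=; first by rewrite mul1e.
rewrite -[RHS](@integral_affine _ c 0) ?gt_eqF//; [|exact: measurable_itint_upd|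
  by move=> t; exact: itint_ge0].
have mgc : measurable_fun setT (fun y => g (vscale c y)).
  apply: (measurableT_comp mg); apply: measurable_vec => j.
  by apply: measurable_funM => //; exact: measurable_coord.
rewrite gtr0_norm// exprS EFinM -muleA; congr (_ * _).
rewrite -ge0_integralZl//; [|exact: measurable_itint_upd|
  by move=> t _; exact: itint_ge0|by rewrite lee_fin exprn_ge0// ltW].
apply: eq_integral => t _; rewrite IH; congr itint.
by apply/funext => j; rewrite /vscale /upd addr0; case: eqVneq.
Qed.

(* Only the coordinate i is modified, affinely, so Fubini with i innermost
   reduces to one dimension *)
Lemma itint_coord_affine s g x i (c : R) (phi : vec R J -> R) :
  measurable_fun setT g -> (forall y, 0 <= g y) ->
  measurable_fun setT phi -> (forall y t, phi (upd y i t) = phi y) ->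
  uniq s -> i \in s -> `|c|%R = 1%R ->
  itint s (fun y => g (upd y i (c * y i + phi y))) x = itint s g x.
Proof.
move=> mg g0 mphi phii us si c1.
have c0 : (c != 0)%R by rewrite -normr_eq0 c1 oner_eq0.
have ps : perm_eq s (rem i s ++ [:: i]).
  by rewrite perm_sym perm_catC /= perm_sym perm_to_rem.
have mgc : measurable_fun setT (fun y : vec R J => g (upd y i (c * y i + phi y))).
  apply: (measurableT_comp mg); apply: measurable_upd => //.
  apply: measurable_funD => //; apply: measurable_funM => //;
  exact: measurable_coord.
rewrite (perm_itint _ mgc _ us ps)// (perm_itint _ mg g0 us ps) !itint_cat.
apply: eq_itint => y _ /=.
rewrite -[RHS](@integral_affine _ c (phi y) _ c0); [|exact: (measurable_itint_upd [::])|by []].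
rewrite c1 mul1e; apply: eq_integral => t _.
by rewrite phii updE upd_upd.
Qed.

End itint_affine.

(** * Marginals of symmetric convex sets *)

Section layer_cake.
Context (R : realType).
Local Open Scope ereal_scope.
Notation mu := (@lebesgue_measure R).

Lemma eq_indic T U (A : set T) (B : set U) x y : (A x <-> B y) ->
  \1_A x = \1_B y :> R.
Proof.
move=> AB; rewrite !indicE; suff -> : (x \in A) = (y \in B) by [].
by apply/idP/idP => /set_mem/AB/mem_set.
Qed.

(** The condition [0 <= r] lets the layer-cake formula integrate [r] over the whole line. *)
Definition subgraph T (f : T -> \bar R) (r : R) : set T :=
  [set x | (0 <= r)%R /\ r%:E < f x].

Lemma measurable_ltE d (T : measurableType d) (a : T -> R) (f : T -> \bar R) :
  measurable_fun setT a -> measurable_fun setT f ->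
  measurable [set x | (a x)%:E < f x].
Proof.
move=> ma mf.
have mg : measurable_fun setT (fun x => f x - (a x)%:E).
  by apply: emeasurable_funB => //; exact/measurable_EFinP.
have := emeasurable_fun_o_infty measurableT mg 0; rewrite setTI.
rewrite (_ : [set x | 0 < _] = [set x | (a x)%:E < f x])//.
by apply/seteqP; split=> x; rewrite /mkset sube_gt0.
Qed.

Lemma measurable_subgraph2 d (T : measurableType d) (f : T -> \bar R) :
  measurable_fun setT f ->
  measurable [set p : R * T | subgraph f p.1 p.2].
Proof.
move=> mf; rewrite (_ : [set p | _] = [set p | (0%R)%:E <= (p.1)%:E] `&`
  [set p : R * T | (p.1)%:E < f p.2]); last first.
  by apply/seteqP; split=> p /=; rewrite /subgraph /= lee_fin.
apply: measurableI; last first.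
  by apply: measurable_ltE => //; exact: measurableT_comp.
rewrite -[X in measurable X]setTI; apply: emeasurable_fun_c_infty => //.
exact/measurable_EFinP.
Qed.

Lemma measurable_subgraph d (T : measurableType d) (f : T -> \bar R) r :
  measurable_fun setT f -> measurable (subgraph f r).
Proof.
move=> mf.
rewrite (_ : subgraph f r = (fun x => (r, x)) @^-1` [set p : R * T | subgraph f p.1 p.2])//.
rewrite -[X in measurable X]setTI.
have mr : measurable_fun setT (fun x : T => (r, x)) by exact: measurable_fun_pair.
by apply: mr => //; exact: measurable_subgraph2.
Qed.

Lemma integral_indicT (A : set R) : measurable A ->
  \int[mu]_t (\1_A t)%:E = mu A.
Proof. by move=> mA; rewrite integral_indic//= setIT. Qed.

Lemma layer_cake T (f : T -> \bar R) x : 0 <= f x ->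
  \int[mu]_r (\1_(subgraph f r) x)%:E = f x.
Proof.
move=> f0.
transitivity (\int[mu]_r (\1_[set r : R | (0 <= r)%R /\ (r%:E < f x)%E] r)%:E).
  by apply: eq_integral => r _; congr EFin; exact: eq_indic.
case fx : (f x) => [y| |].
- rewrite (_ : [set r : R | _] = `[0%R, y[%classic); last first.
    by apply/seteqP; split=> r /=; rewrite in_itv/= lte_fin => /andP.
  rewrite integral_indicT// lebesgue_measure_itv/= lte_fin -EFinB subr0.
  by case: ltP => // y0; rewrite fx lee_fin in f0; congr EFin; apply/eqP; rewrite eq_le f0 y0.
- rewrite (_ : [set r : R | _] = `[0%R, +oo[%classic); last first.
    by apply/seteqP; split=> r /=; rewrite in_itv/= ltry andbT; [case|].
  by rewrite integral_indicT// lebesgue_measure_itv/= ltry.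
- by rewrite fx in f0.
Qed.

Lemma measurable_indicE d (T : measurableType d) (A : set T) : measurable A ->
  measurable_fun setT (fun x => (\1_A x)%:E : \bar R).
Proof. by move=> mA; apply/measurable_EFinP; exact: measurable_indic. Qed.

Lemma measurable_indic_comp d d' (T : measurableType d) (U : measurableType d')
    (A : set T) (f : U -> T) : measurable A -> measurable_fun setT f ->
  measurable_fun setT (fun x => (\1_A (f x))%:E : \bar R).
Proof.
move=> mA mf.
rewrite (_ : (fun x => _) = (fun x => (\1_(f @^-1` A) x)%:E)); last first.
  by apply/funext => x; congr EFin; exact: eq_indic.
by apply: measurable_indicE; rewrite -[X in measurable X]setTI; exact: mf.
Qed.

Lemma indicE_ge0 T (A : set T) x : 0 <= (\1_A x : R)%:E.
Proof. by rewrite lee_fin. Qed.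

Lemma itint_layer_cake (J : finType) s (f : vec R J -> \bar R) (x : vec R J) :
  measurable_fun setT f -> (forall y, 0 <= f y) ->
  itint s f x = \int[mu]_r itint s (fun y => (\1_(subgraph f r) y)%:E) x.
Proof.
move=> mf f0.
transitivity (itint s (fun y => \int[mu]_r (\1_(subgraph f r) y)%:E) x).
  by apply: eq_itint => y _; rewrite layer_cake.
symmetry; apply: (itint_integral lebesgue_measure _
  (g := fun p : R * vec R J => (\1_(subgraph f p.1) p.2)%:E)) => [|p].
- rewrite (_ : (fun p => _) = (fun p => (\1_[set p | subgraph f p.1 p.2] p)%:E)).
    by apply: measurable_indicE; exact: measurable_subgraph2.
  by apply/funext => p; congr EFin; exact: eq_indic.
- exact: indicE_ge0.
Qed.

End layer_cake.

Section convex_marginal.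
Context (R : realType) (J : finType).
Local Open Scope ereal_scope.
Notation mu := (@lebesgue_measure R).
Implicit Types (K : set (vec R J)) (x y : vec R J).

Definition vcomb (l : R) x y : vec R J := fun j => (l * x j + (1 - l) * y j)%R.

Definition convex_sym K :=
  (forall x y l, (0 <= l <= 1)%R -> K x -> K y -> K (vcomb l x y)) /\
  (forall x, K x -> K (vscale (-1) x)).

Lemma measurable_fiber K x i : measurable K -> measurable [set t | K (upd x i t)].
Proof.
move=> mK; have m : measurable_fun setT (fun t => upd x i t) by exact: measurable_upd.
by have := m measurableT _ mK; rewrite setTI.
Qed.

Lemma integral_fiber K x i : measurable K ->
  \int[mu]_t (\1_K (upd x i t))%:E = mu [set t | K (upd x i t)].
Proof.
move=> mK; rewrite -integral_indicT; last exact: measurable_fiber.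
by apply: eq_integral => t _; congr EFin; exact: eq_indic.
Qed.

(** Otherwise the set has diameter at most [r] and fits into a closed interval of length [r]. Two
    distant points are all that is needed of a long fibre, so convex fibres never have to be
    recognised as intervals. *)
Lemma lebesgue_gt_diam (A : set R) (r : R) : (0 <= r)%R -> measurable A ->
  r%:E < mu A -> exists a b, [/\ A a, A b & (r < b - a)%R].
Proof.
move=> r0 mA rA; apply: contrapT => nex.
have dA a b : A a -> A b -> (b - a <= r)%R.
  by move=> Aa Ab; rewrite leNgt; apply/negP => ?; apply: nex; exists a, b.
have A0 : A !=set0.
  apply/set0P/eqP => A0; move: rA; rewrite A0 measure0 lte_fin.
  by rewrite ltNge r0.
case: A0 => a0 Aa0.
have lA : has_lbound A by exists (a0 - r)%R => b Ab; have := dA _ _ Ab Aa0; lra.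
have sub : A `<=` `[inf A, (inf A + r)%R].
  move=> b Ab /=; rewrite in_itv/= ge_inf//=.
  rewrite -lerBlDr; apply: lb_le_inf; first by exists a0.
  by move=> a Aa; have := dA _ _ Aa Ab; lra.
have : mu A <= r%:E.
  have : mu A <= mu `[inf A, (inf A + r)%R] by apply: le_measure => //; rewrite inE.
  move=> /le_trans; apply.
  rewrite lebesgue_measure_itv/=; case: ifP => _; last by rewrite lee_fin.
  by rewrite -EFinB lee_fin addrAC subrr add0r.
by rewrite leNgt rA.
Qed.

Lemma upd_vcomb l x y i s t :
  vcomb l (upd x i s) (upd y i t) = upd (vcomb l x y) i (l * s + (1 - l) * t)%R.
Proof. by apply/funext => j; rewrite /vcomb /upd; case: (j == i). Qed.

(** One-dimensional Brunn-Minkowski in quasi-concave form: if both fibres contain points more than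
    [r] apart, the segments between them combine to a segment longer than [r] over the combined
    point. The reflection [t -> -t] carries the fibre at [-x] to the one at [x]. *)
Lemma convex_sym_subgraph_fiber K i (r : R) : measurable K -> convex_sym K ->
  convex_sym (subgraph (fun x => \int[mu]_t (\1_K (upd x i t))%:E) r).
Proof.
move=> mK [cK sK]; split=> [x y l l01 [r0 rx] [_ ry]|x [r0 rx]]; split => //.
  move: rx ry; rewrite !integral_fiber// => rx ry.
  have [a [b [/= Ka Kb rab]]] := lebesgue_gt_diam r0 (measurable_fiber x i mK) rx.
  have [c [d [/= Kc Kd rcd]]] := lebesgue_gt_diam r0 (measurable_fiber y i mK) ry.
  pose A := (l * a + (1 - l) * c)%R; pose B := (l * b + (1 - l) * d)%R.
  have rAB : (r < B - A)%R.
    have rm : (r < Num.min (b - a) (d - c))%R by rewrite lt_min rab rcd.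
    apply: (lt_le_trans rm); have [m1 m2] : (Num.min (b - a) (d - c) <= b - a /\
      Num.min (b - a) (d - c) <= d - c)%R by rewrite !ge_min !lexx orbT.
    by case/andP: l01 => l0 l1; rewrite /A /B; nra.
  have sub : `[A, B] `<=` [set t | K (upd (vcomb l x y) i t)].
    move=> t /=; rewrite in_itv/= => /andP[At tB].
    pose h := ((t - A) / (B - A))%R.
    have BA0 : (0 < B - A)%R by exact: le_lt_trans rAB.
    have h01 : (0 <= h <= 1)%R.
      by rewrite /h ler_pdivlMr// ler_pdivrMr// mul0r mul1r subr_ge0 At lerB.
    (* The same ratio [h] is used in both segments, so that [t] is the combination of one point over
       [x] and one over [y]. *)
    have -> : t = (l * (h * b + (1 - h) * a) + (1 - l) * (h * d + (1 - h) * c))%R.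
      suff -> : (l * (h * b + (1 - h) * a) + (1 - l) * (h * d + (1 - h) * c)
        = A + h * (B - A))%R by rewrite /h divfK ?gt_eqF// addrC subrK.
      by rewrite /A /B; ring.
    rewrite -upd_vcomb; apply: (cK _ _ l) => //.
      by have := cK _ _ _ h01 Kb Ka; rewrite upd_vcomb; congr K; congr upd;
        apply/funext => j; rewrite /vcomb -mulrDl addrC subrK mul1r.
    by have := cK _ _ _ h01 Kd Kc; rewrite upd_vcomb; congr K; congr upd;
        apply/funext => j; rewrite /vcomb -mulrDl addrC subrK mul1r.
  apply: (@lt_le_trans _ _ (mu `[A, B])); last first.
    by apply: le_measure => //; rewrite inE//; exact: measurable_fiber.
  rewrite lebesgue_measure_itv/= lte_fin -subr_gt0 (le_lt_trans r0 rAB).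
  by rewrite -EFinB lte_fin.
have mf z : measurable_fun setT (fun t => (\1_K (upd z i t))%:E : \bar R).
  by apply: measurable_indic_comp => //; exact: measurable_upd.
have f0 z t : 0 <= (\1_K (upd z i t) : R)%:E by exact: indicE_ge0.
have N1 : (-1 != 0 :> R)%R by rewrite oppr_eq0 oner_eq0.
rewrite -(integral_affine 0 N1 (mf _) (f0 _)).
rewrite normrN normr1 mul1e (lt_le_trans rx)// ge0_le_integral//.
- exact: mf.
- apply: measurable_indic_comp => //; apply: measurable_upd => //.
  by apply: measurable_funD => //; exact: measurable_funM.
move=> t _; rewrite !indicE lee_fin ler_nat.
case: (boolP (upd x i t \in K)) => // /set_mem Kt.
rewrite mem_set//= (_ : upd _ _ _ = vscale (-1) (upd x i t)); first exact: sK.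
by apply/funext => j; rewrite /vscale /upd addr0; case: (j == i).
Qed.

(* Peeling off the innermost coordinate replaces the indicator of K by the
   length of its fibres, which is even and quasi-concave. *)
Lemma le_itint_convex_sym (s : seq J) K x (tau : R) :
  measurable K -> convex_sym K -> (0 <= tau <= 1)%R ->
  itint s (fun y => (\1_K y)%:E) x <= itint s (fun y => (\1_K y)%:E) (vscale tau x).
Proof.
move=> + + tau01; elim/last_ind: s K => [|s i IH] K mK cK.
  rewrite /= !indicE lee_fin ler_nat; case: (boolP (x \in K)) => // /set_mem Kx.
  rewrite mem_set//.
  (* [tau x] is the combination of [x] and [-x] with weight [(1 + tau) / 2] on [x]. *)
  have h01 : (0 <= (1 + tau) / 2 <= 1)%R by case/andP: tau01 => *; apply/andP; split; lra.
  have := cK.1 _ _ _ h01 Kx (cK.2 _ Kx); congr K; apply/funext => j.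
  by rewrite /vcomb /vscale; field.
have mf : measurable_fun setT (itint [:: i] (fun y : vec R J => (\1_K y)%:E : \bar R)).
  by apply: measurable_itint1 => [|y]; [exact: measurable_indicE|exact: indicE_ge0].
have f0 y : 0 <= itint [:: i] (fun y : vec R J => (\1_K y)%:E : \bar R) y.
  by apply: itint_ge0 => z; exact: indicE_ge0.
rewrite -cats1 !itint_cat !itint_layer_cake//.
have msub (z : vec R J) : measurable_fun setT (fun r : R => itint s
    (fun y => (\1_(subgraph (itint [:: i] (fun y => (\1_K y)%:E)) r) y)%:E) z).
  apply: (@measurable_itint _ _ _ _ s
    (fun p : R * vec R J => (\1_(subgraph (itint [:: i] (fun y => (\1_K y)%:E)) p.1) p.2)%:E) (fun=> z)) => //.
  rewrite (_ : (fun p => _) = (fun p => (\1_[set p | subgraph (itint [:: i]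
      (fun y : vec R J => (\1_K y)%:E : \bar R)) p.1 p.2] p)%:E)).
    by apply: measurable_indicE; exact: measurable_subgraph2.
  by apply/funext => p; congr EFin; exact: eq_indic.
apply: ge0_le_integral => //; [|exact: msub|exact: msub|] => r _.
  by apply: itint_ge0 => y; exact: indicE_ge0.
by apply: IH; [exact: measurable_subgraph|exact: convex_sym_subgraph_fiber].
Qed.

End convex_marginal.

(** * One-dimensional rearrangement inequality *)

Section mform.
Context (R : realType) (I : finType) (kappa : vec R I -> \bar R).
Local Open Scope ereal_scope.
Notation mu := (@lebesgue_measure R).
Hypothesis mkappa : measurable_fun setT kappa.
Hypothesis kappa0 : forall t, 0 <= kappa t.

Implicit Types (f g : I -> R -> R).

(** One real variable per index. In the application these are the [i0] coordinates of the vectors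
    [X_e], their other coordinates being frozen, and [kappa] is the volume of a section in the
    variable [u]. *)
Definition mform (f : I -> R -> R) : \bar R :=
  itint (enum I) (fun t => (\prod_e f e (t e))%:E * kappa t) (fun=> 0%R).

Lemma measurable_prod_coord (P : pred I) (f : I -> R -> R) :
  (forall e, measurable_fun setT (f e)) ->
  measurable_fun setT (fun t : vec R I => \prod_(e | P e) f e (t e))%R.
Proof.
move=> mf; under eq_fun do rewrite -big_filter.
apply: measurable_prod => e _.
by apply: (measurableT_comp (mf e)); exact: measurable_coord.
Qed.

Lemma measurable_mform f : (forall e, measurable_fun setT (f e)) ->
  measurable_fun setT (fun t : vec R I => (\prod_e f e (t e))%:E * kappa t).
Proof.
move=> mf; apply: emeasurable_funM => //.
by apply/measurable_EFinP; exact: measurable_prod_coord.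
Qed.

Lemma mform_ge0 f : (forall e t, 0 <= f e t)%R ->
  forall t : vec R I, 0 <= (\prod_e f e (t e))%:E * kappa t.
Proof. by move=> f0 t; rewrite mule_ge0// lee_fin prodr_ge0. Qed.

Lemma le_mform f g :
  (forall e, measurable_fun setT (f e)) -> (forall e, measurable_fun setT (g e)) ->
  (forall e t, 0 <= f e t <= g e t)%R -> mform f <= mform g.
Proof.
move=> mf mg fg.
have f0 e t : (0 <= f e t)%R by case/andP: (fg e t).
have g0 e t : (0 <= g e t)%R by case/andP: (fg e t) => /le_trans; apply.
apply: le_itint; [exact: measurable_mform|exact: measurable_mform|
  exact: mform_ge0| |exact: mform_ge0].
move=> t _; apply: lee_wpmul2r => //; rewrite lee_fin; exact: ler_prod.
Qed.

End mform.

(** * Finite families of intervals *)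

Section intervals.
Context (R : realType).
Implicit Types (l : seq (R * R)) (p q : R * R).

(** A pair is a centre and a half-length. The indicators are added, not united, so that a form in
    such functions expands by multilinearity; for disjoint intervals, as in [ivgood], the sum is the
    indicator of the union. *)
Definition isum l (t : R) : R := \sum_(p <- l) (`|t - p.1| < p.2)%R%:R.

Definition ivord : rel (R * R) := fun p q => (p.1 + p.2 <= q.1 - q.2)%R.

Definition ivgood l := sorted ivord l /\ all (fun p => 0 < p.2) l.

Definition ivscale (tau : R) l := [seq (tau * p.1, p.2) | p <- l].

Lemma isum_ge0 l t : 0 <= isum l t.
Proof. by apply: sumr_ge0 => p _; rewrite ler0n. Qed.

Lemma measurable_iv (c a : R) :
  measurable_fun setT (fun t : R => (`|t - c| < a)%R%:R : R).
Proof.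
rewrite (_ : (fun t => _) = (\1_(`](c - a), (c + a)[%classic) : R -> R)).
  exact: measurable_indic.
apply/funext => t; rewrite indicE.
suff -> : (`|t - c| < a) = (t \in `](c - a), (c + a)[%classic) by [].
by rewrite ltr_distl; apply/idP/idP; rewrite inE/= in_itv.
Qed.

Lemma measurable_isum l : measurable_fun setT (isum l).
Proof. by apply: measurable_sum => p; exact: measurable_iv. Qed.

Lemma isum_path0 p l t : path ivord p l -> all (fun p => 0 < p.2) l ->
  t <= p.1 + p.2 -> isum l t = 0.
Proof.
elim: l p => [|q l IH] p /=; first by rewrite /isum big_nil.
move=> /andP[pq ql] /andP[q0 l0] tp; rewrite /isum big_cons.
rewrite -/(isum l t) (IH q)//; last by move: pq; rewrite /ivord; lra.
rewrite addr0 ltr_distl; move: pq; rewrite /ivord => pq.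
by rewrite ltNge (le_trans tp).
Qed.

Lemma isum_le1 l t : ivgood l -> isum l t <= 1.
Proof.
elim: l => [|p l IH] [sl al]; first by rewrite /isum big_nil.
rewrite /isum big_cons -/(isum l t); move: al => /= /andP[p0 l0].
have [tp|_] := boolP (`|t - p.1| < p.2).
  rewrite (isum_path0 sl l0) ?addr0//; move: tp; rewrite ltr_distl => /andP[_].
  exact: ltW.
by rewrite add0r IH//; split => //; exact: path_sorted sl.
Qed.

Definition adj l := zip l (behead l).

Lemma adjP p q l : (p, q) \in adj l -> exists l1 l2, l = l1 ++ p :: q :: l2.
Proof.
elim: l => [//|a [|b l]] IH; first by [].
rewrite /adj /= inE => /orP[/eqP[-> ->]|/IH[l1 [l2 ->]]]; first by exists [::], l.
by exists (a :: l1), l2.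
Qed.

Lemma sorted_adj (r : rel (R * R)) l :
  (forall p q, (p, q) \in adj l -> r p q) -> sorted r l.
Proof.
elim: l => [//|a [//|b l]] IH H.
rewrite /= H ?mem_head//=; apply: IH => p q pq; apply: H.
by rewrite /adj /= inE pq orbT.
Qed.

Lemma adj_sorted (r : rel (R * R)) l p q : sorted r l -> (p, q) \in adj l -> r p q.
Proof.
elim: l => [//|a [//|b l]] IH /= /andP[ab bl].
rewrite /adj/= inE => /orP[/eqP[-> ->//]|]; exact: IH.
Qed.

Lemma adj_mem l p q : (p, q) \in adj l -> (p \in l) && (q \in l).
Proof.
by move=> /adjP[l1 [l2 ->]]; rewrite !mem_cat !inE !eqxx !orbT.
Qed.

Lemma adj_map f l : adj (map f l) = [seq (f pq.1, f pq.2) | pq <- adj l].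
Proof. by elim: l => [//|a [//|b l]] IH; rewrite /adj/= -/(adj (b :: l)) -IH. Qed.

Lemma seq_argmax (T : eqType) (f : T -> R) (s : seq T) : s != [::] ->
  exists2 x, x \in s & forall y, y \in s -> f y <= f x.
Proof.
elim: s => [//|a [|b s]] IH _.
  by exists a; rewrite ?mem_head// => y; rewrite inE => /eqP ->.
have [x xs Hx] := IH isT.
have [ax|xa] := leP (f a) (f x).
  exists x; first by rewrite inE xs orbT.
  by move=> y; rewrite inE => /orP[/eqP ->//|]; exact: Hx.
exists a; first by rewrite mem_head.
move=> y; rewrite inE => /orP[/eqP ->//|/Hx /le_trans]; apply; exact: ltW.
Qed.

End intervals.

Section slide.
Context (R : realType) (I : finType) (kappa : vec R I -> \bar R).
Local Open Scope ereal_scope.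
Hypothesis mkappa : measurable_fun setT kappa.
Hypothesis kappa0 : forall t, 0 <= kappa t.

(** The geometric property asked of the kernel. A single factor [tau] moves all the centres, so the
    box slides along a ray towards the origin. *)
Definition box_monotone := forall (c a : I -> R) (tau : R), (0 <= tau <= 1)%R ->
  mform kappa (fun e t => (`|t - c e| < a e)%R%:R) <=
  mform kappa (fun e t => (`|t - tau * c e| < a e)%R%:R).

Hypothesis bk : box_monotone.

Implicit Types (l : I -> seq (R * R)).

Definition fupd T (l : I -> T) (e : I) (x : T) : I -> T :=
  fun e' => if e' == e then x else l e'.

Lemma mform_isum l e0 :
  mform kappa (fun e => isum (l e)) =
  \sum_(p <- l e0) mform kappa (fun e => isum (fupd l e0 [:: p] e)).
Proof.
rewrite /mform -itint_sum.
- apply: eq_itint => t _.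
  have -> : (\prod_e isum (l e) (t e))%:E =
      \sum_(p <- l e0) (\prod_e isum (fupd l e0 [:: p] e) (t e))%:E.
    rewrite sumEFin; congr EFin.
    rewrite (bigD1 e0)//= {1}/isum mulr_suml; apply: eq_bigr => p _.
    rewrite [RHS](bigD1 e0)//= /fupd eqxx /isum big_seq1; congr (_ * _)%R.
    by apply: eq_bigr => e /negbTE ->.
  rewrite ge0_sume_distrl// => p _; rewrite lee_fin.
  by apply: prodr_ge0 => e _; exact: isum_ge0.
- move=> p; apply: (measurable_mform mkappa (f := fun e => isum (fupd l e0 [:: p] e))) => e; exact: measurable_isum.
- move=> p t; apply: (mform_ge0 kappa0 (f := fun e => isum (fupd l e0 [:: p] e))) => e x; exact: isum_ge0.
Qed.

(** Expanding one list at a time leaves forms in single intervals, to which [box_monotone] applies.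
    The list [u] collects the indices still to be expanded. *)
Lemma mform_ivscale l tau : (0 <= tau <= 1)%R ->
  mform kappa (fun e => isum (l e)) <=
  mform kappa (fun e => isum (ivscale tau (l e))).
Proof.
move=> tau01.
suff : forall (u : seq I) l, (forall e, e \notin u -> exists p, l e = [:: p]) ->
   mform kappa (fun e => isum (l e)) <=
   mform kappa (fun e => isum (ivscale tau (l e))).
  by move=> /(_ (enum I)); apply => e; rewrite mem_enum.
elim=> [|e0 u IH] {}l Hl.
  have /choice[p lp] : forall e, exists p, l e = [:: p] by move=> e; exact: Hl.
  have -> : (fun e => isum (l e)) = (fun e t => (`|t - (p e).1| < (p e).2)%R%:R).
    by apply/funext => e; apply/funext => t; rewrite lp /isum big_seq1.
  have -> : (fun e => isum (ivscale tau (l e))) =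
      (fun e t => (`|t - tau * (p e).1| < (p e).2)%R%:R).
    by apply/funext => e; apply/funext => t; rewrite lp /isum big_seq1.
  exact: bk.
rewrite (mform_isum l e0) (mform_isum _ e0) big_map; apply: lee_sum => p _.
have -> : (fun e => isum (fupd (fun e => ivscale tau (l e)) e0 [:: (tau * p.1, p.2)%R] e)) =
   (fun e => isum (ivscale tau (fupd l e0 [:: p] e))).
  by apply/funext => e; rewrite /fupd; case: (e == e0).
apply: IH => e eu; rewrite /fupd; case: eqVneq => [_|ee0]; first by exists p.
by apply: Hl; rewrite inE negb_or ee0.
Qed.

(* Scale the centres by the largest tau < 1 at which two neighbouring
   intervals touch, merge them, and induct on the number of intervals. *)
Lemma mform_intervals l : (forall e, ivgood (l e)) ->
  mform kappa (fun e => isum (l e)) <=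
  mform kappa (fun e t => (`|t| < \sum_(p <- l e) p.2)%R%:R).
Proof.
have [N] := ubnP (\sum_e size (l e))%N; elim: N l => [//|N IH] l lN gl.
pose P := [seq (e, pq) | e <- enum I, pq <- adj (l e)].
have memP e pq : pq \in adj (l e) -> (e, pq) \in P.
  by move=> h; apply/allpairsPdep; exists e, pq; rewrite mem_enum.
(* No index has two intervals: sliding all the way, with [tau = 0], centres them. *)
have [P0|P0] := eqVneq P [::].
  have z01 : (0 <= (0 : R) <= 1)%R by rewrite lexx ler01.
  apply: (le_trans (mform_ivscale l z01)); apply: le_mform => // [e|e|e t].
  - exact: measurable_isum.
  - have := measurable_iv (0 : R) (\sum_(p <- l e) p.2).
    by under eq_fun do rewrite subr0.
  rewrite isum_ge0/=; case le : (l e) => [|p [|q r]].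
  - by rewrite /isum /= big_nil ler0n.
  - by rewrite /isum !big_seq1 /= mul0r subr0.
  - have : (p, q) \in adj (l e) by rewrite le /adj /= mem_head.
    by move=> /memP; rewrite P0.
(* The factor at which the two intervals touch. As [tau] decreases from 1, the first contact occurs
   at the largest ratio, and until then the order within every list is kept. *)
pose ratio (x : I * ((R * R) * (R * R))) :=
  ((x.2.1.2 + x.2.2.2) / (x.2.2.1 - x.2.1.1))%R.
have [[e0 [p q]] Pe0 maxr] := seq_argmax ratio P0.
have ad0 : (p, q) \in adj (l e0).
  by move/allpairsPdep: Pe0 => [e' [pq' [_ h [-> ->]]]].
have adE e p' q' : (p', q') \in adj (l e) ->
    [/\ 0 < p'.2, 0 < q'.2 & p'.1 + p'.2 <= q'.1 - q'.2]%R.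
  move=> h; have [sl al] := gl e; have /andP[pl ql] := adj_mem h.
  by split; [exact: (allP al)|exact: (allP al)|exact: (adj_sorted sl h)].
pose tau := ratio (e0, (p, q)).
have [p0 q0 pq0] := adE _ _ _ ad0.
have qp0 : (0 < q.1 - p.1)%R by lra.
have tauE : (tau * (q.1 - p.1) = p.2 + q.2)%R.
  by rewrite /tau /ratio /= divfK// gt_eqF.
have tau01 : (0 <= tau <= 1)%R.
  by rewrite /tau /ratio /= ler_pdivlMr// ler_pdivrMr//; apply/andP; split; lra.
apply: (le_trans (mform_ivscale l tau01)).
have [l1 [l2 le0]] := adjP ad0.
pose m : R * R := ((tau * p.1 - p.2 + (tau * q.1 + q.2)) / 2, p.2 + q.2)%R.
pose l' := fupd (fun e => ivscale tau (l e)) e0 (ivscale tau l1 ++ m :: ivscale tau l2).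
have gs e : ivgood (ivscale tau (l e)).
  split.
    apply: sorted_adj => a b; rewrite adj_map => /mapP[[a' b'] ab [-> ->]] /=.
    rewrite /ivord /=; have [a0 b0 ab0] := adE _ _ _ ab.
    have := maxr (e, (a', b')) (memP _ _ ab); rewrite -/tau /ratio /=.
    by rewrite ler_pdivrMr; lra.
  by rewrite all_map; have [_] := gl e.
have sz : (\sum_e size (l' e) < \sum_e size (l e))%N.
  rewrite [X in (_ < X)%N](bigD1 e0)//= [X in (X < _)%N](bigD1 e0)//=.
  rewrite -addSn; apply: leq_add.
    by rewrite /l' /fupd eqxx le0 !size_cat/= !size_map !addnS.
  by apply: leq_sum => e /negbTE h; rewrite /l' /fupd h size_map.
have gl' e : ivgood (l' e).
  rewrite /l' /fupd; case: eqVneq => [ee0|_]; last exact: gs.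
  have [sg ag] := gs e0; move: sg ag; rewrite le0 /ivscale map_cat /= => sg ag.
  have mE1 : (m.1 - m.2 = tau * p.1 - p.2)%R by rewrite /m /=; lra.
  have mE2 : (m.1 + m.2 = tau * q.1 + q.2)%R by rewrite /m /=; lra.
  split; last first.
    move: ag; rewrite !all_cat /= => /and4P[-> _ _ ->].
    by rewrite andbT /= addr_gt0.
  move: sg; case: (l1) => [|a l1'] /=.
    by case: (l2) => [|b l2'] //= /and3P[_]; rewrite /ivord /= mE2 => -> ->.
  rewrite !cat_path /= => /and4P[-> h1 h2 h3] /=.
  rewrite {1}/ivord mE1; move: h1; rewrite {1}/ivord/= => ->/=.
  by move: h3; case: (l2) => [|b l2'] //=; rewrite /ivord /= mE2.
have -> : (fun e (t : R) => (`|t| < \sum_(p <- l e) p.2)%R%:R : R) =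
   (fun e (t : R) => (`|t| < \sum_(p <- l' e) p.2)%R%:R).
  apply/funext => e; apply/funext => t; congr ((_ < _)%R%:R).
  rewrite /l' /fupd; case: eqVneq => [->|_]; last by rewrite big_map.
  by rewrite le0 !big_cat /= !big_cons !big_map /=; ring.
apply: le_trans (IH l' _ gl'); last exact: leq_trans sz _.
apply: le_mform => // [e|e|e t]; [exact: measurable_isum|exact: measurable_isum|].
rewrite isum_ge0 /= /l' /fupd; case: eqVneq => [->|_//].
rewrite le0 /ivscale map_cat /= /isum !big_cat /= !big_cons /= lerD2l addrA lerD2r.
(* The merged interval contains the two scaled ones, which are disjoint, and also the point at which
   they touch. *)
have touch : (tau * p.1 + p.2 = tau * q.1 - q.2)%R by lra.
rewrite !ltr_distl -natrD ler_nat.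
case: (boolP (tau * p.1 - p.2 < t < tau * p.1 + p.2)%R) => [/andP[h1 h2]|_];
case: (boolP (tau * q.1 - q.2 < t < tau * q.1 + q.2)%R) => [/andP[h3 h4]|_] //=.
- lra.
- by rewrite addn0 lt0b; apply/andP; split; lra.
- by rewrite add0n lt0b; apply/andP; split; lra.
Qed.

End slide.

(** * Approximation in measure by intervals *)

Section approx.
Context (R : realType).
Local Open Scope ereal_scope.
Notation mu := (@lebesgue_measure R).

Lemma lebesgue_iv (c a : R) : (0 <= a)%R ->
  \int[mu]_t ((`|t - c| < a)%R%:R)%:E = (2 * a)%:E.
Proof.
move=> a0; transitivity (\int[mu]_t (\1_(`](c - a)%R, (c + a)%R[%classic) t)%:E).
  apply: eq_integral => t _; rewrite indicE; congr EFin.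
  suff -> : (`|t - c| < a)%R = (t \in `](c - a)%R, (c + a)%R[%classic) by [].
  by rewrite ltr_distl; apply/idP/idP; rewrite inE/= in_itv.
rewrite integral_indicT// lebesgue_measure_itv/= lte_fin.
have -> : (c - a < c + a)%R = (0 < a)%R by apply/idP/idP; lra.
by case: ltP => h; rewrite -?EFinB; congr EFin; lra.
Qed.

Lemma integral_isum (l : seq (R * R)) : all (fun p => 0 < p.2)%R l ->
  \int[mu]_t (isum l t)%:E = (2 * \sum_(p <- l) p.2)%:E.
Proof.
elim: l => [_|p l IH /= /andP[p0 l0]].
  rewrite big_nil mulr0; under eq_integral do rewrite /isum big_nil.
  by rewrite integral0.
have m1 : measurable_fun setT (fun t : R => ((`|t - p.1| < p.2)%R%:R : R)%:E).
  by apply/measurable_EFinP; exact: measurable_iv.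
have m2 : measurable_fun setT (fun t : R => (isum l t)%:E).
  by apply/measurable_EFinP; exact: measurable_isum.
have p1 (t : R) : setT t -> 0 <= ((`|t - p.1| < p.2)%R%:R : R)%:E by rewrite lee_fin.
have p2 (t : R) : setT t -> 0 <= (isum l t)%:E by rewrite lee_fin isum_ge0.
rewrite big_cons mulrDr EFinD -IH// -(lebesgue_iv p.1 (ltW p0)).
rewrite -(ge0_integralD lebesgue_measure measurableT p1 m1 p2 m2).
by apply: eq_integral => t _; rewrite -EFinD /isum big_cons.
Qed.

(** The mesh is [1 / (N + 1)]. The [2 N (N + 1)] cells start at [-N] and fill [[-N, N]] up to the
    grid points, which open cells miss. *)
Let cell (N j : nat) : R * R :=
  (((j%:R + 2^-1) / N.+1%:R - N%:R)%R, (2^-1 / N.+1%:R)%R).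

Let cells (U : set R) N := [seq cell N j | j <- [seq j <- iota 0 (2 * N * N.+1) |
  `[< forall t, (`|t - (cell N j).1| < (cell N j).2)%R -> U t >]]].

Let cells_good U N : ivgood (cells U N).
Proof.
split; last by rewrite all_map; apply/allP => j _ /=; rewrite divr_gt0.
rewrite /cells.
have srt : sorted ltn [seq j <- iota 0 (2 * N * N.+1) |
  `[< forall t, (`|t - (cell N j).1| < (cell N j).2)%R -> U t >]].
  by apply: sorted_filter; [exact: ltn_trans|exact: iota_ltn_sorted].
apply: homo_sorted srt => i j ij; rewrite /ivord /cell /=.
have h : (i%:R + 1 <= j%:R :> R)%R by rewrite natr1 ler_nat.
have n0 : (0 < N.+1%:R^-1 :> R)%R by rewrite invr_gt0.
by have := ler_wpM2r (ltW n0) h; set k := (N.+1%:R^-1)%R; lra.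
Qed.

Let isum_cells_le U N t : (isum (cells U N) t)%:E <= (\1_U t)%:E.
Proof.
rewrite lee_fin indicE; have [Ut|nU] := pselect (U t).
  by rewrite mem_set//; exact: isum_le1 (cells_good U N).
rewrite memNset// /isum big_seq big1// => p /mapP[j].
rewrite mem_filter => /andP[/asboolP H _] ->.
by apply/eqP; rewrite pnatr_eq0 eqb0; apply/negP => /H.
Qed.

Let grid : set R := [set t | exists p : nat * nat, t = (p.2%:R / p.1.+1%:R - p.1%:R)%R].

Let grid0 : measurable grid /\ mu grid = 0.
Proof.
have cg : countable grid.
  have -> : grid = (fun p : nat * nat => p.2%:R / p.1.+1%:R - p.1%:R)%R @` setT.
    by apply/seteqP; split=> [t [p ->]|t [p _ <-]]; [exists p|exists p].
  by apply: sub_countable (card_image_le _ _) _; exact: countableP.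
split; last exact: countable_lebesgue_measure0.
exact: countable_measurable.
Qed.

(** Once [N] exceeds [|t|] and the mesh is below [r], the cell containing [t] lies within distance
    [r] of [t], hence in [U]. Its number is the integer part of [(t + N) (N + 1)]. *)
Let cells_near (U : set R) t : open U -> U t -> ~ grid t ->
  \forall N \near \oo, (1 <= isum (cells U N) t)%R.
Proof.
move=> oU Ut ngt.
have [r /= r0 rU] : nbhs t U by exact: open_nbhs_nbhs.
near=> N.
have Nt : (`|t| < N%:R)%R.
  by near: N; exact: nbhs_infty_gtr.
have Nr : (N.+1%:R^-1 < r)%R.
  rewrite invf_plt ?posrE//; apply: (@lt_trans _ _ N%:R); last by rewrite ltr_nat.
  by near: N; exact: nbhs_infty_gtr.
move: Nt; rewrite ltr_norml => /andP[t1 t2].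
pose y := ((t + N%:R) * N.+1%:R)%R.
have N0 : (0 < N.+1%:R :> R)%R by [].
have y0 : (0 <= y)%R by rewrite mulr_ge0//; lra.
have /andP[jy yj] := truncn_itv y0.
set j := Num.truncn y in jy yj.
have tE : (t = y / N.+1%:R - N%:R)%R by rewrite /y mulfK ?gt_eqF// addrK.
have jy' : (j%:R < y)%R.
  rewrite lt_neqAle jy andbT; apply/eqP => E; apply: ngt; exists (N, j) => /=.
  by rewrite E.
have tcell : (`|t - (cell N j).1| < (cell N j).2)%R.
  have n0 : (0 < N.+1%:R^-1 :> R)%R by rewrite invr_gt0.
  rewrite /cell /= ltr_distl {1 2}tE; move: yj; rewrite -natr1 => yj.
  rewrite -(ltr_pM2r n0) in jy'; rewrite -(ltr_pM2r n0) in yj.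
  by move: jy' yj; set k := (N.+1%:R^-1)%R => *; apply/andP; split; lra.
have jin : cell N j \in cells U N.
  apply/mapP; exists j => //; rewrite mem_filter mem_iota add0n leq0n /=.
  apply/andP; split.
    apply/asboolP => u /= hu; apply: rU; rewrite /ball/=.
    pose c : R := ((j%:R + 2^-1) / N.+1%:R - N%:R)%R.
    move: tcell hu; rewrite /cell/= -/c => h1 h2.
    have -> : (t - u = (t - c) - (u - c))%R by ring.
    apply: (le_lt_trans (ler_normB _ _)); apply: lt_trans Nr.
    by move: h1 h2; set k := (N.+1%:R^-1)%R => *; lra.
  rewrite -(ltr_nat R) (le_lt_trans jy)// /y natrM natrM.
  by rewrite ltr_pM2r//; lra.
rewrite /isum (big_rem _ jin)/= tcell lerDl; apply: sumr_ge0 => p _.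
by rewrite ler0n.
Unshelve. all: by end_near.
Qed.

(** The intervals are grid cells inside an open [U] that contains [B] and is only slightly larger.
    They need neither cover [B] nor lie in it: little of [B] is missed, and the total length hardly
    exceeds the measure of [B]. *)
Lemma interval_approx (B : set R) (eta : R) : measurable B -> mu B < +oo ->
  (0 < eta)%R -> exists l, [/\ ivgood l,
    mu (B `\` [set t | (1 <= isum l t)%R]) <= eta%:E &
    (2 * \sum_(p <- l) p.2)%:E <= mu B + eta%:E].
Proof.
move=> mB Bfin eta0.
have [U [oU BU UB]] := lebesgue_regularity_outer mB Bfin eta0.
have mU : measurable U by exact: open_measurable.
have [mg g0] := grid0.
pose W N := [set t | (1 <= isum (cells U N) t)%R].
have mW N : measurable (W N).
  rewrite -[W N]setTI; apply: measurable_fun_le => //; exact: measurable_isum.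
(* Points that stay covered from stage [N] on. These sets increase, so continuity from below applies
   to them. *)
pose F N := (B `\` grid) `&` \bigcap_(M in [set M | (N <= M)%N]) W M.
have mF N : measurable (F N).
  apply: measurableI; first exact: measurableD.
  by apply: bigcap_measurable => //; exists N => /=.
have FU : \bigcup_N F N = B `\` grid.
  apply/seteqP; split=> [t [N _ []]//|t [Bt gt]].
  have [N _ HN] := cells_near oU (BU _ Bt) gt.
  by exists N => //; split => // M /= NM; exact: HN.
have ndF : nondecreasing_seq F.
  move=> m n mn; apply/subsetPset => t [? H]; split => // M /= nM; apply: H => /=.
  exact: leq_trans nM.
have cvF : (mu \o F) N @[N --> \oo] --> mu B.
  have -> : mu B = mu (\bigcup_N F N).
    rewrite FU measureD//= (_ : mu (B `&` grid) = 0) ?sube0//.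
    by apply: (@subset_measure0 _ _ _ mu _ grid) => //; exact: measurableI.
  apply: nondecreasing_cvg_mu => //; rewrite FU; exact: measurableD.
have [N HN] : exists N, mu B - eta%:E < mu (F N).
  have Bf : mu B \is a fin_num by rewrite ge0_fin_numE.
  have : mu B - eta%:E < mu B by rewrite lteBlDr// lteDl.
  move=> lt; apply: contrapT => nex; move: lt; rewrite ltNge => /negP; apply.
  rewrite -[leLHS](cvg_lim _ cvF)//; apply: lime_le; first by apply/cvg_ex; eexists; exact: cvF.
  by apply: nearW => N /=; rewrite leNgt; apply/negP => h; apply: nex; exists N.
exists (cells U N); split; first exact: cells_good.
  have sub : B `\` W N `<=` B `\` F N.
    by move=> t [Bt nW]; split => // -[_ H]; apply: nW; exact: (H N (leqnn N)).
  apply: (@le_trans _ _ (mu (B `\` F N))).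
    by apply: le_measure => //; rewrite inE; apply: measurableD => //; [exact: mW|exact: mF].
  have BF : B `&` F N = F N by rewrite setIidr// => t [[]].
  rewrite measureD//; [|exact: mF]; rewrite BF.
  have leF : mu (F N) <= mu B.
    by apply: le_measure => //; rewrite ?inE; [exact: mF|exact: mB|move=> t [[]]].
  have fF : mu (F N) \is a fin_num by rewrite ge0_fin_numE// (le_lt_trans leF).
  rewrite leeBlDr//.
  by rewrite ltW// -lteBlDl.
rewrite -integral_isum; last by have [] := cells_good U N.
apply: (@le_trans _ _ (\int[mu]_t (\1_U t)%:E)).
  apply: ge0_le_integral => //.
  - by move=> t _; rewrite lee_fin isum_ge0.
  - by apply/measurable_EFinP; exact: measurable_isum.
  - exact: measurable_indicE.
rewrite integral_indicT//.
have -> : U = B `|` (U `\` B) by rewrite setDUK.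
rewrite measureU//=; [|exact: measurableD|by rewrite setDIK].
by rewrite leeD2l// ltW.
Qed.

End approx.

(** If every [t e] lies in [B e] but some [t e] is not in [W e], the summand of that index equals
    1. *)
Lemma prod_indic_telescope (R : realType) (I : finType) T (B W : I -> set T)
    (t : I -> T) :
  \prod_e \1_(B e) (t e) <= \prod_e \1_(W e) (t e) +
  \sum_e \prod_e' (if e' == e then \1_(B e `\` W e) (t e') else \1_(B e') (t e')) :> R.
Proof.
have S0 : 0 <= \sum_e \prod_e' (if e' == e then \1_(B e `\` W e) (t e')
    else \1_(B e') (t e')) :> R.
  by apply: sumr_ge0 => e _; apply: prodr_ge0 => e' _; case: ifP.
have P0 (A : I -> set T) : 0 <= \prod_e \1_(A e) (t e) :> R by apply: prodr_ge0.
have [Ball|/existsNP[e nB]] := pselect (forall e, B e (t e)); last first.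
  rewrite (bigD1 e)//= indicE memNset//= mul0r; exact: addr_ge0.
have [Wall|/existsNP[e nW]] := pselect (forall e, W e (t e)).
  rewrite big1 => [|e _]; last by rewrite indicE mem_set.
  by rewrite big1 ?lerDl// => e _; rewrite indicE mem_set.
rewrite [leLHS]big1 => [|e' _]; last by rewrite indicE mem_set.
apply: (@le_trans _ _ (\sum_e \prod_e' (if e' == e then \1_(B e `\` W e) (t e')
    else \1_(B e') (t e')))); last by rewrite lerDr.
rewrite (bigD1 e)//= [X in X + _]big1 => [|e' _].
  by rewrite lerDl; apply: sumr_ge0 => e' _; apply: prodr_ge0 => e'' _; case: ifP.
by case: eqVneq => [->|_]; rewrite indicE mem_set.
Qed.

Section itint_prod_le.
Context (R : realType) (I : finType).
Local Open Scope ereal_scope.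
Notation mu := (@lebesgue_measure R).

(** An upper bound suffices, since such products only occur in error terms and in bounds for kernels
    and volumes. *)
Lemma itint_prod_le (s : seq I) (f : I -> R -> R) (D : I -> R) (z : vec R I) :
  uniq s -> (forall e, measurable_fun setT (f e)) ->
  (forall e t, 0 <= f e t)%R ->
  (forall e, \int[mu]_t (f e t)%:E <= (D e)%:E) ->
  itint s (fun t => (\prod_(e <- s) f e (t e))%:E) z <= (\prod_(e <- s) D e)%:E.
Proof.
move=> us mf f0 fD.
have D0 e : (0 <= D e)%R.
  rewrite -lee_fin (le_trans _ (fD e))//; apply: integral_ge0 => t _.
  by rewrite lee_fin.
have mP s' : measurable_fun setT (fun t : vec R I => (\prod_(e <- s') f e (t e))%:E).
  apply/measurable_EFinP; apply: measurable_prod => e _.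
  by apply: (measurableT_comp (mf e)); exact: measurable_coord.
have P0 s' (t : vec R I) : 0 <= (\prod_(e <- s') f e (t e))%:E.
  by rewrite lee_fin prodr_ge0.
elim: s z us => [|i s IH] z /=; first by rewrite !big_nil.
move=> /andP[si us].
have stepE t : itint s (fun t => (\prod_(e <- i :: s) f e (t e))%:E) (upd z i t) =
    (f i t)%:E * itint s (fun t => (\prod_(e <- s) f e (t e))%:E) (upd z i t).
  rewrite -itintZ//; last by rewrite lee_fin.
  apply: eq_itint => y yz; rewrite big_cons EFinM yz// updE//.
under eq_integral do rewrite stepE.
apply: (@le_trans _ _ (\int[mu]_t ((f i t)%:E * (\prod_(e <- s) D e)%:E))).
  apply: ge0_le_integral => //.
  - by move=> t _; rewrite mule_ge0 ?lee_fin//; apply: itint_ge0.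
  - apply: emeasurable_funM; first by apply/measurable_EFinP; exact: mf.
    exact: measurable_itint_upd.
  - by apply: emeasurable_funM => //; apply/measurable_EFinP; exact: mf.
  - by move=> t _; rewrite lee_wpmul2l ?lee_fin//; exact: IH.
rewrite ge0_integralZr//; [|by apply/measurable_EFinP; exact: mf|by move=> t _; rewrite lee_fin|
  by rewrite lee_fin prodr_ge0].
by rewrite big_cons EFinM lee_wpmul2r// lee_fin prodr_ge0.
Qed.

End itint_prod_le.

Section rearrangement1d.
Context (R : realType) (I : finType) (kappa : vec R I -> \bar R) (C : R).
Local Open Scope ereal_scope.
Notation mu := (@lebesgue_measure R).
Hypothesis mkappa : measurable_fun setT kappa.
Hypothesis kappa0 : forall t, 0 <= kappa t.
Hypothesis kappaC : forall t, kappa t <= C%:E.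

Implicit Types B W : I -> set R.

(** Each summand of the error has one factor of measure at most [eta] and other factors of measure
    at most [D], and the kernel is at most [C]. Since [1 <= D], the exponent may be rounded up to
    [#|I|]. *)
Lemma mform_telescope B W (eta D : R) :
  (forall e, measurable (B e)) -> (forall e, measurable (W e)) ->
  (forall e, mu (B e) <= D%:E) -> (forall e, mu (B e `\` W e) <= eta%:E) ->
  (1 <= D)%R -> (0 <= eta)%R ->
  mform kappa (fun e => \1_(B e)) <= mform kappa (fun e => \1_(W e)) +
    (#|I|%:R * (C * (eta * D ^+ #|I|)))%:E.
Proof.
move=> mB mW BD BW D1 eta0.
have C0 : (0 <= C)%R by rewrite -lee_fin (le_trans _ (kappaC (fun=> 0%R))).
pose g e e' : R -> R := if e' == e then \1_(B e `\` W e) else \1_(B e').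
have mg e e' : measurable_fun setT (g e e').
  by rewrite /g; case: eqP => _; apply: measurable_indic => //; exact: measurableD.
have g0 e e' t : (0 <= g e e' t)%R by rewrite /g; case: ifP.
pose G (t : vec R I) := \sum_e (C * \prod_e' g e e' (t e'))%:E.
have mprod e : measurable_fun setT (fun t : vec R I => \prod_e' g e e' (t e'))%R.
  exact: measurable_prod_coord.
have mG e : measurable_fun setT (fun t : vec R I => (C * \prod_e' g e e' (t e'))%:E).
  by apply/measurable_EFinP; apply: measurable_funM => //; exact: mprod.
have G0 e (t : vec R I) : 0 <= (C * \prod_e' g e e' (t e'))%:E.
  by rewrite lee_fin mulr_ge0// prodr_ge0.
have mW' : measurable_fun setT
    (fun t : vec R I => (\prod_e \1_(W e) (t e))%:E * kappa t).
  apply: (measurable_mform mkappa (f := fun e => \1_(W e))) => e.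
  exact: measurable_indic.
have W0 : forall t : vec R I, 0 <= (\prod_e \1_(W e) (t e))%:E * kappa t.
  exact: (mform_ge0 kappa0 (f := fun e => \1_(W e))).
apply: (@le_trans _ _ (itint (enum I) (fun t : vec R I =>
    (\prod_e \1_(W e) (t e))%:E * kappa t + G t) (fun=> 0%R))).
  apply: le_itint.
  - apply: (measurable_mform mkappa (f := fun e => \1_(B e))) => e.
    exact: measurable_indic.
  - by apply: emeasurable_funD => //; apply: emeasurable_sum => e; exact: mG.
  - exact: (mform_ge0 kappa0 (f := fun e => \1_(B e))).
  - move=> t _; apply: (@le_trans _ _ (((\prod_e \1_(W e) (t e)) +
       \sum_e \prod_e' g e e' (t e'))%:E * kappa t)).
      apply: lee_wpmul2r => //; rewrite lee_fin.
      have := prod_indic_telescope R B W t; congr (_ <= _ + _)%R.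
      by apply: eq_bigr => e _; apply: eq_bigr => e' _; rewrite /g; case: ifP.
    rewrite EFinD ge0_muleDl ?lee_fin ?prodr_ge0//; last first.
      by rewrite sumr_ge0// => e _; rewrite prodr_ge0.
    rewrite leeD2l// /G sumEFin -mulr_sumr EFinM muleC lee_wpmul2r//.
    by rewrite lee_fin sumr_ge0// => e _; rewrite prodr_ge0.
  - by move=> t; rewrite adde_ge0// sume_ge0.
rewrite itintD//; [|exact: emeasurable_sum|by move=> t; exact: sume_ge0].
rewrite leeD2l// itint_sum//.
have -> : (#|I|%:R * (C * (eta * D ^+ #|I|)))%:E =
    \sum_(e : I) (C * (eta * D ^+ #|I|))%:E.
  by rewrite sumEFin sumr_const mulr_natl.
apply: lee_sum => e _; under eq_itint do rewrite EFinM.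
rewrite itintZ//; [|by apply/measurable_EFinP; exact: mprod|by move=> t; rewrite lee_fin prodr_ge0].
rewrite EFinM lee_wpmul2l ?lee_fin//.
have := @itint_prod_le R I (enum I) (g e) (fun e' => if e' == e then eta else D)
  (fun=> 0%R) (enum_uniq _) (mg e) (g0 e).
have -> : (fun t : vec R I => (\prod_(e' <- enum I) g e e' (t e'))%:E) =
   (fun t : vec R I => (\prod_e' g e e' (t e'))%:E).
  by apply/funext => t; rewrite big_enum.
move=> H; apply: (le_trans (H _)) => [e'|].
  rewrite /g; case: eqP => _; rewrite integral_indicT//; exact: measurableD.
rewrite lee_fin big_enum /= (bigD1 e)//= eqxx.
rewrite ler_wpM2l// (eq_bigr (fun=> D)) => [|e' /negbTE ->//].
by rewrite prodr_const ler_weXn2l// max_card.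
Qed.

Hypothesis bk : box_monotone kappa.

(** The intervals that approximate [B e] are replaced by one centred interval of length at most
    [mu (B e) + eta]. The error estimate is paid twice, for the approximation and for shrinking to
    the exact length, whence [2 K eta]. *)
Theorem mform_rearr B : (forall e, measurable (B e)) ->
  (forall e, mu (B e) < +oo) ->
  mform kappa (fun e => \1_(B e)) <=
  mform kappa (fun e => \1_[set t | ((2 * `|t|)%:E < mu (B e))%E]).
Proof.
move=> mB Bfin.
have C0 : (0 <= C)%R by rewrite -lee_fin (le_trans _ (kappaC (fun=> 0%R))).
have Bf e : mu (B e) = (fine (mu (B e)))%:E by rewrite fineK// ge0_fin_numE.
have f0 e : (0 <= fine (mu (B e)))%R by apply: fine_ge0.
(* At least 1, and a bound for the measure of every [B e] and of its enlarged centred interval, as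
   [eta <= 1]. *)
pose D := (\sum_e fine (mu (B e)) + 2)%R.
have S0 : (0 <= \sum_e fine (mu (B e)))%R by rewrite sumr_ge0.
have BD e : (fine (mu (B e)) + 1 <= D)%R.
  rewrite /D (bigD1 e)//= -addrA lerD2l ler_wpDl// ?ler1n//.
  by rewrite sumr_ge0.
have D1 : (1 <= D)%R by rewrite /D; lra.
pose K := (#|I|%:R * (C * D ^+ #|I|))%R.
have K0 : (0 <= K)%R by rewrite !mulr_ge0// exprn_ge0//; lra.
pose Bs e := [set t : R | ((2 * `|t|)%:E < mu (B e))%E].
pose Bh (eta : R) e := [set t : R | (2 * `|t| < fine (mu (B e)) + eta)%R].
have BsE e : Bs e = [set t : R | (`|t - 0| < fine (mu (B e)) / 2)%R].
  apply/seteqP; split=> t /=; rewrite /Bs /= Bf lte_fin subr0; lra.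
have BhE eta e : Bh eta e = [set t : R | (`|t - 0| < (fine (mu (B e)) + eta) / 2)%R].
  by apply/seteqP; split=> t; rewrite /Bh /= subr0; lra.
have ivE (a : R) : [set t : R | (`|t - 0| < a)%R] = `](0 - a)%R, (0 + a)%R[%classic.
  by apply/seteqP; split=> t /=; rewrite in_itv/= ltr_distl.
have mBs e : measurable (Bs e) by rewrite BsE ivE.
have mBh eta e : measurable (Bh eta e) by rewrite BhE ivE.
have muiv (a : R) : (0 <= a)%R -> mu [set t : R | (`|t - 0| < a)%R] = (2 * a)%:E.
  move=> a0; rewrite ivE lebesgue_measure_itv/= lte_fin.
  case: ltP => h; rewrite -?EFinB; congr EFin; lra.
suff key eta : (0 < eta <= 1)%R -> mform kappa (fun e => \1_(B e)) <=
    mform kappa (fun e => \1_(Bs e)) + (2 * K * eta)%:E.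
  apply/lee_addgt0Pr => eps eps0.
  pose eta : R := (Num.min 1 (eps / (2 * K + 1)))%R.
  have K1 : (0 < 2 * K + 1)%R by lra.
  have eta01 : (0 < eta <= 1)%R.
    by rewrite /eta lt_min ltr01 divr_gt0//= ge_min lexx.
  apply: (le_trans (key eta eta01)); rewrite leeD2l// lee_fin.
  have : (eta <= eps / (2 * K + 1))%R by rewrite /eta ge_min lexx orbT.
  rewrite ler_pdivlMr// => h; apply: le_trans h; case/andP: eta01 => *; nra.
move=> /andP[eta0 eta1].
have /choice[l Hl] : forall e, exists l, [/\ ivgood l,
    mu (B e `\` [set t | (1 <= isum l t)%R]) <= eta%:E &
    (2 * \sum_(p <- l) p.2)%:E <= mu (B e) + eta%:E].
  by move=> e; exact: interval_approx.
pose W e := [set t | (1 <= isum (l e) t)%R].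
have mW e : measurable (W e).
  rewrite -[W e]setTI; apply: measurable_fun_le => //; exact: measurable_isum.
have s1 : mform kappa (fun e => \1_(B e)) <= mform kappa (fun e => \1_(W e)) +
    (#|I|%:R * (C * (eta * D ^+ #|I|)))%:E.
  apply: mform_telescope => //; last exact: ltW.
  - by move=> e; rewrite Bf lee_fin; have := BD e; lra.
  - by move=> e; have [] := Hl e.
have s2 : mform kappa (fun e => \1_(W e)) <= mform kappa (fun e => \1_(Bh eta e)).
  apply: (@le_trans _ _ (mform kappa (fun e => isum (l e)))).
    apply: (le_mform mkappa kappa0) => [e|e|e t].
    - exact: measurable_indic.
    - exact: measurable_isum.
    rewrite indicE ler0n/=; case: (boolP (t \in W e)) => [/set_mem//|_].
    exact: isum_ge0.
  have gl e : ivgood (l e) by have [] := Hl e.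
  apply: (le_trans (mform_intervals mkappa kappa0 bk gl)).
  apply: (le_mform mkappa kappa0) => [e|e|e t].
  - have := measurable_iv (0 : R)%R (\sum_(p <- l e) p.2)%R.
    by under eq_fun do rewrite subr0.
  - exact: measurable_indic.
  rewrite ler0n indicE ler_nat /=; case: ltP => // h.
  rewrite mem_set// /Bh /=; have [_ _] := Hl e.
  by rewrite Bf -EFinD lee_fin; lra.
have s3 : mform kappa (fun e => \1_(Bh eta e)) <= mform kappa (fun e => \1_(Bs e)) +
    (#|I|%:R * (C * (eta * D ^+ #|I|)))%:E.
  have sub e : Bs e `<=` Bh eta e.
    by move=> t; rewrite BsE BhE/= subr0; lra.
  have muh e : mu (Bh eta e) = (fine (mu (B e)) + eta)%:E.
    by rewrite BhE muiv; [congr EFin; lra|have := f0 e; lra].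
  have mus e : mu (Bs e) = (fine (mu (B e)))%:E.
    by rewrite BsE muiv; [congr EFin; lra|have := f0 e; lra].
  apply: mform_telescope => //; last exact: ltW.
  - by move=> e; rewrite muh lee_fin; have := BD e; lra.
  - move=> e; rewrite measureD//; [|exact: mBh|exact: mBs|by have := ltry (fine (mu (B e)) + eta)%R; rewrite -muh].
    by rewrite (setIidr (sub e)) [X in X - _]muh [X in _ - X]mus -EFinB lee_fin; lra.
apply: (le_trans s1); apply: (le_trans (leeD2r _ s2)).
apply: (le_trans (leeD2r _ s3)); rewrite -addeA leeD2l// -EFinD lee_fin /K; lra.
Qed.

End rearrangement1d.

(** * Steiner symmetrization of set-indexed forms *)

Lemma inl_inj A B : injective (@inl A B). Proof. by move=> x y []. Qed.
Lemma inr_inj A B : injective (@inr A B). Proof. by move=> x y []. Qed.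

Lemma perm_filter_cat (T : eqType) (L s : seq T) : uniq L -> uniq s ->
  {subset s <= L} -> perm_eq L ([seq j <- L | j \notin s] ++ s).
Proof.
move=> uL us sL; apply: uniq_perm => //.
  rewrite cat_uniq filter_uniq// us andbT /=.
  by apply/hasPn => j js; rewrite mem_filter js.
move=> j; rewrite mem_cat mem_filter; have [/sL ->//|_] := boolP (j \in s).
by rewrite orbF.
Qed.

Section steiner.
Context (R : realType) (I D : finType) (i0 : D).
Local Open Scope ereal_scope.
Notation mu := (@lebesgue_measure R).

Definition vrow (X : vec R (I * D)%type) (e : I) : vec R D := fun k => X (e, k).

Definition setform (A : I -> set (vec R D)) (V : vec R (I * D)%type -> \bar R) :=
  itint (enum {: I * D}) (fun X => (\prod_e \1_(A e) (vrow X e))%:E * V X) (fun=> 0%R).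

Definition steiner (A : set (vec R D)) : set (vec R D) :=
  [set x | ((2 * `|x i0|)%:E < mu [set t | A (upd x i0 t)])%E].

(** The variables of convexity are the [i0] entries of [X] and the entries of [w] other than [i0];
    the two equalities freeze the rest. [stc_sym] changes the sign of exactly these variables. The
    bound on [w] makes the volumes of sections in [w] bounded uniformly in [X]. *)
Record steiner_convex (K : set (vec R (I * D)%type * vec R D)) := SteinerConvex {
  stc_meas : measurable K;
  stc_conv : forall X X' w w' l, (0 <= l <= 1)%R ->
    (forall e k, k != i0 -> X (e, k) = X' (e, k)) -> w i0 = w' i0 ->
    K (X, w) -> K (X', w') -> K (vcomb l X X', vcomb l w w');
  stc_sym : forall X w, K (X, w) ->
    K ((fun p => if p.2 == i0 then - X p else X p)%R,
       (fun k => if k == i0 then w k else - w k)%R);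
  stc_bd : exists rho : R, forall X w k, K (X, w) -> (`|w k| < rho)%R
}.

(** One index type for [X] and [w] together, so that the [i0] entries of [X], listed in [tlist], and
    the other entries of [w], listed in [wlist], can be integrated innermost with all else fixed. *)
Let J := (I * D + D)%type.
Let join (X : vec R (I * D)%type) (w : vec R D) : vec R J :=
  fun j => match j with inl p => X p | inr k => w k end.
Let lft (z : vec R J) : vec R (I * D)%type := fun p => z (inl p).
Let rgt (z : vec R J) : vec R D := fun k => z (inr k).

Let tlist : seq J := [seq inl (e, i0) | e <- enum I].
Let wlist : seq J := [seq inr k | k <- enum D & k != i0].

Let mem_wlist_inl p : (inl p \in wlist) = false.
Proof. by apply/negP => /mapP[k _]. Qed.

Let mem_wlist_i0 : (inr i0 \in wlist) = false.
Proof. by apply/negP => /mapP[k]; rewrite mem_filter => /andP[ki _] [ki']; rewrite ki' eqxx in ki. Qed.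

Let mem_wlist_inr k : k != i0 -> inr k \in wlist.
Proof. by move=> k0; apply/mapP; exists k => //; rewrite mem_filter k0 mem_enum. Qed.

Let mlft : measurable_fun setT lft.
Proof. by apply: measurable_vec => p; exact: measurable_coord. Qed.
Let mrgt : measurable_fun setT rgt.
Proof. by apply: measurable_vec => p; exact: measurable_coord. Qed.

Lemma measurable_vrow e : measurable_fun setT (vrow ^~ e).
Proof. by apply: measurable_vec => k; exact: measurable_coord. Qed.

Lemma measurable_prod_indic (A : I -> set (vec R D)) : (forall e, measurable (A e)) ->
  measurable_fun setT (fun X : vec R (I * D)%type => (\prod_e \1_(A e) (vrow X e))%R : R).
Proof.
move=> mA; apply: measurable_prod => e _; apply/measurable_EFinP.
by apply: measurable_indic_comp => //; exact: measurable_vrow.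
Qed.

Lemma prod_indic_ge0 (T : Type) (A : I -> set T) (x : I -> T) :
  0 <= (\prod_e \1_(A e) (x e) : R)%:E.
Proof. by rewrite lee_fin prodr_ge0. Qed.

Lemma measurable_steiner A : measurable A -> measurable (steiner A).
Proof.
move=> mA.
rewrite (_ : steiner A = [set x | (2 * `|x i0|)%:E <
    itint [:: i0] (fun y => (\1_A y)%:E) x]); last first.
  by apply/seteqP; split=> x /=; rewrite /steiner/= integral_fiber.
apply: measurable_ltE.
  by apply: measurable_funM => //; apply: measurableT_comp => //;
    exact: measurable_coord.
by apply: measurable_itint1; [exact: measurable_indicE|move=> y; exact: indicE_ge0].
Qed.

Variable K : set (vec R (I * D)%type * vec R D).
Hypothesis HK : steiner_convex K.

Let V (X : vec R (I * D)%type) := itint (enum D) (fun w => (\1_K (X, w))%:E) (fun=> 0%R).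

Let K' : set (vec R J) := [set z | K (lft z, rgt z)].

Let mK' : measurable K'.
Proof.
have m : measurable_fun setT (fun z : vec R J => (lft z, rgt z)).
  exact: measurable_fun_pair.
by have := m measurableT _ (stc_meas HK); rewrite setTI.
Qed.

Let F (A : I -> set (vec R D)) (z : vec R J) : \bar R :=
  (\prod_e \1_(A e) (vrow (lft z) e))%:E * (\1_K' z)%:E.

Let mF A : (forall e, measurable (A e)) -> measurable_fun setT (F A).
Proof.
move=> mA; apply: emeasurable_funM; last exact: measurable_indicE.
apply/measurable_EFinP; exact: (measurableT_comp (measurable_prod_indic mA) mlft).
Qed.

Let F0 A z : 0 <= F A z.
Proof. by rewrite /F mule_ge0// ?prod_indic_ge0// indicE_ge0. Qed.

Let setform_join A : (forall e, measurable (A e)) ->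
  setform A V = itint ([seq inl p | p <- enum {: I * D}] ++ [seq inr k | k <- enum D])
    (F A) (join (fun=> 0%R) (fun=> 0%R)).
Proof.
move=> mA; rewrite itint_cat.
rewrite (itint_map (G := join ^~ (fun=> 0%R))); last first.
  by move=> X p t _; apply/funext => -[q|k].
apply: eq_itint => X _ /=.
rewrite (itint_map (G := join X)); last first.
  by move=> w k t _; apply/funext => -[q|k'].
rewrite /V -itintZ.
- by apply: eq_itint => w _; rewrite /F; congr (_ * _%:E); exact: eq_indic.
- apply: measurable_indic_comp; first exact: stc_meas HK.
  exact: measurable_fun_pair.
- by move=> y; exact: indicE_ge0.
- exact: prod_indic_ge0.
Qed.

Section inner.
Variable z : vec R J.

Let G (t : vec R I) : vec R J := fun j => match j with
  | inl p => if p.2 == i0 then t p.1 else z (inl p) | inr k => z (inr k) end.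

Let kappa (t : vec R I) : \bar R := itint wlist (fun y => (\1_K' y)%:E) (G t).

Let mG : measurable_fun setT G.
Proof.
apply: measurable_vec => -[[e k]|k] /=; last exact: measurable_cst.
by case: (k == i0) => //; exact: measurable_coord.
Qed.

Let mkappa : measurable_fun setT kappa.
Proof.
apply: (@measurable_itint _ _ _ (vec R I) wlist (fun p => (\1_K' p.2)%:E) G) => //.
by apply: measurable_indic_comp => //; exact: measurable_snd.
Qed.

Let kappa0 t : 0 <= kappa t.
Proof. by apply: itint_ge0 => y; exact: indicE_ge0. Qed.

Let kappaC : exists C : R, forall t, kappa t <= C%:E.
Proof.
have [rho Hrho] := stc_bd HK.
have uw : uniq wlist.
  by rewrite map_inj_uniq => [|x y []//]; exact/filter_uniq/enum_uniq.
pose f (j : J) (t : R) : R := (`|t - 0| < `|rho|)%R%:R.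
exists (\prod_(j <- wlist) (2 * `|rho|))%R => t.
have mf j : measurable_fun setT (f j) by exact: measurable_iv.
have f0 j x : (0 <= f j x)%R by rewrite /f ler0n.
apply: le_trans (itint_prod_le (G t) uw mf f0 (D := fun=> (2 * `|rho|)%R) _); last first.
  by move=> j; rewrite /f lebesgue_iv.
apply: le_itint.
- exact: measurable_indicE.
- apply/measurable_EFinP; apply: measurable_prod => j _.
  by apply: (measurableT_comp (mf j)); exact: measurable_coord.
- by move=> y; exact: indicE_ge0.
- move=> y _; rewrite lee_fin indicE.
  case: (boolP (y \in K')) => [/set_mem Ky|_]; last by rewrite prodr_ge0.
  rewrite big_seq big1// => j /mapP[k _ ->]; rewrite /f subr0.
  by rewrite (lt_le_trans (Hrho _ _ k Ky))// ler_norm.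
- by move=> y; rewrite lee_fin prodr_ge0.
Qed.

(** A scale [s] is added as a variable and the box is centred at [s c]. Since [w_i0] is frozen at
    its value in [z], the slot [inr i0] is free to hold [s]. After the shift [t -> t + s c] the set
    [K2] is convex and symmetric in [t], [s] and the free entries of [w]. Integrating out all but
    [s] gives a marginal that does not decrease when [s] passes from 1 to [tau]. *)
Let bkappa : box_monotone kappa.
Proof.
move=> c a tau tau01.
pose Xy (y : vec R J) : vec R (I * D)%type := fun p =>
  if p.2 == i0 then (y (inl (p.1, i0)) + y (inr i0) * c p.1)%R else z (inl p).
pose wy (y : vec R J) : vec R D := fun k => if k == i0 then z (inr i0) else y (inr k).
pose K2 : set (vec R J) := [set y | (forall e, `|y (inl (e, i0))| < a e)%R /\ K (Xy y, wy y)].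
pose x1 : vec R J := fun j => if j == inr i0 then 1%R else 0%R.
have mK2 : measurable K2.
  have -> : K2 = (\bigcap_e [set y : vec R J | (`|y (inl (e, i0))| < a e)%R])
     `&` [set y | K (Xy y, wy y)].
    apply/seteqP; split=> y [h1 h2]; split => // e; last exact: (h1 e Logic.I).
    by move=> _; exact: h1.
  apply: measurableI.
    apply: fin_bigcap_measurable => [|e _]; first exact: finite_finset.
    rewrite (_ : [set y | _] = [set y : vec R J |
      (`|y (inl (e, i0))|)%:E < (a e)%:E]); last first.
      by apply/seteqP; split=> y /=; rewrite lte_fin.
    apply: measurable_ltE => //.
    by apply: measurableT_comp => //; exact: measurable_coord.
  have m : measurable_fun setT (fun y => (Xy y, wy y)).
    apply: measurable_fun_pair; apply: measurable_vec.
      move=> [e k]; rewrite /Xy /=; case: (k == i0) => //.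
      apply: measurable_funD; first exact: measurable_coord.
      by apply: measurable_funM => //; exact: measurable_coord.
    by move=> k; rewrite /wy; case: (k == i0) => //; exact: measurable_coord.
  by have := m measurableT _ (stc_meas HK); rewrite setTI.
have cK2 : convex_sym K2.
  split=> [x y l l01 [xa Kx] [ya Ky]|x [xa Kx]].
    split=> [e|].
      have mlt : (Num.max `|x (inl (e, i0))| `|y (inl (e, i0))| < a e)%R.
        by rewrite gt_max xa ya.
      apply: le_lt_trans mlt.
      have [h1 h2] : (`|x (inl (e, i0))| <= Num.max `|x (inl (e, i0))| `|y (inl (e, i0))| /\
        `|y (inl (e, i0))| <= Num.max `|x (inl (e, i0))| `|y (inl (e, i0))|)%R.
        by rewrite !le_max !lexx orbT.
      move: h1 h2; set m := Num.max _ _; rewrite !ler_norml /vcomb.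
      by case/andP: l01 => l0 l1 /andP[? ?] /andP[? ?]; apply/andP; split; nra.
    have := stc_conv HK l01 (X := Xy x) (X' := Xy y) (w := wy x) (w' := wy y) _ _ Kx Ky.
    have -> : vcomb l (Xy x) (Xy y) = Xy (vcomb l x y).
      by apply/funext => -[e k]; rewrite /vcomb /Xy /=; case: (k == i0); ring.
    have -> : vcomb l (wy x) (wy y) = wy (vcomb l x y).
      by apply/funext => k; rewrite /vcomb /wy /=; case: (k == i0); ring.
    apply; last by rewrite /wy eqxx.
    by move=> e k /negbTE; rewrite /Xy /= => ->.
  split=> [e|]; first by rewrite /vscale normrM normrN1 mul1r.
  have := stc_sym HK Kx; congr (K (_, _)); apply/funext.
    by move=> [e k] /=; rewrite /Xy /vscale /=; case: (k == i0) => //; ring.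
  by move=> k; rewrite /wy /vscale /=; case: (k == i0) => //; ring.
(* At scale [sg], translating by [sg c] turns the centred box in [K2] into the box around [sg c]. *)
have key (sg : R) : itint (tlist ++ wlist) (fun y => (\1_K2 y)%:E) (vscale sg x1) =
    mform kappa (fun e t => (`|t - sg * c e| < a e)%R%:R).
  pose sc : vec R I := fun e => (sg * c e)%R.
  pose G' (t : vec R I) : vec R J := fun j => match j with
    | inl p => if p.2 == i0 then t p.1 else 0%R | inr k => (sg * x1 (inr k))%R end.
  pose H (t : vec R I) := (\prod_e (`|t e - sg * c e| < a e)%R%:R)%:E * kappa t.
  have mH : measurable_fun setT H.
    apply: (measurable_mform mkappa (f := fun e t => (`|t - sg * c e| < a e)%R%:R)) => e.
    exact: measurable_iv.
  have H0 t : 0 <= H t.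
    apply: (mform_ge0 kappa0 (f := fun e t => (`|t - sg * c e| < a e)%R%:R)) => e r.
    exact: ler0n.
  rewrite itint_cat (_ : vscale sg x1 = G' (fun=> 0%R)); last first.
    by apply/funext => -[[e k]|k] //=; rewrite /vscale /x1 /= mulr0; case: ifP.
  rewrite (itint_map (G := G')); last first.
    move=> x e t _; apply/funext => -[[e' k]|k] //=; rewrite /upd /=.
    rewrite -[inl _ == inl _]/((e', k) == (e, i0)) xpair_eqE andbC.
    by case: (k == i0).
  transitivity (itint (enum I) (fun t => H (vadd t sc)) (fun=> 0%R)); last first.
    rewrite itint_shift//; apply: eq_itint_base => e; by rewrite mem_enum.
  apply: eq_itint => t _ /=; rewrite /H.
  (* [Phi] keeps the coordinates of [wlist] and takes all others from [z] and the shifted [t], so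
     that both integrals over [wlist] can be compared with a common base point. *)
  pose Phi (y : vec R J) : vec R J :=
    fun j => if j \in wlist then y j else G (vadd t sc) j.
  have -> : kappa (vadd t sc) = itint wlist (fun y => (\1_K' (Phi y))%:E) (G' t).
    transitivity (itint wlist (fun y => (\1_K' y)%:E) (Phi (G' t))).
      by apply: eq_itint_base => j /negbTE jw; rewrite /Phi jw.
    rewrite -{1}[wlist]map_id (itint_map (G := Phi))// => y j r jw.
    by apply/funext => j'; rewrite /Phi /upd; case: eqVneq => [->|//]; rewrite jw.
  rewrite -itintZ.
  - apply: eq_itint => y yG.
    have yt e : y (inl (e, i0)) = t e by rewrite yG ?mem_wlist_inl//= eqxx.
    have y1 : y (inr i0) = sg by rewrite yG ?mem_wlist_i0//= /x1 eqxx mulr1.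
    have vE e : (vadd t sc e - sg * c e = t e)%R by rewrite /vadd /sc addrK.
    rewrite -EFinM; congr EFin.
    have [ta|/existsNP[e nta]] := pselect (forall e, `|t e| < a e)%R; last first.
      rewrite (bigD1 e)//= vE (negbTE (introN idP nta)) !mul0r indicE memNset//.
      by move=> [/(_ e)]; rewrite yt.
    rewrite big1 ?mul1r => [|e _]; last by rewrite vE ta.
    apply: eq_indic.
    have -> : K' (Phi y) = K (Xy y, wy y).
      rewrite /K' /=; congr (K (_, _)); apply/funext.
        move=> [e k]; rewrite /lft /Phi mem_wlist_inl /Xy /=.
        by case: (k == i0) => //; rewrite yt y1.
      move=> k; rewrite /rgt /Phi /wy; case: eqVneq => [->|k0].
        by rewrite mem_wlist_i0.
      by rewrite mem_wlist_inr.
    split; first by case.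
    by move=> ?; split => // e; rewrite yt.
  - apply: measurable_indic_comp => //; apply: measurable_vec => j.
    by rewrite /Phi; case: (j \in wlist) => //; exact: measurable_coord.
  - by move=> y; exact: indicE_ge0.
  - by rewrite lee_fin prodr_ge0.
have := le_itint_convex_sym (tlist ++ wlist) x1 mK2 cK2 tau01.
have -> : x1 = vscale 1 x1 by apply/funext => j; rewrite /vscale mul1r.
have -> : vscale tau (vscale 1 x1) = vscale tau x1.
  by apply/funext => j; rewrite /vscale mul1r.
rewrite !key.
by have -> : (fun e (t : R) => (`|t - 1 * c e| < a e)%R%:R : R) =
  (fun e t => (`|t - c e| < a e)%R%:R) by
  apply/funext => e; apply/funext => t; rewrite mul1r.
Qed.

Lemma itint_inner A : (forall e, measurable (A e)) ->
  itint (tlist ++ wlist) (F A) z =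
  mform kappa (fun e => \1_[set t | A e (upd (vrow (lft z) e) i0 t)]).
Proof.
move=> mA; rewrite itint_cat.
rewrite [in LHS](_ : z = G (fun e => z (inl (e, i0)))); last first.
  by apply/funext => -[[e k]|k] //=; case: eqVneq => [->|].
rewrite (itint_map (G := G)); last first.
  move=> x e t _; apply/funext => -[[e' k]|k] //=; rewrite /upd /=.
  rewrite -[inl _ == inl _]/((e', k) == (e, i0)) xpair_eqE andbC.
  by case: (k == i0).
transitivity (itint (enum I) (itint wlist (F A) \o G) (fun=> 0%R)).
  by apply: eq_itint_base => e; rewrite mem_enum.
apply: eq_itint => t _ /=; rewrite /kappa -itintZ.
- apply: eq_itint => y yG; rewrite /F; congr (_%:E * _).
  apply: eq_bigr => e _; apply: eq_indic.
  have -> // : vrow (lft y) e = upd (vrow (lft z) e) i0 (t e).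
  by apply/funext => k; rewrite /vrow /lft yG ?mem_wlist_inl//= /upd.
- exact: measurable_indicE.
- by move=> y; exact: indicE_ge0.
- exact: prod_indic_ge0.
Qed.

Lemma le_itint_inner A : (forall e, measurable (A e)) ->
  (forall e x, mu [set t | A e (upd x i0 t)] < +oo) ->
  itint (tlist ++ wlist) (F A) z <= itint (tlist ++ wlist) (F (steiner \o A)) z.
Proof.
move=> mA fA; rewrite !itint_inner//; last by move=> e; exact: measurable_steiner.
have [C HC] := kappaC.
apply: (le_trans (mform_rearr mkappa kappa0 HC bkappa _ _)) => [e|e|].
- exact: measurable_fiber.
- exact: fA.
have -> // : (fun e => \1_[set t : R | (2 * `|t|)%:E <
     mu [set t | A e (upd (vrow (lft z) e) i0 t)]] : R -> R) =
  (fun e => \1_[set t | (steiner \o A) e (upd (vrow (lft z) e) i0 t)]).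
apply/funext => e; apply/funext => t; apply: eq_indic => /=; rewrite /steiner /= updE.
by have -> : [set s | A e (upd (upd (vrow (lft z) e) i0 t) i0 s)] =
  [set s | A e (upd (vrow (lft z) e) i0 s)] by
  apply/seteqP; split=> s /=; rewrite upd_upd.
Qed.

End inner.

Lemma le_setform_steiner A : (forall e, measurable (A e)) ->
  (forall e x, mu [set t | A e (upd x i0 t)] < +oo) ->
  setform A V <= setform (steiner \o A) V.
Proof.
move=> mA fA.
have mS e : measurable ((steiner \o A) e) by exact: measurable_steiner.
rewrite !setform_join//.
set L := (X in itint X); set inn := tlist ++ wlist.
have uL : uniq L.
  rewrite cat_uniq (map_inj_uniq (@inl_inj _ _)) (map_inj_uniq (@inr_inj _ _)).
  by rewrite !enum_uniq andbT /=; apply/hasPn => j /mapP[k _ ->]; apply/negP => /mapP[].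
have uinn : uniq inn.
  rewrite cat_uniq map_inj_uniq => [|x y []//]; rewrite (map_inj_uniq (@inr_inj _ _)).
  rewrite enum_uniq filter_uniq ?enum_uniq// andbT /=.
  by apply/hasPn => j /mapP[k _ ->]; apply/negP => /mapP[].
have sL : {subset inn <= L}.
  by move=> j _; rewrite mem_cat; case: j => [p|k]; apply/orP; [left|right];
    apply: map_f; rewrite mem_enum.
have pL := perm_filter_cat uL uinn sL.
rewrite !(perm_itint _ _ _ uL pL) ?itint_cat//; [|exact: mF|exact: mF].
apply: le_itint.
- by apply: measurable_itint1; [exact: mF|exact: F0].
- by apply: measurable_itint1; [exact: mF|exact: F0].
- by move=> y; apply: itint_ge0; exact: F0.
- by move=> y _; exact: le_itint_inner.
- by move=> y; apply: itint_ge0; exact: F0.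
Qed.

End steiner.

(** * Euclidean norm and inner product *)

Section euclid.
Context (R : realType) (D : finType).
Implicit Types x y w : vec R D.

Definition vdot x y : R := \sum_k x k * y k.
Definition vnorm x : R := Num.sqrt (vdot x x).

Lemma vdot_ge0 x : 0 <= vdot x x.
Proof. by apply: sumr_ge0 => k _; rewrite -expr2 sqr_ge0. Qed.

Lemma vnorm_ge0 x : 0 <= vnorm x. Proof. exact: sqrtr_ge0. Qed.

Lemma vnorm_sqr x : vnorm x ^+ 2 = vdot x x.
Proof. by rewrite sqr_sqrtr// vdot_ge0. Qed.

Lemma vnormZ (a : R) x : vnorm (vscale a x) = `|a| * vnorm x.
Proof.
rewrite /vnorm (_ : vdot _ _ = a ^+ 2 * vdot x x).
  by rewrite sqrtrM ?sqr_ge0// sqrtr_sqr.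
by rewrite /vdot mulr_sumr; apply: eq_bigr => k _; rewrite /vscale; ring.
Qed.

Lemma le_coord_vnorm x k : `|x k| <= vnorm x.
Proof.
rewrite -sqrtr_sqr ler_sqrt ?vdot_ge0// /vdot (bigD1 k)//= -expr2 lerDl.
by apply: sumr_ge0 => j _; rewrite -expr2 sqr_ge0.
Qed.

Lemma vnorm_eq0 x : vnorm x = 0 -> x = fun=> 0.
Proof.
move=> x0; apply/funext => k; apply/eqP; rewrite -normr_le0 -x0.
exact: le_coord_vnorm.
Qed.

(** Cauchy-Schwarz, from the sum of the squares of [x_k |y| - y_k |x|]. *)
Lemma vdot_le x y : vdot x y <= vnorm x * vnorm y.
Proof.
have [x0|xn0] := eqVneq (vnorm x) 0.
  by rewrite x0 mul0r (vnorm_eq0 x0) /vdot big1// => k _; rewrite mul0r.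
have [y0|yn0] := eqVneq (vnorm y) 0.
  by rewrite y0 mulr0 (vnorm_eq0 y0) /vdot big1// => k _; rewrite mulr0.
have a0 : 0 < vnorm x by rewrite lt_neqAle eq_sym xn0 vnorm_ge0.
have b0 : 0 < vnorm y by rewrite lt_neqAle eq_sym yn0 vnorm_ge0.
have : 0 <= \sum_k (x k * vnorm y - y k * vnorm x) ^+ 2.
  by apply: sumr_ge0 => k _; rewrite sqr_ge0.
rewrite (_ : \sum_k _ = vdot x x * vnorm y ^+ 2 + vdot y y * vnorm x ^+ 2
  - 2 * vnorm x * vnorm y * vdot x y); last first.
  rewrite /vdot !mulr_suml mulr_sumr -big_split -sumrB /=.
  by apply: eq_bigr => k _; ring.
rewrite -!vnorm_sqr => h.
have : 0 <= 2 * (vnorm x * vnorm y) * (vnorm x * vnorm y - vdot x y).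
  by apply: le_trans h _; rewrite le_eqVlt; apply/orP; left; apply/eqP; ring.
by rewrite pmulr_rge0 ?subr_ge0// !mulr_gt0.
Qed.

Lemma vnorm_vcomb (l : R) x y : 0 <= l <= 1 ->
  vnorm (vcomb l x y) <= l * vnorm x + (1 - l) * vnorm y.
Proof.
move=> /andP[l0 l1].
have x0 := vnorm_ge0 x; have y0 := vnorm_ge0 y.
have r0 : 0 <= l * vnorm x + (1 - l) * vnorm y.
  by rewrite addr_ge0// mulr_ge0// subr_ge0.
rewrite -(ler_sqr (vnorm_ge0 _)) ?nnegrE// vnorm_sqr.
have -> : vdot (vcomb l x y) (vcomb l x y) =
   l ^+ 2 * vnorm x ^+ 2 + (1 - l) ^+ 2 * vnorm y ^+ 2 + 2 * (l * (1 - l)) * vdot x y.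
  rewrite !vnorm_sqr /vdot !mulr_sumr -!big_split /=.
  by apply: eq_bigr => k _; rewrite /vcomb; ring.
have h := vdot_le x y.
have c0 : 0 <= 2 * (l * (1 - l)) by rewrite !mulr_ge0// subr_ge0.
have := ler_wpM2l c0 h; lra.
Qed.

Lemma measurable_vdot d (T : measurableType d) (f g : T -> vec R D) :
  measurable_fun setT f -> measurable_fun setT g ->
  measurable_fun setT (fun t => vdot (f t) (g t)).
Proof.
move=> mf mg; apply: measurable_sum => k; apply: measurable_funM.
  exact: (measurableT_comp (measurable_coord k) mf).
exact: (measurableT_comp (measurable_coord k) mg).
Qed.

Lemma measurable_vnorm d (T : measurableType d) (f : T -> vec R D) :
  measurable_fun setT f -> measurable_fun setT (fun t => vnorm (f t)).
Proof.
move=> mf; have := measurable_vdot mf mf => mff.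
have ms : measurable_fun setT (@Num.sqrt R).
  by apply: continuous_measurable_fun => x; exact: sqrt_continuous.
exact: (measurableT_comp ms mff).
Qed.

End euclid.

Lemma measurable_layer (R : realType) T (f : T -> \bar R) (x : T) :
  measurable_fun setT (fun r : R => (\1_(subgraph f r) x)%:E : \bar R).
Proof.
rewrite (_ : (fun r => _) = (fun r : R =>
    (\1_(`[0, +oo[%classic `&` [set r : R | (r%:E < f x)%E]) r)%:E : \bar R)).
  by apply: measurable_indicE; apply: measurableI => //; exact: measurable_ltE.
apply/funext => r; congr EFin; apply: eq_indic.
by split=> -[]; rewrite /= in_itv/= andbT.
Qed.

(** Convexity and homogeneity stand in for the triangle inequality. Zeros away from the origin are
    allowed, because a support function will be applied to only one block of the coordinates. *)
Record seminorm (R : realType) (I : finType) (N : vec R I -> R) := Seminorm {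
  sn_meas : measurable_fun setT N;
  sn_ge0 : forall x, 0 <= N x;
  sn_conv : forall (l : R) x y, 0 <= l <= 1 ->
    N (vcomb l x y) <= l * N x + (1 - l) * N y;
  sn_homo : forall (a : R) x, N (vscale a x) = `|a| * N x
}.

(** * Quasi-concave kernels under Steiner symmetrization *)

Section kernels.
Context (R : realType) (I D : finType) (i0 : D).
Local Open Scope ereal_scope.
Notation mu := (@lebesgue_measure R).
Notation VX := (vec R (I * D)%type).
Notation VW := (vec R D).

Definition dots (X : VX) (w : VW) : vec R I := fun e => vdot (vrow X e) w.

Definition sform (A : I -> set VW) (g : VX * VW -> \bar R) :=
  setform A (fun X => itint (enum D) (fun w => g (X, w)) (fun=> 0%R)).

(** The superlevel sets have the convexity and the symmetry of [steiner_convex]; boundedness comes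
    from the set with which they are intersected. *)
Record steiner_qconcave (G : VX * VW -> \bar R) := SteinerQconcave {
  sqc_meas : measurable_fun setT G;
  sqc_ge0 : forall p, 0 <= G p;
  sqc_conv : forall X X' w w' l, (0 <= l <= 1)%R ->
    (forall e k, k != i0 -> X (e, k) = X' (e, k)) -> w i0 = w' i0 ->
    Order.min (G (X, w)) (G (X', w')) <= G (vcomb l X X', vcomb l w w');
  sqc_sym : forall X w, G (X, w) <=
    G ((fun p => if p.2 == i0 then - X p else X p)%R,
       (fun k => if k == i0 then w k else - w k)%R)
}.

Definition gker (K : set (VX * VW)) (Gs : seq (VX * VW -> \bar R)) : VX * VW -> \bar R :=
  foldr (fun G g p => G p * g p) (fun p => (\1_K p)%:E) Gs.

Lemma gker_indic K S Gs p :
  (\1_S p)%:E * gker K Gs p = gker (K `&` S) Gs p.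
Proof.
elim: Gs => [|G Gs IH] /=; last by rewrite muleCA IH.
by rewrite indicI EFinM muleC.
Qed.

Lemma gker_ge0 K (Gs : seq (VX * VW -> \bar R)) :
  List.Forall steiner_qconcave Gs -> forall p, 0 <= gker K Gs p.
Proof.
elim => [|G Gs' GG _ IH] p /=; first exact: indicE_ge0.
by rewrite mule_ge0//; exact: sqc_ge0.
Qed.

Lemma measurable_gker K (Gs : seq (VX * VW -> \bar R)) : measurable K ->
  List.Forall steiner_qconcave Gs -> measurable_fun setT (gker K Gs).
Proof.
move=> mK; elim => [|G Gs' GG _ IH] /=; first exact: measurable_indicE.
by apply: emeasurable_funM => //; exact: sqc_meas.
Qed.

Lemma sform_integral A (g : R * (VX * VW) -> \bar R) :
  (forall e, measurable (A e)) -> measurable_fun setT g -> (forall p, 0 <= g p) ->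
  sform A (fun p => \int[mu]_r g (r, p)) = \int[mu]_r sform A (fun p => g (r, p)).
Proof.
move=> mA mg g0; rewrite /sform /setform.
have mgX X : measurable_fun setT (fun q : R * VW => g (q.1, (X, q.2))).
  apply: (measurableT_comp mg); apply: measurable_fun_pair => //.
  by apply: measurable_fun_pair => //; exact: measurable_snd.
transitivity (itint (enum {: I * D}) (fun X => \int[mu]_r
    ((\prod_e \1_(A e) (vrow X e))%:E * itint (enum D) (fun w => g (r, (X, w))) (fun=> 0%R)))
    (fun=> 0%R)).
  apply: eq_itint => X _.
  rewrite -(itint_integral lebesgue_measure _ (g := fun q : R * VW => g (q.1, (X, q.2))))//; last exact: mgX.
  rewrite ge0_integralZl//.
  - apply: (@measurable_itint _ _ _ R (enum D) (fun q => g (q.1, (X, q.2))) (fun=> (fun=> 0%R))) => //; exact: mgX.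
  - by move=> r _; apply: itint_ge0.
  - exact: prod_indic_ge0.
symmetry; apply: (itint_integral lebesgue_measure _ (g := fun q : R * VX =>
  (\prod_e \1_(A e) (vrow q.2 e))%:E * itint (enum D) (fun w => g (q.1, (q.2, w))) (fun=> 0%R))).
- apply: emeasurable_funM.
    by apply/measurable_EFinP; apply: (measurableT_comp (measurable_prod_indic mA)).
  apply: (@measurable_itint _ _ _ (R * VX)%type (enum D) (fun q => g (q.1.1, (q.1.2, q.2)))
    (fun=> (fun=> 0%R))) => //.
  apply: (measurableT_comp mg); apply: measurable_fun_pair => /=.
    by apply: measurableT_comp; [exact: measurable_fst|exact: measurable_fst].
  apply: measurable_fun_pair => //.
  by apply: measurableT_comp; [exact: measurable_snd|exact: measurable_fst].
- by move=> q; rewrite mule_ge0 ?prod_indic_ge0//; apply: itint_ge0.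
Qed.

Lemma steiner_convexI K G (r : R) : steiner_convex i0 K -> steiner_qconcave G ->
  steiner_convex i0 (K `&` subgraph G r).
Proof.
move=> HK HG; split.
- apply: measurableI; first exact: stc_meas HK.
  by apply: measurable_subgraph; exact: sqc_meas.
- move=> X X' w w' l l01 XX ww [KX [r0 rX]] [KX' [_ rX']]; split.
    exact: (stc_conv HK).
  split => //; apply: lt_le_trans (sqc_conv HG l01 XX ww).
  by rewrite lt_min rX rX'.
- move=> X w [KX [r0 rX]]; split; first exact: (stc_sym HK).
  by split => //; exact: lt_le_trans (sqc_sym HG X w).
- by have [rho H] := stc_bd HK; exists rho => X w k [KX _]; exact: H KX.
Qed.

(** A product of quasi-concave functions need not be quasi-concave, so the factors are removed one
    at a time: [G] is a mixture of the indicators of its layers, and each layer is intersected with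
    [K]. *)
Lemma le_sform_steiner K Gs A : steiner_convex i0 K ->
  List.Forall steiner_qconcave Gs -> (forall e, measurable (A e)) ->
  (forall e x, mu [set t | A e (upd x i0 t)] < +oo) ->
  sform A (gker K Gs) <= sform (steiner i0 \o A) (gker K Gs).
Proof.
move=> + HGs mA fA; elim: HGs K => [|G Gs' HG HGs IH] K HK /=.
  exact: le_setform_steiner.
pose g (q : R * (VX * VW)) := gker (K `&` subgraph G q.1) Gs' q.2.
have gE : (fun p => G p * gker K Gs' p) = (fun p => \int[mu]_r g (r, p)).
  apply/funext => p; rewrite -{1}(layer_cake (sqc_ge0 HG p)).
  rewrite -ge0_integralZr//.
  - by apply: eq_integral => r _; rewrite /g gker_indic.
  - exact: measurable_layer.
  - exact: gker_ge0.
have mg : measurable_fun setT g.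
  rewrite (_ : g = fun q => (\1_[set q | subgraph G q.1 q.2] q)%:E * gker K Gs' q.2).
    apply: emeasurable_funM.
      by apply: measurable_indicE; apply: measurable_subgraph2; exact: sqc_meas.
    apply: (measurableT_comp (measurable_gker (stc_meas HK) HGs)).
    exact: measurable_snd.
  apply/funext => q; rewrite /g -gker_indic.
  by have -> : \1_(subgraph G q.1) q.2 = \1_[set q | subgraph G q.1 q.2] q :> R
    by exact: eq_indic.
have g0 q : 0 <= g q by apply: gker_ge0.
have mS e : measurable ((steiner i0 \o A) e) by exact: measurable_steiner.
rewrite gE !sform_integral//.
have ms B : (forall e, measurable (B e)) ->
    measurable_fun setT (fun r => sform B (fun p => g (r, p))).
  move=> mB; apply: (@measurable_itint _ _ _ R (enum {: I * D}) (fun q : R * VX =>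
    (\prod_e \1_(B e) (vrow q.2 e))%:E * itint (enum D) (fun w => g (q.1, (q.2, w))) (fun=> 0%R))
    (fun=> (fun=> 0%R))) => //.
    apply: emeasurable_funM.
      by apply/measurable_EFinP; apply: (measurableT_comp (measurable_prod_indic mB)).
    apply: (@measurable_itint _ _ _ (R * VX)%type (enum D) (fun q => g (q.1.1, (q.1.2, q.2)))
      (fun=> (fun=> 0%R))) => //.
    apply: (measurableT_comp mg); apply: measurable_fun_pair => /=.
      by apply: measurableT_comp; [exact: measurable_fst|exact: measurable_fst].
    apply: measurable_fun_pair => //.
    by apply: measurableT_comp; [exact: measurable_snd|exact: measurable_fst].
  by move=> q; rewrite mule_ge0 ?prod_indic_ge0//; apply: itint_ge0.
apply: ge0_le_integral => //; [|exact: ms|exact: ms|].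
- move=> r _; apply: itint_ge0 => X; rewrite mule_ge0 ?prod_indic_ge0//.
  by apply: itint_ge0.
- by move=> r _; exact: (IH _ (steiner_convexI r HK HG)).
Qed.

Section seminorm_kernel.
Variables (eps : R).
Hypothesis eps0 : (0 < eps)%R.

Definition mnorm (N : vec R I -> R) (p : VX * VW) : R :=
  (N (dots p.1 p.2) + eps * vnorm p.2)%R.

Lemma measurable_dots d (T : measurableType d) (f : T -> VX) (g : T -> VW) :
  measurable_fun setT f -> measurable_fun setT g ->
  measurable_fun setT (fun t => dots (f t) (g t)).
Proof.
move=> mf mg; apply: measurable_vec => e; apply: measurable_vdot => //.
exact: (measurableT_comp (measurable_vrow e) mf).
Qed.

Lemma measurable_mnorm N : seminorm N -> measurable_fun setT (mnorm N).
Proof.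
move=> sN; apply: measurable_funD.
  apply: (measurableT_comp (sn_meas sN)).
  by apply: measurable_dots; [exact: measurable_fst|exact: measurable_snd].
apply: measurable_funM => //; apply: measurable_vnorm; exact: measurable_snd.
Qed.

Lemma mnorm_ge0 N p : seminorm N -> (0 <= mnorm N p)%R.
Proof.
by move=> sN; rewrite addr_ge0 ?sn_ge0// mulr_ge0 ?vnorm_ge0// ltW.
Qed.

Lemma mnorm_comb N X X' w w' (l : R) : seminorm N -> (0 <= l <= 1)%R ->
  (forall e k, k != i0 -> X (e, k) = X' (e, k)) -> w i0 = w' i0 ->
  (mnorm N (vcomb l X X', vcomb l w w') <=
   Num.max (mnorm N (X, w)) (mnorm N (X', w')))%R.
Proof.
move=> sN l01 XX ww.
apply: (@le_trans _ _ (l * mnorm N (X, w) + (1 - l) * mnorm N (X', w'))%R).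
  rewrite /mnorm /=.
  (* In each product [X (e, k) * w k] one factor is common to both points, so the bilinear
     expression combines affinely. *)
  have -> : dots (vcomb l X X') (vcomb l w w') = vcomb l (dots X w) (dots X' w').
    apply/funext => e; rewrite /dots /vcomb /vdot !mulr_sumr -big_split /=.
    apply: eq_bigr => k _; rewrite /vrow.
    have [->|k0] := eqVneq k i0; first by rewrite ww; ring.
    by rewrite XX//; ring.
  have := sn_conv sN (dots X w) (dots X' w') l01.
  have := ler_wpM2l (ltW eps0) (vnorm_vcomb w w' l01); lra.
have [h1 h2] : (mnorm N (X, w) <= Num.max (mnorm N (X, w)) (mnorm N (X', w')) /\
  mnorm N (X', w') <= Num.max (mnorm N (X, w)) (mnorm N (X', w')))%R.
  by rewrite !le_max !lexx orbT.
by move: h1 h2; set m := Num.max _ _; case/andP: l01 => *; nra.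
Qed.

Lemma mnorm_flip N X w : seminorm N ->
  mnorm N ((fun p => if p.2 == i0 then - X p else X p)%R,
       (fun k => if k == i0 then w k else - w k)%R) = mnorm N (X, w).
Proof.
move=> sN; rewrite /mnorm /=; congr (_ + _ * _)%R.
  rewrite (_ : dots _ _ = vscale (-1) (dots X w)).
    by rewrite sn_homo// normrN1 mul1r.
  apply/funext => e; rewrite /dots /vscale /vdot mulr_sumr; apply: eq_bigr => k _.
  by rewrite /vrow /=; case: (k == i0); ring.
rewrite /vnorm; congr Num.sqrt; apply: eq_bigr => k _.
by case: (k == i0); rewrite ?mulrNN.
Qed.

(** Boundedness is where [eps] enters: [eps |w| < 1] on the set. *)
Lemma steiner_convex_mnorm N : seminorm N ->
  steiner_convex i0 [set p | (mnorm N p < 1)%R].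
Proof.
move=> sN; split.
- rewrite (_ : [set p | _] = [set p : VX * VW | (mnorm N p)%:E < 1%:E]); last first.
    by apply/seteqP; split=> p /=; rewrite lte_fin.
  by apply: measurable_ltE => //; exact: measurable_mnorm.
- move=> X X' w w' l l01 XX ww /= h1 h2.
  by apply: le_lt_trans (mnorm_comb sN l01 XX ww) _; rewrite gt_max h1.
- by move=> X w; rewrite /= mnorm_flip.
- exists eps^-1%R => X w k /= h.
  rewrite -[ltRHS]mul1r ltr_pdivlMr// mulrC; apply: le_lt_trans h.
  rewrite /mnorm /= (le_trans (ler_wpM2l (ltW eps0) (le_coord_vnorm w k)))//.
  by rewrite lerDr sn_ge0.
Qed.

Lemma steiner_qconcave_mnorm N (phi : R -> \bar R) : seminorm N ->
  measurable_fun setT phi -> (forall t, 0 <= phi t) ->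
  (forall s t, (0 <= s)%R -> (s <= t)%R -> phi t <= phi s) ->
  steiner_qconcave (phi \o mnorm N).
Proof.
move=> sN mphi phi0 phid; split.
- by apply: measurableT_comp => //; exact: measurable_mnorm.
- by move=> p; exact: phi0.
- move=> X X' w w' l l01 XX ww /=; have := mnorm_comb sN l01 XX ww.
  have [hle|/ltW hle] := leP (mnorm N (X, w)) (mnorm N (X', w')) => h.
    by rewrite ge_min; apply/orP; right; apply: phid => //; exact: mnorm_ge0.
  by rewrite ge_min; apply/orP; left; apply: phid => //; exact: mnorm_ge0.
- by move=> X w /=; rewrite mnorm_flip.
Qed.

End seminorm_kernel.

End kernels.

(** * Reflections and volume *)

Section householder.
Context (R : realType) (D : finType).
Local Open Scope ereal_scope.
Implicit Types (x y u v : vec R D).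

(** Householder reflection in the hyperplane orthogonal to [u], the identity if [u = 0]. Reflections
    suffice as rotations, since one of them takes a given vector to a given axis. *)
Definition hh u x : vec R D := fun k => (x k - 2 * vdot x u / vdot u u * u k)%R.

Let shear i (a : vec R D) x : vec R D :=
  fun j => if j == i then x i else (x j + x i * a j)%R.

Let measurable_shear i a : measurable_fun setT (shear i a).
Proof.
apply: measurable_vec => j; rewrite /shear; case: (j == i); first exact: measurable_coord.
apply: measurable_funD; first exact: measurable_coord.
by apply: measurable_funM => //; exact: measurable_coord.
Qed.

(** With [x_i] fixed, the shear is a translation of the other coordinates. *)
Let itint_shear i a (g : vec R D -> \bar R) x : measurable_fun setT g -> (forall y, 0 <= g y) ->
  itint (enum D) (g \o shear i a) x = itint (enum D) g x.
Proof.
move=> mg g0.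
have mgs : measurable_fun setT (g \o shear i a) by exact: measurableT_comp.
have iD : i \in enum D by rewrite mem_enum.
have uD := enum_uniq D.
have gs0 y : 0 <= (g \o shear i a) y by exact: g0.
rewrite (itint_rem x mgs gs0 uD iD) [RHS](itint_rem x mg g0 uD iD) /=.
apply: eq_integral => t _.
pose b : vec R D := fun j => if j == i then 0%R else (t * a j)%R.
have niD : i \notin rem i (enum D) by rewrite mem_rem_uniqF.
rewrite (eq_itint (h := fun y => g (vadd y b))); last first.
  move=> y yx /=; congr g; apply/funext => j; rewrite /shear /vadd /b.
  by have yi : y i = t by [rewrite yx// updE]; case: eqVneq => [->|_]; rewrite yi ?addr0.
rewrite itint_shift//; apply: eq_itint_base => j jD.
have -> : j = i.
  apply/eqP; apply: contraNT jD => ji; rewrite mem_rem_uniq// inE ji.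
  by rewrite mem_enum.
by rewrite /vadd /b eqxx addr0.
Qed.

Lemma measurable_hh u : measurable_fun setT (hh u).
Proof.
apply: measurable_vec => j; apply: measurable_funB; first exact: measurable_coord.
apply: measurable_funM => //; apply: measurable_funM => //; apply: measurable_funM => //.
exact: measurable_vdot.
Qed.

(* After the shear x_j -= x_i u_j / u_i the vector u becomes u_i e_i, so the
   reflection modifies only the coordinate i. *)
Lemma itint_hh u (g : vec R D -> \bar R) x : measurable_fun setT g -> (forall y, 0 <= g y) ->
  itint (enum D) (g \o hh u) x = itint (enum D) g x.
Proof.
move=> mg g0.
have [u0|/existsNP[i /eqP ui]] := pselect (forall k, u k = 0%R).
  congr itint; apply/funext => y /=; congr g; apply/funext => k.
  by rewrite /hh u0 mulr0 subr0.
pose a : vec R D := fun j => (u j / u i)%R.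
pose phi y : R := (- (2 * \sum_(j | j != i) y j * u j / vdot u u) * u i)%R.
have mphi : measurable_fun setT phi.
  apply: measurable_funM => //; apply: measurableT_comp => //.
  apply: measurable_funM => //; under eq_fun do rewrite -big_filter.
  apply: measurable_sum => j; by do 2 apply: measurable_funM => //;
    exact: measurable_coord.
pose P y := upd y i (-1 * y i + phi y)%R.
have mP : measurable_fun setT P.
  apply: measurable_upd => //; apply: measurable_funD => //.
  by apply: measurable_funM => //; exact: measurable_coord.
have U0 : vdot u u != 0%R.
  rewrite gt_eqF// lt_neqAle vdot_ge0 andbT eq_sym; apply/eqP => U0.
  have := vnorm_eq0 (x := u); rewrite /vnorm U0 sqrtr0 => /(_ erefl) /(congr1 (@^~ i)).
  by move/eqP; rewrite (negbTE ui).
have E : g \o hh u = ((g \o shear i a) \o P) \o shear i (vscale (-1) a).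
  apply/funext => y /=; congr g; apply/funext => j.
  set y' := shear i _ y.
  have yi : y' i = y i by rewrite /y' /shear eqxx.
  have key : (P y' i = y i - 2 * vdot y u / vdot u u * u i)%R.
    rewrite /P updE yi /phi.
    (* The inverse shear contributes [- (y_i / u_i) <u, u>] to the sum, which turns the [-y_i] of
       [P] into the [+y_i] of the reflection. *)
    have -> : (\sum_(j | j != i) y' j * u j / vdot u u =
       (vdot y u - y i / u i * vdot u u) / vdot u u)%R.
      rewrite -mulr_suml; congr (_ / _)%R.
      rewrite {2}/vdot mulr_sumr /vdot -sumrB [RHS](bigD1 i)//=.
      rewrite (_ : (y i * u i - _ = 0)%R) ?add0r; last by field.
      apply: eq_bigr => k ki; rewrite /y' /shear (negbTE ki) /vscale /a; ring.
    by field; rewrite ui U0.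
  rewrite {1}/shear; case: eqVneq => [->|ji]; first by rewrite key /hh.
  rewrite key /P updN// /y' /shear (negbTE ji) /vscale /a /hh.
  by field; rewrite ui U0.
rewrite E itint_shear; [|by do 2 apply: measurableT_comp => //|by move=> y; exact: g0].
have mgs : measurable_fun setT (g \o shear i a) by exact: measurableT_comp.
have gs0 y : 0 <= (g \o shear i a) y by exact: g0.
have phii y t : phi (upd y i t) = phi y.
  rewrite /phi; congr (- (2 * _) * _)%R; apply: eq_bigr => j ji.
  by rewrite updN.
have iD : i \in enum D by rewrite mem_enum.
have N1 : `|-1 : R|%R = 1%R by rewrite normrN1.
transitivity (itint (enum D) (g \o shear i a) x).
  exact: (itint_coord_affine x mgs gs0 mphi phii (enum_uniq D) iD N1).
exact: itint_shear.
Qed.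

Lemma vdotC x y : vdot x y = vdot y x.
Proof. by apply: eq_bigr => k _; rewrite mulrC. Qed.

Lemma vdot_hhl u x y : vdot (hh u x) y =
  (vdot x y - 2 * vdot x u / vdot u u * vdot u y)%R.
Proof.
rewrite /vdot mulr_sumr -sumrB; apply: eq_bigr => k _; rewrite /hh /vdot; ring.
Qed.

Lemma vdot_hh_sym u x y : vdot (hh u x) y = vdot x (hh u y).
Proof. by rewrite vdot_hhl [RHS]vdotC vdot_hhl (vdotC x y) (vdotC u y) (vdotC x u); ring. Qed.

Lemma hhK u x : hh u (hh u x) = x.
Proof.
apply/funext => k; rewrite {1}/hh vdot_hhl /hh.
have [U0|U0] := eqVneq (vdot u u) 0%R; first by rewrite U0 invr0; ring.
by field.
Qed.

Lemma vnorm_hh u x : vnorm (hh u x) = vnorm x.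
Proof. by rewrite /vnorm vdot_hh_sym hhK. Qed.

Lemma hh_vadd u x y : hh u (vadd x y) = vadd (hh u x) (hh u y).
Proof.
apply/funext => k; rewrite /hh /vadd.
have -> : vdot (fun j => x j + y j)%R u = (vdot x u + vdot y u)%R.
  by rewrite /vdot -big_split; apply: eq_bigr => j _; rewrite mulrDl.
ring.
Qed.

Definition vaxis (i : D) (c : R) : vec R D := fun k => if k == i then c else 0%R.

(** The reflection that exchanges [v] with the vector of the same length on the axis has normal
    [v - |v| e_i]. If [v] is that vector already, the normal is 0 and the reflection is the
    identity. *)
Lemma hh_to_axis i v : exists u, hh u v = vaxis i (vnorm v).
Proof.
pose u : vec R D := fun k => (v k - vaxis i (vnorm v) k)%R; exists u.
have vE : vdot v u = (vdot v v - vnorm v * v i)%R.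
  rewrite /vdot (_ : (vnorm v * v i = \sum_k v k * vaxis i (vnorm v) k)%R).
    by rewrite -sumrB; apply: eq_bigr => k _; rewrite /u mulrBr.
  rewrite (bigD1 i)//= big1 => [|k ki]; last by rewrite /vaxis (negbTE ki) mulr0.
  by rewrite /vaxis eqxx addr0 mulrC.
have bE : vdot (vaxis i (vnorm v)) u = (vnorm v * v i - vdot v v)%R.
  rewrite /vdot (bigD1 i)//= big1 => [|k ki]; last by rewrite /vaxis (negbTE ki) mul0r.
  by rewrite -/(vdot v v) -vnorm_sqr addr0 /u /vaxis eqxx; ring.
have uE : vdot u u = (2 * vdot v u)%R.
  have -> : vdot u u = (vdot v u - vdot (vaxis i (vnorm v)) u)%R.
    by rewrite /vdot -sumrB; apply: eq_bigr => k _; rewrite -mulrBl.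
  by rewrite bE vE; ring.
apply/funext => k; rewrite /hh.
have [U0|U0] := eqVneq (vdot u u) 0%R.
  have /vnorm_eq0 u0 : vnorm u = 0%R by rewrite /vnorm U0 sqrtr0.
  have /(congr1 (@^~ k)) := u0; rewrite /u => /eqP; rewrite subr_eq0 => /eqP ->.
  by rewrite U0 invr0; ring.
by rewrite -uE divff// mul1r /u; ring.
Qed.

End householder.

Section volume.
Context (R : realType) (D : finType).
Local Open Scope ereal_scope.
Notation mu := (@lebesgue_measure R).
Implicit Types (A B : set (vec R D)) (x y u v : vec R D).

Definition vol A : \bar R := itint (enum D) (fun x => (\1_A x)%:E) (fun=> 0%R).

Lemma vol_ge0 A : 0 <= vol A.
Proof. by apply: itint_ge0 => x; exact: indicE_ge0. Qed.

Lemma le_vol A B : measurable A -> measurable B -> A `<=` B -> vol A <= vol B.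
Proof.
move=> mA mB AB; apply: le_itint.
- exact: measurable_indicE.
- exact: measurable_indicE.
- by move=> x; exact: indicE_ge0.
- by move=> x _; rewrite lee_fin !indicE ler_nat; case: (boolP (x \in A)) => // /set_mem/AB/mem_set ->.
- by move=> x; exact: indicE_ge0.
Qed.

Lemma vol_hh u A : measurable A -> vol (hh u @^-1` A) = vol A.
Proof.
move=> mA; rewrite /vol -[RHS](itint_hh u).
- by apply: eq_itint => x _ /=; congr EFin; exact: eq_indic.
- exact: measurable_indicE.
- by move=> x; exact: indicE_ge0.
Qed.

Lemma volD A B : measurable A -> measurable B ->
  vol A = vol (A `&` B) + vol (A `\` B).
Proof.
move=> mA mB; rewrite /vol -itintD.
- apply: eq_itint => x _; rewrite -EFinD; congr EFin; rewrite !indicE.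
  rewrite in_setI in_setD; case: (x \in A); case: (x \in B); rewrite /= ?addr0 ?add0r//.
- by apply: measurable_indicE; exact: measurableI.
- by apply: measurable_indicE; exact: measurableD.
- by move=> x; exact: indicE_ge0.
- by move=> x; exact: indicE_ge0.
Qed.

Lemma vol_fiber i : exists2 s : seq D, i \notin s & forall A, measurable A ->
  vol A = itint s (fun x => mu [set t | A (upd x i t)]) (fun=> 0%R).
Proof.
exists (rem i (enum D)); first by rewrite mem_rem_uniqF// enum_uniq.
move=> A mA; rewrite /vol.
have ps : perm_eq (enum D) (rem i (enum D) ++ [:: i]).
  by rewrite perm_sym perm_catC /= perm_sym perm_to_rem// mem_enum.
rewrite (perm_itint _ _ _ (enum_uniq D) ps).
- by rewrite itint_cat; apply: eq_itint => x _ /=; rewrite integral_fiber.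
- exact: measurable_indicE.
- by move=> x; exact: indicE_ge0.
Qed.

Lemma measurable_mu_fiber i A : measurable A ->
  measurable_fun setT (fun x => mu [set t | A (upd x i t)]).
Proof.
move=> mA; rewrite (_ : (fun x => _) = itint [:: i] (fun y => (\1_A y)%:E)).
  by apply: measurable_itint1; [exact: measurable_indicE|move=> y; exact: indicE_ge0].
by apply/funext => x /=; rewrite integral_fiber.
Qed.

Lemma mu_centred (c : \bar R) : 0 <= c -> mu [set t : R | ((2 * `|t|)%:E < c)%E] = c.
Proof.
case: c => [c| |//] c0.
- rewrite (_ : [set t | _] = `](- (c / 2))%R, (c / 2)%R[%classic); last first.
    apply/seteqP; split=> t /=; rewrite in_itv/= lte_fin -ltr_norml;
      rewrite ltr_pdivlMr// mulrC//.
  rewrite lebesgue_measure_itv/= lte_fin lee_fin in c0 *.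
  by case: ltP => h; rewrite -?EFinB; congr EFin; lra.
- rewrite (_ : [set t | _] = [set` `]-oo, +oo[ ]); last first.
    by apply/seteqP; split=> t //= _; rewrite ltry.
  by rewrite lebesgue_measure_itv.
Qed.

Lemma mu_steiner_fiber i A x :
  mu [set t | steiner i A (upd x i t)] = mu [set t | A (upd x i t)].
Proof.
rewrite -[RHS]mu_centred//; congr (lebesgue_measure _).
apply/seteqP; split=> t /=; rewrite /steiner /= updE;
  by have -> : [set s | A (upd (upd x i t) i s)] = [set s | A (upd x i s)] by
    apply/seteqP; split=> s /=; rewrite upd_upd.
Qed.

Lemma vol_steiner i A : measurable A -> vol (steiner i A) = vol A.
Proof.
move=> mA; have [s _ H] := vol_fiber i; rewrite !H//; last exact: measurable_steiner.
by apply: eq_itint => x _; exact: mu_steiner_fiber.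
Qed.

Definition vshift i (lam : R) x : vec R D := upd x i (x i + lam)%R.

(** Let [a] and [b] be the fibres of [A] and [B], with [b] centred. Symmetrization lowers the
    measure of [a \ b] to the positive part of [|a| - |b|], which is [|a \ b|] minus the smaller of
    [|a \ b|] and [|b \ a|]. The points of [a \ b] that the shift carries into [b \ a] have measure
    at most that smaller number. *)
Lemma steiner_gain i A B (lam : R) : measurable A -> measurable B ->
  steiner i B = B ->
  (forall x, mu [set t | A (upd x i t)] < +oo) ->
  (forall x, mu [set t | B (upd x i t)] < +oo) ->
  vol (steiner i A `\` B) +
    vol [set x | (A `\` B) x /\ (B `\` A) (vshift i lam x)] <= vol (A `\` B).
Proof.
move=> mA mB SB fA fB; set E := [set x | _ /\ _].
have mSA : measurable (steiner i A) by exact: measurable_steiner.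
have mE : measurable E.
  have mm : measurable_fun setT (vshift i lam).
    apply: measurable_upd => //; apply: measurable_funD => //; exact: measurable_coord.
  apply: measurableI; first exact: measurableD.
  by have := mm measurableT _ (measurableD mB mA); rewrite setTI.
have [s _ H] := vol_fiber i.
rewrite !H; [|exact: measurableD|exact: mE|exact: measurableD].
rewrite -itintD; [|apply: measurable_mu_fiber; exact: measurableD|
   exact: measurable_mu_fiber|by []|by []].
apply: le_itint => //.
- apply: emeasurable_funD; apply: measurable_mu_fiber => //; exact: measurableD.
- apply: measurable_mu_fiber; exact: measurableD.
- by move=> x; rewrite adde_ge0.
move=> x _.
pose a := [set t | A (upd x i t)]; pose b := [set t | B (upd x i t)].
have ma : measurable a by exact: measurable_fiber.
have mb : measurable b by exact: measurable_fiber.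
have bE : b = [set t : R | ((2 * `|t|)%:E < mu b)%E].
  transitivity [set t | steiner i B (upd x i t)]; first by rewrite SB.
  apply/seteqP; split=> t /=; rewrite /steiner /= updE;
  by have -> : [set s | B (upd (upd x i t) i s)] = [set s | B (upd x i s)] by
    apply/seteqP; split=> s' /=; rewrite upd_upd.
have aE : [set t | steiner i A (upd x i t)] = [set t : R | ((2 * `|t|)%:E < mu a)%E].
  apply/seteqP; split=> t /=; rewrite /steiner /= updE;
  by have -> : [set s | A (upd (upd x i t) i s)] = [set s | A (upd x i s)] by
    apply/seteqP; split=> s' /=; rewrite upd_upd.
pose ee := [set t | E (upd x i t)].
have me : measurable ee by exact: measurable_fiber.
have e1 : mu ee <= mu (a `\` b).
  apply: le_measure; rewrite ?inE//; first exact: measurableD.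
  by move=> t [].
have e2 : mu ee <= mu (b `\` a).
  rewrite (@lebesgue_affine _ 1 (- lam) ee)// ?oner_eq0// normr1 mul1e.
  apply: le_measure; rewrite ?inE.
  - have m1 : measurable_fun setT (fun t : R => (1 * t + - lam)%R).
      by apply: measurable_funD => //; exact: measurable_funM.
    by have := m1 measurableT _ me; rewrite setTI.
  - exact: measurableD.
  - move=> t [_]; rewrite /b /a /= /vshift updE upd_upd mul1r subrK; by case.
have -> : [set t | (steiner i A `\` B) (upd x i t)] = [set t | steiner i A (upd x i t)] `\` b by [].
have -> : [set t | (A `\` B) (upd x i t)] = a `\` b by [].
rewrite aE.
have fa : mu a \is a fin_num by rewrite ge0_fin_numE// fA.
have fb : mu b \is a fin_num by rewrite ge0_fin_numE// fB.
(* If [a] is no longer than [b], the centred copy of [a] lies in [b] and nothing remains outside. *)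
have [ab|ba] := leP (mu a) (mu b).
  rewrite (_ : _ `\` b = set0) ?measure0 ?add0e//.
  rewrite bE -subset0 => t /= [h]; apply; exact: lt_le_trans ab.
have mA2 : measurable [set t : R | (2 * `|t|)%:E < mu a].
  rewrite -aE; exact: measurable_fiber.
have A2E : mu [set t : R | (2 * `|t|)%:E < mu a] = mu a by rewrite mu_centred.
have fA2 : mu [set t : R | (2 * `|t|)%:E < mu a] < +oo by rewrite A2E fA.
have muD (S T : set R) : measurable S -> measurable T -> mu S < +oo ->
    mu (S `\` T) = mu S - mu (S `&` T) by move=> *; exact: measureD.
rewrite muD// A2E setIidr; last first.
  by rewrite [X in X `<=` _]bE => t /= h; exact: lt_trans ba.
rewrite (muD a b)//; last exact: fA.
apply: (@le_trans _ _ (mu a - mu b + mu (b `\` a))); first by rewrite leeD2l.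
rewrite (muD b a)//; last exact: fB.
by rewrite setIC addeA subeK.
Qed.

End volume.

(** * Integration row by row *)

Section blocks.
Context (R : realType) (I D : finType).
Local Open Scope ereal_scope.
Notation VX := (vec R (I * D)%type).
Notation VW := (vec R D).
Implicit Types (X : VX) (e : I) (es : seq I).

Definition bins e X (x : VW) : VX := fun p => if p.1 == e then x p.2 else X p.

Definition blk es : seq (I * D) := [seq (e, k) | e <- es, k <- enum D].

Lemma measurable_bins d (T : measurableType d) e (f : T -> VX) (g : T -> VW) :
  measurable_fun setT f -> measurable_fun setT g ->
  measurable_fun setT (fun t => bins e (f t) (g t)).
Proof.
move=> mf mg; apply: measurable_vec => p; rewrite /bins; case: (p.1 == e).
  exact: (measurableT_comp (measurable_coord p.2) mg).
exact: (measurableT_comp (measurable_coord p) mf).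
Qed.

Lemma vrow_bins e X x : vrow (bins e X x) e = x.
Proof. by apply/funext => k; rewrite /vrow /bins eqxx. Qed.

Lemma vrow_binsN e e' X x : e' != e -> vrow (bins e X x) e' = vrow X e'.
Proof. by move=> /negbTE ee; apply/funext => k; rewrite /vrow /bins /= ee. Qed.

Lemma bins_vrow e X : bins e X (vrow X e) = X.
Proof. by apply/funext => -[e' k]; rewrite /bins /vrow /=; case: eqVneq => [->|]. Qed.

Lemma itint_block e (F : VX -> \bar R) X :
  itint [seq (e, k) | k <- enum D] F X =
  itint (enum D) (fun x => F (bins e X x)) (fun=> 0%R).
Proof.
rewrite -{1}(bins_vrow e X) (itint_map (G := bins e X)).
  by apply: eq_itint_base => k; rewrite mem_enum.
move=> x k t _; apply/funext => -[e' k']; rewrite /bins /upd /= xpair_eqE.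
by case: (e' == e).
Qed.

Lemma itint_blk_cons e es F X :
  itint (blk (e :: es)) F X =
  itint (enum D) (fun x => itint (blk es) F (bins e X x)) (fun=> 0%R).
Proof. by rewrite /blk /= itint_cat itint_block. Qed.

Lemma mem_blk es p : (p \in blk es) = (p.1 \in es).
Proof.
apply/allpairsPdep/idP => [[e [k [ees _ ->]]]//|pes].
by exists p.1, p.2; rewrite mem_enum -surjective_pairing.
Qed.

Lemma itint_enum_blk F X : measurable_fun setT F -> (forall X, 0 <= F X) ->
  itint (enum {: I * D}) F X = itint (blk (enum I)) F X.
Proof.
move=> mF F0; apply: perm_itint => //; first exact: enum_uniq.
apply: uniq_perm; first exact: enum_uniq.
  by apply: allpairs_uniq; rewrite ?enum_uniq// => -[? ?] [? ?].
by move=> p; rewrite mem_blk !mem_enum.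
Qed.

Lemma itint_blk_out es e F X (f : VW -> \bar R) : e \notin es ->
  measurable_fun setT F -> (forall X, 0 <= F X) -> (forall x, 0 <= f x) ->
  itint (blk es) (fun X => f (vrow X e) * F X) X = f (vrow X e) * itint (blk es) F X.
Proof.
move=> ees mF F0 f0; rewrite -itintZ//; apply: eq_itint => Y YX.
congr (f _ * _); apply/funext => k; rewrite /vrow YX// mem_blk//.
Qed.

Lemma measurable_prod_rows es (g : I -> VW -> R) : (forall e, measurable_fun setT (g e)) ->
  measurable_fun setT (fun X : VX => (\prod_(e <- es) g e (vrow X e))%R).
Proof.
move=> mg; apply: measurable_prod => e _.
exact: (measurableT_comp (mg e) (measurable_vrow e)).
Qed.

Lemma itint_blk_prod_le es (g : I -> VW -> R) (c : I -> R) X : uniq es ->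
  (forall e, measurable_fun setT (g e)) -> (forall e x, 0 <= g e x)%R ->
  (forall e, itint (enum D) (fun x => (g e x)%:E) (fun=> 0%R) <= (c e)%:E) ->
  itint (blk es) (fun X => (\prod_(e <- es) g e (vrow X e))%:E) X <=
  (\prod_(e <- es) c e)%:E.
Proof.
move=> + mg g0 gc.
have c0 e : (0 <= c e)%R.
  rewrite -lee_fin (le_trans _ (gc e))//; apply: itint_ge0 => x.
  by rewrite lee_fin.
have mP s : measurable_fun setT (fun X : VX => (\prod_(e <- s) g e (vrow X e))%:E).
  by apply/measurable_EFinP; exact: measurable_prod_rows.
have P0 s (X' : VX) : 0 <= (\prod_(e <- s) g e (vrow X' e))%:E.
  by rewrite lee_fin prodr_ge0.
elim: es X => [|e es IH] X /=; first by rewrite !big_nil.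
move=> /andP[ees ues]; rewrite itint_blk_cons.
apply: (@le_trans _ _ (itint (enum D) (fun x => (\prod_(e <- es) c e)%:E * (g e x)%:E) (fun=> 0%R))).
  apply: le_itint.
  - apply: (@measurable_itint _ _ _ VW (blk es)
      (fun q => (\prod_(e <- e :: es) g e (vrow q.2 e))%:E) (bins e X)) => //.
    + exact: (measurableT_comp (mP (e :: es))).
    + by apply: (measurable_bins e (f := fun=> X) (g := id)).
  - by apply: emeasurable_funM => //; apply/measurable_EFinP; exact: mg.
  - by move=> x; apply: itint_ge0 => y; exact: P0.
  - move=> x _.
    have -> : itint (blk es) (fun Y => (\prod_(e' <- e :: es) g e' (vrow Y e'))%:E) (bins e X x) =
        (g e x)%:E * itint (blk es) (fun Y => (\prod_(e' <- es) g e' (vrow Y e'))%:E) (bins e X x).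
      have f0 (y : VW) : 0 <= (g e y)%:E by rewrite lee_fin.
      have := itint_blk_out (bins e X x) ees (mP es) (P0 es) f0; rewrite vrow_bins => <-.
      by apply: eq_itint => Y _; rewrite big_cons EFinM.
    rewrite muleC; by apply: lee_wpmul2r; [rewrite lee_fin|exact: IH].
  - by move=> x; rewrite mule_ge0// lee_fin// prodr_ge0.
rewrite itintZ//; [|by apply/measurable_EFinP; exact: mg|
  by move=> x; rewrite lee_fin|by rewrite lee_fin prodr_ge0].
by rewrite big_cons mulrC EFinM lee_wpmul2l// lee_fin prodr_ge0.
Qed.

Definition hhX u X : VX := fun p => hh u (vrow X p.1) p.2.

(** Reflecting only the rows in [es] permits an induction over the rows. *)
Let hhes u es X : VX := fun p => if p.1 \in es then hh u (vrow X p.1) p.2 else X p.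

Let measurable_hhes u es : measurable_fun setT (hhes u es).
Proof.
apply: measurable_vec => p; rewrite /hhes; case: (p.1 \in es); last exact: measurable_coord.
have m : measurable_fun setT (fun X : VX => hh u (vrow X p.1)).
  by apply: measurableT_comp; [exact: measurable_hh|exact: measurable_vrow].
exact: (measurableT_comp (measurable_coord p.2) m).
Qed.

Lemma measurable_hhX u : measurable_fun setT (hhX u).
Proof.
apply: measurable_vec => p; have m : measurable_fun setT (fun X : VX => hh u (vrow X p.1)).
  by apply: measurableT_comp; [exact: measurable_hh|exact: measurable_vrow].
exact: (measurableT_comp (measurable_coord p.2) m).
Qed.

Let itint_hhes u es F X : uniq es -> measurable_fun setT F -> (forall X, 0 <= F X) ->
  itint (blk es) (F \o hhes u es) X = itint (blk es) F X.
Proof.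
elim: es F X => [|e es IH] F X /=; first by move=> _ _ _; congr F.
move=> /andP[ees ues] mF F0; rewrite !itint_blk_cons.
have E : F \o hhes u (e :: es) = (F \o hhes u [:: e]) \o hhes u es.
  apply/funext => Y /=; congr F; apply/funext => -[e' k]; rewrite /hhes /= !inE.
  have [->|ee] := eqVneq e' e; last by [].
  by congr hh; apply/funext => k'; rewrite /vrow /= (negbTE ees).
have m1 : measurable_fun setT (F \o hhes u [:: e]) by exact: measurableT_comp.
rewrite E.
transitivity (itint (enum D) (fun x => itint (blk es) F (bins e X (hh u x))) (fun=> 0%R)).
  apply: eq_itint => x _; rewrite (IH _ _ ues m1); last by move=> Y; exact: F0.
  have mp : itint (map id (blk es)) F (hhes u [:: e] (bins e X x)) =
      itint (blk es) (F \o hhes u [:: e]) (bins e X x).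
    apply: itint_map => Y p t; rewrite mem_blk => pes.
    have pe : p.1 != e by apply: contraNneq ees => <-.
    apply/funext => -[e' k]; rewrite /hhes /upd /= inE.
    case: (eqVneq e' e) => [->|ee] //.
    have -> : ((e, k) == p) = false by apply: contraNF pe => /eqP <-.
    congr hh; apply/funext => k'; rewrite /vrow.
    by have -> : ((e, k') == p) = false by apply: contraNF pe => /eqP <-.
  rewrite -mp map_id; congr itint.
  apply/funext => -[e' k]; rewrite /hhes /bins /= inE; case: eqVneq => [->|//].
  by rewrite -/(bins e X x) vrow_bins.
have m2 : measurable_fun setT (fun x => itint (blk es) F (bins e X x)).
  apply: (@measurable_itint _ _ _ VW (blk es) (fun q => F q.2) (bins e X)) => //.
  + exact: (measurableT_comp mF).
  + by apply: (measurable_bins e (f := fun=> X) (g := id)).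
have m20 y : 0 <= itint (blk es) F (bins e X y) by exact: itint_ge0.
exact: (itint_hh u (fun=> 0%R) m2 m20).
Qed.

Lemma itint_hhX u F X : measurable_fun setT F -> (forall X, 0 <= F X) ->
  itint (enum {: I * D}) (F \o hhX u) X = itint (enum {: I * D}) F X.
Proof.
move=> mF F0.
have m1 : measurable_fun setT (F \o hhX u).
  by apply: measurableT_comp => //; exact: measurable_hhX.
have m10 Y : 0 <= (F \o hhX u) Y by exact: F0.
rewrite (itint_enum_blk X m1 m10) (itint_enum_blk X mF F0).
rewrite -[RHS](itint_hhes u X (enum_uniq I) mF F0).
apply: eq_itint => Y _ /=; congr F; apply/funext => p.
by rewrite /hhX /hhes mem_enum.
Qed.

End blocks.

Section averaging.
Context (R : realType) (D : finType).
Local Open Scope ereal_scope.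
Implicit Types (A B : set (vec R D)) (x y u v : vec R D).

Lemma vol_box_le A (rho : R) : measurable A -> (0 <= rho)%R ->
  (forall x k, A x -> `|x k| < rho)%R -> vol A <= ((2 * rho) ^+ #|D|)%:E.
Proof.
move=> mA rho0 Arho.
pose f (j : D) (t : R) : R := (`|t - 0| < rho)%R%:R.
have mf j : measurable_fun setT (f j) by exact: measurable_iv.
have f0 j t : (0 <= f j t)%R by rewrite /f ler0n.
have := @itint_prod_le R D (enum D) f (fun=> (2 * rho)%R) (fun=> 0%R) (enum_uniq D) mf f0.
rewrite big_enum/= prodr_const => H; apply: le_trans (H _); last first.
  by move=> e; rewrite /f lebesgue_iv.
apply: le_itint.
- exact: measurable_indicE.
- apply/measurable_EFinP; apply: measurable_prod => j _.
  by apply: (measurableT_comp (mf j)); exact: measurable_coord.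
- by move=> y; exact: indicE_ge0.
- move=> y _; rewrite lee_fin indicE.
  case: (boolP (y \in A)) => [/set_mem Ay|_]; last by rewrite prodr_ge0.
  by rewrite big1// => j _; rewrite /f subr0 Arho.
- by move=> y; rewrite lee_fin prodr_ge0.
Qed.

(* Fubini: the integral over v of vol {x in A, x + v in B} is vol A * vol B. *)
Lemma vol_translate A B (rho c : R) : measurable A -> measurable B ->
  (0 <= rho)%R -> (0 <= c)%R ->
  (forall x k, A x -> `|x k| < rho)%R -> (forall x k, B x -> `|x k| < rho)%R ->
  (forall v, vol [set x | A x /\ B (vadd x v)] <= c%:E) ->
  vol A * vol B <= (c * (4 * rho) ^+ #|D|)%:E.
Proof.
move=> mA mB rho0 c0 Arho Brho Hc.
pose g (q : vec R D * vec R D) : \bar R := (\1_A q.1)%:E * (\1_B (vadd q.1 q.2))%:E.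
have mg : measurable_fun setT g.
  apply: emeasurable_funM; apply: measurable_indic_comp => //.
  apply: measurable_vec => j; apply: measurable_funD.
    by apply: (measurableT_comp (measurable_coord j)); exact: measurable_fst.
  by apply: (measurableT_comp (measurable_coord j)); exact: measurable_snd.
have g0 q : 0 <= g q by rewrite mule_ge0// indicE_ge0.
have E1 : vol A * vol B = itint (enum D) (fun x => itint (enum D)
    (fun v => g (x, v)) (fun=> 0%R)) (fun=> 0%R).
  rewrite muleC {2}/vol -itintZ.
  - apply: eq_itint => x _; rewrite /g /= itintZ.
    + rewrite muleC; congr (_ * _).
      have mB' : measurable_fun setT (fun y => (\1_B y)%:E : \bar R).
        exact: measurable_indicE.
      have B0 y : 0 <= (\1_B y : R)%:E by exact: indicE_ge0.
      have := itint_shift (enum D) (fun=> 0%R) x mB' B0.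
      have -> : itint (enum D) (fun x => (\1_B x)%:E) (vadd (fun=> 0%R) x) = vol B.
        by apply: eq_itint_base => k; rewrite mem_enum.
      move=> <-; apply: eq_itint => y _; congr ((\1_B _)%:E).
      by apply/funext => k; rewrite /vadd addrC.
    + apply: measurable_indic_comp => //; apply: measurable_vec => j.
      by apply: measurable_funD => //; exact: measurable_coord.
    + by move=> y; exact: indicE_ge0.
    + exact: indicE_ge0.
  - exact: measurable_indicE.
  - by move=> y; exact: indicE_ge0.
  - exact: vol_ge0.
rewrite E1 itintC//.
(* For [v] outside this box no point of [A] is moved into [B]; the volume of the box is the source
   of the factor [(4 rho) ^+ #|D|]. *)
pose S := [set v : vec R D | forall k, (`|v k| < 2 * rho)%R].
have mS : measurable S.
  have -> : S = \bigcap_k [set v : vec R D | (`|v k|)%:E < (2 * rho)%:E].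
    apply/seteqP; split=> v h k; first by move=> _ /=; rewrite lte_fin; exact: h.
    by have /= := h k Logic.I; rewrite lte_fin.
  apply: fin_bigcap_measurable => [|k _]; first exact: finite_finset.
  by apply: measurable_ltE => //; apply: measurableT_comp => //; exact: measurable_coord.
apply: (@le_trans _ _ (c%:E * vol S)); last first.
  rewrite EFinM lee_wpmul2l// ?lee_fin// (_ : 4 * rho = 2 * (2 * rho))%R; last by ring.
  have r2 : (0 <= 2 * rho)%R by rewrite mulr_ge0.
  by apply: vol_box_le => // x k Sx; exact: Sx.
rewrite /vol -itintZ; [|exact: measurable_indicE|by move=> y; exact: indicE_ge0|by rewrite lee_fin].
apply: le_itint.
- apply: (@measurable_itint _ _ _ (vec R D) (enum D) (fun q => g (q.2, q.1)) (fun=> (fun=> 0%R))) => //.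
  by apply: (measurableT_comp mg); apply: measurable_fun_pair; [exact: measurable_snd|exact: measurable_fst].
- by apply: emeasurable_funM => //; exact: measurable_indicE.
- by move=> v; apply: itint_ge0.
- move=> v _.
  have gE x : g (x, v) = (\1_[set x | A x /\ B (vadd x v)] x)%:E.
    rewrite /g /= -EFinM; congr EFin.
    rewrite !indicE; have [Ax|nAx] := pselect (A x); last first.
      by rewrite [x \in A]memNset// mul0r memNset// => -[].
    have [Bx|nBx] := pselect (B (vadd x v)); first by rewrite !mem_set ?mulr1.
    by rewrite [vadd x v \in B]memNset// mulr0 memNset// => -[].
  under eq_itint do rewrite gE.
  have [Sv|nSv] := pselect (S v).
    by rewrite indicE mem_set// mule1; exact: Hc.
  rewrite indicE memNset// mule0 -/(vol _) (_ : [set x | _] = set0).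
    by rewrite /vol; under eq_itint do rewrite indic0; rewrite itint0.
  rewrite -subset0 => x [Ax Bx]; apply: nSv => k.
  have := Arho _ k Ax; have := Brho _ k Bx; rewrite /vadd !ltr_norml.
  by move=> /andP[? ?] /andP[? ?]; apply/andP; split; lra.
- by move=> v; rewrite mule_ge0 ?lee_fin.
Qed.

End averaging.

(** * Balls and their volumes *)

Section balls.
Context (R : realType) (D : finType) (i0 : D).
Local Open Scope ereal_scope.
Notation mu := (@lebesgue_measure R).
Implicit Types (A B : set (vec R D)) (x y u v : vec R D).

Definition ballv (r : R) : set (vec R D) := [set x | (vnorm x < r)%R].

Lemma measurable_ballv r : measurable (ballv r).
Proof.
rewrite (_ : ballv r = [set x | (vnorm x)%:E < r%:E]); last first.
  by apply/seteqP; split=> x /=; rewrite /ballv /= lte_fin.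
by apply: measurable_ltE => //; exact: measurable_vnorm.
Qed.

Lemma hh_ballv u r : hh u @^-1` ballv r = ballv r.
Proof. by apply/seteqP; split=> x; rewrite /preimage /ballv /= vnorm_hh. Qed.

Lemma ballv_coord r x k : ballv r x -> (`|x k| < r)%R.
Proof. exact/le_lt_trans/le_coord_vnorm. Qed.

Lemma steiner_ballv r : steiner i0 (ballv r) = ballv r.
Proof.
have [r0|r0] := leP r 0%R.
  have -> : ballv r = set0.
    by rewrite -subset0 => x /= h; have := vnorm_ge0 x; rewrite leNgt (lt_le_trans h).
  rewrite -subset0 => x; rewrite /steiner /= (_ : [set t | _] = set0)// measure0.
  by rewrite lte_fin ltNge mulr_ge0.
apply/seteqP; suff H x : steiner i0 (ballv r) x <-> ballv r x by split=> x /H.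
pose s := (\sum_(k | k != i0) x k * x k)%R.
have s0 : (0 <= s)%R by apply: sumr_ge0 => k _; rewrite -expr2 sqr_ge0.
have nE t : ballv r (upd x i0 t) = (t ^+ 2 < r ^+ 2 - s)%R :> Prop.
  rewrite /ballv /= -(ltr_sqr (vnorm_ge0 _)) ?nnegrE ?ltW// vnorm_sqr /vdot.
  rewrite (bigD1 i0)//= updE ltrBrDr expr2.
  by under eq_bigr => k ki do rewrite updN//.
have xE : ballv r x = (x i0 ^+ 2 < r ^+ 2 - s)%R :> Prop.
  by rewrite -nE; congr (ballv r _); apply/funext => k; rewrite /upd; case: eqVneq => [->|].
rewrite /steiner /= (_ : [set t | _] = [set t | (t ^+ 2 < r ^+ 2 - s)%R]); last first.
  by apply/seteqP; split=> t /=; rewrite nE.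
rewrite xE; have [h|h] := leP (r ^+ 2 - s)%R 0%R.
  have h2 (t : R) : ~ (t ^+ 2 < r ^+ 2 - s)%R.
    by move=> h3; have := lt_le_trans h3 h; rewrite ltNge sqr_ge0.
  split => [|/h2//]; rewrite (_ : [set t | _] = set0) ?measure0.
    by rewrite lte_fin ltNge mulr_ge0.
  by rewrite -subset0 => t /h2.
pose a := Num.sqrt (r ^+ 2 - s)%R.
have a0 : (0 < a)%R by rewrite sqrtr_gt0.
have aE (t : R) : (t ^+ 2 < r ^+ 2 - s)%R = (`|t| < a)%R.
  by rewrite -(sqr_sqrtr (ltW h)) -/a -real_normK ?num_real// ltr_sqr// ?nnegrE// ltW.
rewrite (_ : [set t | _] = [set t : R | ((2 * `|t|)%:E < (2 * a)%:E)%E]); last first.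
  by apply/seteqP; split=> t /=; rewrite aE lte_fin ltr_pM2l.
rewrite mu_centred ?lee_fin ?mulr_ge0// ?ltW//.
by rewrite lte_fin ltr_pM2l// aE.
Qed.

Definition omegav : R := fine (vol (ballv 1)).

Lemma vol_ballv1 : 0 < vol (ballv 1) < +oo.
Proof.
have n0 : (0 < #|D|)%N by apply/card_gt0P; exists i0.
apply/andP; split; last first.
  apply: (@le_lt_trans _ _ ((2 * 1) ^+ #|D|)%:E); last by rewrite ltry.
  by apply: vol_box_le => //; [exact: measurable_ballv|move=> x k; exact: ballv_coord].
(* The cube of half-side [c = 1 / #|D|] lies in the unit ball, because [x_k^2 < c] for each of the
   [#|D|] coordinates. This gives the positive lower bound. *)
pose c : R := (#|D|%:R^-1)%R.
have c0 : (0 < c)%R by rewrite invr_gt0 ltr0n.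
pose S := [set x : vec R D | forall k, (`|x k| < c)%R].
have SB x : S x -> ballv 1 x.
  move=> Sx; rewrite /ballv /= -(ltr_sqr (vnorm_ge0 _)) ?nnegrE// vnorm_sqr expr1n.
  have h : (vdot x x < \sum_(k : D) c)%R.
    rewrite /vdot (bigD1 i0)//= [ltRHS](bigD1 i0)//=.
    have c1 : (c <= 1)%R by rewrite invf_le1 ?ltr0n// ler1n.
    have step k : (x k * x k < c)%R.
      rewrite -expr2 -real_normK ?num_real// expr2.
      apply: (@lt_le_trans _ _ (c * c)%R); first by apply: ltr_pM.
      by rewrite ger_pMl.
    by apply: ltr_leD => //; apply: ler_sum => k _; exact: ltW.
  apply: (lt_le_trans h); rewrite sumr_const /c -[X in (X <= _)%R]mulr_natl divff//.
  by rewrite pnatr_eq0 -lt0n.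
have mS : measurable S.
  have -> : S = \bigcap_k [set v : vec R D | (`|v k|)%:E < c%:E].
    apply/seteqP; split=> v h k; first by move=> _ /=; rewrite lte_fin; exact: h.
    by have /= := h k Logic.I; rewrite lte_fin.
  apply: fin_bigcap_measurable => [|k _]; first exact: finite_finset.
  by apply: measurable_ltE => //; apply: measurableT_comp => //; exact: measurable_coord.
apply: lt_le_trans (le_vol mS (measurable_ballv 1) SB).
suff -> : vol S = ((2 * c) ^+ #|D|)%:E by rewrite lte_fin exprn_gt0// mulr_gt0.
have SE x : (\1_S x)%:E = (\prod_(k <- enum D) (`|x k - 0| < c)%R%:R)%:E :> \bar R.
  congr EFin; rewrite big_enum /= indicE; have [Sx|/existsNP[k nS]] := pselect (S x).
    by rewrite mem_set// big1// => k _; rewrite subr0 Sx.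
  rewrite memNset; last by move=> /(_ k).
  by rewrite (bigD1 k)//= subr0 (negbTE (introN idP nS)) mul0r.
rewrite /vol; under eq_fun do rewrite SE.
have gen (s : seq D) z : uniq s ->
    itint s (fun x : vec R D => (\prod_(k <- s) (`|x k - 0| < c)%R%:R)%:E) z =
    ((2 * c) ^+ size s)%:E.
  elim: s z => [|k s IH] z /=; first by rewrite big_nil.
  move=> /andP[ks us].
  have st t : itint s (fun x : vec R D => (\prod_(j <- k :: s) (`|x j - 0| < c)%R%:R)%:E) (upd z k t) =
      ((2 * c) ^+ size s)%:E * ((`|t - 0| < c)%R%:R)%:E.
    rewrite -(IH (upd z k t))// muleC -itintZ.
    - by apply: eq_itint => y yz; rewrite big_cons EFinM yz// updE.
    - apply/measurable_EFinP; apply: measurable_prod => j _.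
      by apply: (measurableT_comp (measurable_iv 0%R c)); exact: measurable_coord.
    - by move=> y; rewrite lee_fin prodr_ge0// => j _; rewrite ler0n.
    - by rewrite lee_fin ler0n.
  under eq_integral do rewrite st.
  have miv : measurable_fun setT (fun t : R => ((`|t - 0| < c)%R%:R)%:E : \bar R).
    by apply/measurable_EFinP; exact: measurable_iv.
  have iv0 (t : R) : setT t -> 0 <= ((`|t - 0| < c)%R%:R : R)%:E by rewrite lee_fin ler0n.
  have k0 : 0 <= ((2 * c) ^+ size s)%:E by rewrite lee_fin exprn_ge0// mulr_ge0// ltW.
  rewrite (ge0_integralZl lebesgue_measure measurableT miv iv0 k0).
  by rewrite lebesgue_iv ?ltW// -EFinM exprSr.
by rewrite gen ?enum_uniq// -cardE.
Qed.

Lemma omegavE : vol (ballv 1) = omegav%:E.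
Proof. by rewrite fineK// ge0_fin_numE ?vol_ge0//; case/andP: vol_ballv1. Qed.

Lemma omegav_gt0 : (0 < omegav)%R.
Proof. by rewrite -lte_fin -omegavE; case/andP: vol_ballv1. Qed.

Lemma vol_ballv r : (0 <= r)%R -> vol (ballv r) = (omegav * r ^+ #|D|)%:E.
Proof.
rewrite le_eqVlt => /predU1P[<-|r0].
  have -> : ballv 0 = set0.
    by rewrite -subset0 => x /= h; have := vnorm_ge0 x; rewrite leNgt h.
  have n0 : (#|D| != 0)%N by rewrite -lt0n; apply/card_gt0P; exists i0.
  rewrite expr0n (negbTE n0) mulr0 /vol.
  by under eq_fun do rewrite indic0; rewrite itint0.
have mb : measurable_fun setT (fun x => (\1_(ballv r) x)%:E : \bar R).
  by apply: measurable_indicE; exact: measurable_ballv.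
have b0 x : 0 <= (\1_(ballv r) x : R)%:E by exact: indicE_ge0.
have := itint_scale (enum D) (fun=> 0%R) mb b0 r0.
have -> : vscale r (fun=> 0%R) = (fun=> 0%R) :> vec R D.
  by apply/funext => k; rewrite /vscale mulr0.
rewrite -/(vol (ballv r)) => <-; rewrite -cardE mulrC EFinM -omegavE; congr (_ * _).
apply: eq_itint => x _; congr EFin; apply: eq_indic.
by rewrite /ballv /= vnormZ gtr0_norm// -[X in (_ < X)%R]mulr1 ltr_pM2l.
Qed.

(** Written through the volume and not through a radius, it also covers infinite volume, where it is
    the whole space, and it depends measurably on the volume. *)
Definition star A : set (vec R D) :=
  [set x | (omegav * vnorm x ^+ #|D|)%:E < vol A].

Lemma starE A : vol A < +oo -> exists r, [/\ (0 <= r)%R, star A = ballv r & vol (ballv r) = vol A].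
Proof.
move=> Afin.
have n0 : (#|D| != 0)%N by rewrite -lt0n; apply/card_gt0P; exists i0.
have AE : vol A = (fine (vol A))%:E by rewrite fineK// ge0_fin_numE// vol_ge0.
have w0 := omegav_gt0.
have a0 : (0 <= fine (vol A))%R by apply: fine_ge0; exact: vol_ge0.
pose r := ((fine (vol A) / omegav) `^ #|D|%:R^-1)%R.
have r0 : (0 <= r)%R by exact: powR_ge0.
have rn : (r ^+ #|D| = fine (vol A) / omegav)%R.
  have q0 : (0 <= fine (vol A) / omegav)%R by apply: divr_ge0 => //; exact: ltW.
  by rewrite -powR_mulrn// /r -powRrM mulVf ?powRr1// pnatr_eq0.
exists r; split => //; last first.
  by rewrite vol_ballv// rn AE; congr EFin; field; rewrite gt_eqF.
apply/seteqP; split=> x; rewrite /star /ballv /= AE lte_fin -ltr_pdivlMl// mulrC -rn.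
  by rewrite ltr_pXn2r ?lt0n ?nnegrE ?vnorm_ge0.
by rewrite ltr_pXn2r ?lt0n ?nnegrE ?vnorm_ge0.
Qed.

Lemma star_mono A B : vol A <= vol B -> star A `<=` star B.
Proof. by move=> AB x /= h; exact: lt_le_trans AB. Qed.

Lemma steiner_mono A B : measurable A -> measurable B -> A `<=` B ->
  steiner i0 A `<=` steiner i0 B.
Proof.
move=> mA mB AB x; rewrite /steiner /= => h; apply: (lt_le_trans h).
apply: le_measure; rewrite ?inE; [exact: measurable_fiber|exact: measurable_fiber|].
by move=> t /AB.
Qed.

Lemma fiber_ballv_lty r x : mu [set t | ballv r (upd x i0 t)] < +oo.
Proof.
apply: (@le_lt_trans _ _ (mu `](- r)%R, r[%classic)).
  apply: le_measure; rewrite ?inE; [exact: measurable_fiber (measurable_ballv r)|by []|].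
  move=> t /= h; have := ballv_coord i0 h; rewrite updE ltr_norml in_itv//.
by rewrite lebesgue_measure_itv/=; case: ifP => _; rewrite ?ltry// -EFinB ltry.
Qed.

Lemma fiber_lty A r x : measurable A -> A `<=` ballv r ->
  mu [set t | A (upd x i0 t)] < +oo.
Proof.
move=> mA Ar; apply: le_lt_trans (fiber_ballv_lty r x).
apply: le_measure; rewrite ?inE; [exact: measurable_fiber|
  exact: measurable_fiber (measurable_ballv r)|by move=> t /Ar].
Qed.

End balls.

(** * From Steiner symmetrization to balls *)

Section greedy.
Context (R : realType) (I D : finType) (i0 : D).
Local Open Scope ereal_scope.
Notation VX := (vec R (I * D)%type).
Notation VW := (vec R D).
Variables (V : VX -> \bar R) (C : R).
Hypothesis mV : measurable_fun setT V.
Hypothesis V0 : forall X, 0 <= V X.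
Hypothesis VC : forall X, V X <= C%:E.
Hypothesis Vhh : forall u X, V (hhX u X) = V X.
Hypothesis Vst : forall A : I -> set VW, (forall e, measurable (A e)) ->
  (exists rho, forall e, A e `<=` ballv rho) ->
  setform A V <= setform (steiner i0 \o A) V.

Implicit Types (A B W : I -> set VW).

Lemma measurable_setform A : (forall e, measurable (A e)) ->
  measurable_fun setT (fun X => (\prod_e \1_(A e) (vrow X e))%:E * V X).
Proof.
move=> mA; apply: emeasurable_funM => //; apply/measurable_EFinP.
exact: measurable_prod_indic.
Qed.

Lemma setform_hh u A : (forall e, measurable (A e)) ->
  setform (fun e => hh u @^-1` A e) V = setform A V.
Proof.
move=> mA; rewrite /setform -[RHS](itint_hhX u).
- apply: eq_itint => X _ /=; rewrite Vhh.
  by rewrite (eq_bigr (fun e => \1_(A e) (vrow (hhX u X) e))).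
- exact: measurable_setform.
- by move=> X; rewrite mule_ge0// prod_indic_ge0.
Qed.

(** The estimate of [mform_telescope] with vectors in place of real variables. *)
Lemma setform_telescope B W (eta c : R) :
  (forall e, measurable (B e)) -> (forall e, measurable (W e)) ->
  (forall e, vol (B e) <= c%:E) -> (forall e, vol (B e `\` W e) <= eta%:E) ->
  (1 <= c)%R -> (0 <= eta)%R ->
  setform B V <= setform W V + (#|I|%:R * (C * (eta * c ^+ #|I|)))%:E.
Proof.
move=> mB mW Bc BW c1 eta0.
have C0 : (0 <= C)%R by rewrite -lee_fin (le_trans _ (VC (fun=> 0%R))).
pose g e e' : VW -> R := if e' == e then \1_(B e `\` W e) else \1_(B e').
have mg e e' : measurable_fun setT (g e e').
  by rewrite /g; case: eqP => _; apply: measurable_indic => //; exact: measurableD.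
have g0 e e' t : (0 <= g e e' t)%R by rewrite /g; case: ifP.
have mprod e : measurable_fun setT (fun X : VX => \prod_e' g e e' (vrow X e'))%R.
  exact: measurable_prod_rows.
have mG e : measurable_fun setT (fun X : VX => (C * \prod_e' g e e' (vrow X e'))%:E).
  by apply/measurable_EFinP; apply: measurable_funM => //; exact: mprod.
have G0 e (X : VX) : 0 <= (C * \prod_e' g e e' (vrow X e'))%:E.
  by rewrite lee_fin mulr_ge0// prodr_ge0.
pose G (X : VX) := \sum_e (C * \prod_e' g e e' (vrow X e'))%:E.
have mGs : measurable_fun setT G by apply: emeasurable_sum => e; exact: mG.
have Gs0 X : 0 <= G X by apply: sume_ge0 => e _; exact: G0.
have W0 X : 0 <= (\prod_e \1_(W e) (vrow X e))%:E * V X.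
  by rewrite mule_ge0// prod_indic_ge0.
apply: (@le_trans _ _ (itint (enum {: I * D}) (fun X : VX =>
    (\prod_e \1_(W e) (vrow X e))%:E * V X + G X) (fun=> 0%R))).
  apply: le_itint.
  - exact: measurable_setform.
  - by apply: emeasurable_funD => //; exact: measurable_setform.
  - by move=> X; rewrite mule_ge0// prod_indic_ge0.
  - move=> X _; apply: (@le_trans _ _ (((\prod_e \1_(W e) (vrow X e)) +
       \sum_e \prod_e' g e e' (vrow X e'))%:E * V X)).
      apply: lee_wpmul2r => //; rewrite lee_fin.
      have := prod_indic_telescope R B W (vrow X); congr (_ <= _ + _)%R.
      by apply: eq_bigr => e _; apply: eq_bigr => e' _; rewrite /g; case: ifP.
    have S0 : (0 <= \sum_e \prod_e' g e e' (vrow X e'))%R.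
      by rewrite sumr_ge0// => e _; rewrite prodr_ge0.
    rewrite EFinD ge0_muleDl ?lee_fin ?prodr_ge0//.
    rewrite leeD2l// /G sumEFin -mulr_sumr EFinM muleC lee_wpmul2r//.
  - by move=> X; rewrite adde_ge0.
rewrite itintD//; last exact: measurable_setform.
rewrite leeD2l// itint_sum//.
have -> : (#|I|%:R * (C * (eta * c ^+ #|I|)))%:E =
    \sum_(e : I) (C * (eta * c ^+ #|I|))%:E.
  by rewrite sumEFin sumr_const mulr_natl.
apply: lee_sum => e _.
have mpE : measurable_fun setT (fun X : VX => (\prod_e' g e e' (vrow X e'))%:E).
  by apply/measurable_EFinP; exact: mprod.
have pE0 (X : VX) : 0 <= (\prod_e' g e e' (vrow X e'))%:E by rewrite lee_fin prodr_ge0.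
under eq_fun do rewrite EFinM.
rewrite itintZ// ?lee_fin// EFinM lee_wpmul2l ?lee_fin//.
rewrite itint_enum_blk//.
have := @itint_blk_prod_le R I D (enum I) (g e) (fun e' => if e' == e then eta else c)
  (fun=> 0%R) (enum_uniq I) (mg e) (g0 e).
have -> : (fun X : VX => (\prod_(e' <- enum I) g e e' (vrow X e'))%:E) =
   (fun X : VX => (\prod_e' g e e' (vrow X e'))%:E).
  by apply/funext => X; rewrite big_enum.
move=> H; apply: (le_trans (H _)) => [e'|].
  by rewrite /g; case: eqP => _; [exact: BW|exact: Bc].
rewrite lee_fin big_enum /= (bigD1 e)//= eqxx.
rewrite ler_wpM2l// (eq_bigr (fun=> c)) => [|e' /negbTE ->//].
by rewrite prodr_const ler_weXn2l// max_card.
Qed.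

Definition defect B A : R := (\sum_e fine (vol (A e `\` B e)))%R.

Variables (A : I -> set VW) (rho : R).
Hypothesis mA : forall e, measurable (A e).
Hypothesis Arho : forall e, A e `<=` ballv rho.

Let rho_ge0 e : A e !=set0 -> (0 <= rho)%R.
Proof.
by move=> [x /Arho]; rewrite /ballv /= => /ltW; apply: le_trans; exact: vnorm_ge0.
Qed.

(** An invariant in place of finite sequences of symmetrizations: it records all that is used of a
    tuple obtained from [A] in this way. *)
Definition reachable A' := [/\ forall e, measurable (A' e),
  forall e, A' e `<=` ballv rho, forall e, vol (A' e) = vol (A e) &
  setform A V <= setform A' V].

Let B e := star (A e).

Let sub_lty (S : set VW) : measurable S -> S `<=` ballv rho -> vol S < +oo.
Proof.
move=> mS Srho; apply: (@le_lt_trans _ _ ((2 * `|rho|) ^+ #|D|)%:E); last by rewrite ltry.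
apply: vol_box_le => // x k /Srho h; apply: lt_le_trans (ler_norm rho).
exact: ballv_coord h.
Qed.

Let BE e : exists r : R,
  [/\ (0 <= r)%R, B e = ballv r & vol (ballv r : set VW) = vol (A e)].
Proof. by apply: (starE i0); exact: sub_lty. Qed.

Let mB e : measurable (B e).
Proof. by have [r [_ -> _]] := BE e; exact: measurable_ballv. Qed.

Let volB e : vol (B e) = vol (A e).
Proof. by have [r [_ -> ->]] := BE e. Qed.

Let Brho e : B e `<=` ballv rho.
Proof.
have [Ae|/set0P[x Ax]] := eqVneq (A e) set0.
  move=> x; rewrite /B /star /= Ae /vol.
  under eq_fun do rewrite indic0; rewrite itint0 lte_fin ltNge mulr_ge0//.
    exact/ltW/omegav_gt0.
  by rewrite exprn_ge0// vnorm_ge0.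
have r0 : (0 <= rho)%R by apply: (rho_ge0 (e := e)); exists x.
move=> y; rewrite /B /star /= => h.
have := lt_le_trans h (le_vol (mA e) (measurable_ballv rho) (@Arho e)).
rewrite (vol_ballv i0)// lte_fin (ltr_pM2l (omegav_gt0 R i0)).
rewrite ltr_pXn2r ?nnegrE ?vnorm_ge0//.
by apply/card_gt0P; exists i0.
Qed.

Let hhB u e : hh u @^-1` B e = B e.
Proof. by have [r [_ -> _]] := BE e; rewrite hh_ballv. Qed.

(** Steiner symmetrization in the direction that the reflection takes to the axis [i0]. *)
Let step (u : VW) A' : I -> set VW := fun e =>
  hh u @^-1` steiner i0 (hh u @^-1` A' e).

Let measurable_pre u (S : set VW) : measurable S -> measurable (hh u @^-1` S).
Proof. by move=> mS; have := measurable_hh u measurableT mS; rewrite setTI. Qed.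

Lemma reachable_step u A' : reachable A' -> reachable (step u A').
Proof.
move=> [mA' A'rho volA' leA'].
have mp e : measurable (hh u @^-1` A' e) by exact: measurable_pre.
have prho e : hh u @^-1` A' e `<=` ballv rho.
  by rewrite -[X in _ `<=` X](hh_ballv u) => x; exact: A'rho.
have ms e : measurable (steiner i0 (hh u @^-1` A' e)) by exact: measurable_steiner.
split.
- by move=> e; exact: measurable_pre.
- move=> e; rewrite /step -[X in _ `<=` X](hh_ballv u) => x h.
  rewrite /preimage /mkset -(steiner_ballv i0).
  by apply: (steiner_mono (mp e) (measurable_ballv rho) (prho e)).
- by move=> e; rewrite /step vol_hh// vol_steiner// vol_hh.
- apply: (le_trans leA'); rewrite -(setform_hh u mA') /step.
  apply: (le_trans (Vst mp _)); first by exists rho.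
  by rewrite (setform_hh u (A := steiner i0 \o (fun e => hh u @^-1` A' e))).
Qed.

(** The reflection turns the shift by [v] into a shift by [|v|] along the axis and preserves the
    ball [B e], so the gain along the axis becomes a gain along [v]. *)
Lemma step_gain u A' (v : VW) e : reachable A' -> hh u v = vaxis i0 (vnorm v) ->
  vol (step u A' e `\` B e) +
  vol [set x | (A' e `\` B e) x /\ (B e `\` A' e) (vadd x v)] <= vol (A' e `\` B e).
Proof.
move=> [mA' A'rho volA' leA'] uv.
have mp : measurable (hh u @^-1` A' e) by exact: measurable_pre.
have ms : measurable (steiner i0 (hh u @^-1` A' e)) by exact: measurable_steiner.
have prho : hh u @^-1` A' e `<=` ballv rho.
  by rewrite -[X in _ `<=` X](hh_ballv u) => x; exact: A'rho.
have SB : steiner i0 (B e) = B e.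
  by have [r [_ -> _]] := BE e; exact: steiner_ballv.
have := @steiner_gain R D i0 _ _ (vnorm v) mp (mB e) SB
  (fun x => fiber_lty i0 x mp prho) (fun x => fiber_lty i0 x (mB e) (@Brho e)).
have -> : vol (hh u @^-1` A' e `\` B e) = vol (A' e `\` B e).
  rewrite -{1}(hhB u e) -[RHS](vol_hh u)//; exact: measurableD.
have -> : vol (steiner i0 (hh u @^-1` A' e) `\` B e) = vol (step u A' e `\` B e).
  rewrite /step -[in RHS](hhB u e) -[LHS](vol_hh u)//; exact: measurableD.
set E1 := (X in _ + vol X <= _); set E2 := [set x | _ /\ (B e `\` A' e) _].
suff -> : E1 = hh u @^-1` E2.
  rewrite vol_hh//; apply: measurableI; first exact: measurableD.
  have mv : measurable_fun setT (fun x : VW => vadd x v).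
    apply: measurable_vec => k; apply: measurable_funD => //; exact: measurable_coord.
  by have := mv measurableT _ (measurableD (mB e) (mA' e)); rewrite setTI.
have key x : hh u (vshift i0 (vnorm v) x) = vadd (hh u x) v.
  have -> : vshift i0 (vnorm v) x = vadd x (hh u v).
    rewrite uv; apply/funext => k; rewrite /vshift /upd /vadd /vaxis.
    by case: eqVneq => [->|_] //; rewrite addr0.
  by rewrite hh_vadd hhK.
have hB x : B e (hh u x) = B e x by rewrite -[in RHS](hhB u e).
apply/seteqP; split=> x; rewrite /E1 /E2 /setD /preimage /= -key !hB; by case.
Qed.

Let fin_diff A' e (S : set VW) : reachable A' -> measurable S ->
  vol (A' e `\` S) = (fine (vol (A' e `\` S)))%:E.
Proof.
move=> [mA' A'rho _ _] mS; rewrite fineK// ge0_fin_numE ?vol_ge0//.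
by apply: sub_lty => [|x [/A'rho]//]; exact: measurableD.
Qed.

Let vol_diff_sym A' e : reachable A' -> vol (B e `\` A' e) = vol (A' e `\` B e).
Proof.
move=> [mA' A'rho volA' _].
have mI : measurable (A' e `&` B e) by exact: measurableI.
have fI : vol (A' e `&` B e) \is a fin_num.
  by rewrite ge0_fin_numE ?vol_ge0//; apply: sub_lty => // x [/A'rho].
have := volD (mA' e) (mB e); rewrite volA' -volB (volD (mB e) (mA' e)).
rewrite [B e `&` _]setIC addeC [RHS]addeC.
by move=> /(congr1 (fun z => z - vol (A' e `&` B e))); rewrite !addeK.
Qed.

(* If the infimum d of the defect over the reachable tuples were positive, some
   symmetrization would decrease an almost optimal defect below d. *)
Lemma reachable_defect (eta : R) : (0 < eta)%R ->
  exists2 A', reachable A' & (\sum_e fine (vol (A' e `\` B e)) < eta)%R.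
Proof.
move=> eta0.
pose S := [set d : R | exists2 A', reachable A' & d = (\sum_e fine (vol (A' e `\` B e)))%R].
have S0 : S !=set0.
  by exists (\sum_e fine (vol (A e `\` B e)))%R, A => //; split.
have Slb : lbound S 0%R.
  move=> _ [A' _ ->]; apply: sumr_ge0 => e _; apply: fine_ge0; exact: vol_ge0.
have Sinf : has_inf S by split => //; exists 0%R.
have d0 : (0 <= inf S)%R by exact: lb_le_inf.
suff dE : inf S = 0%R.
  have [_ [A' rA' ->]] := inf_adherent eta0 Sinf.
  by rewrite dE add0r => h; exists A'.
apply/eqP; rewrite eq_le d0 andbT leNgt; apply/negP => dpos.
set d := inf S in d0 dpos.
(* Some index has a defect of at least [delta], since otherwise the total would be at most
   [d / 2]. *)
pose delta : R := (d / (2 * #|I|%:R))%R.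
pose M : R := ((4 * `|rho|) ^+ #|D| + 1)%R.
have M0 : (0 < M)%R by rewrite /M ltr_wpDl// exprn_ge0// mulr_ge0.
(* Chosen so that [gam * M] is half of [delta ^+ 2]: by averaging over translations, some [v] gains
   more than [gam]. As the defect of [A'] is below [d + gam], one step brings it below [d]. *)
pose gam : R := (delta ^+ 2 / (2 * M))%R.
(* Without indices the defect is an empty sum, which contradicts [0 < d]. *)
have [e0] : exists e : I, True.
  apply: contrapT => nI; move: dpos; rewrite ltNge => /negP; apply.
  apply: (@ge_inf _ S) => //; first by exists 0%R.
  by exists A; [split|rewrite big1// => e _; exfalso; apply: nI; exists e].
move=> _.
have I0 : (0 < #|I|%:R :> R)%R by rewrite ltr0n; apply/card_gt0P; exists e0.
have del0 : (0 < delta)%R by rewrite divr_gt0// mulr_gt0.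
have gam0 : (0 < gam)%R by rewrite divr_gt0 ?exprn_gt0// mulr_gt0.
have [_ [A' rA' ->] Ad] := inf_adherent gam0 Sinf.
have dle A2 : reachable A2 -> (d <= \sum_e fine (vol (A2 e `\` B e)))%R.
  by move=> rA2; apply: ge_inf; [exists 0%R|exists A2].
have [e ed] : exists e, (delta <= fine (vol (A' e `\` B e)))%R.
  apply: contrapT => nex; have := dle _ rA'; rewrite leNgt => /negP; apply.
  apply: (@le_lt_trans _ _ (\sum_(e : I) delta)%R).
    apply: ler_sum => e _; rewrite leNgt; apply/negP => h; apply: nex.
    by exists e; exact: ltW.
  rewrite sumr_const -mulr_natl /delta invfM mulrCA mulrA mulrACA divff ?gt_eqF//.
  by lra.
have [mA' A'rho volA' _] := rA'.
pose E v := [set x | (A' e `\` B e) x /\ (B e `\` A' e) (vadd x v)].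
have bd (T : set VW) : T `<=` ballv rho -> forall x k, T x -> (`|x k| < `|rho|)%R.
  move=> Tr x k /Tr h; apply: lt_le_trans (ler_norm rho); exact: ballv_coord h.
have [v Ev] : exists v, gam%:E < vol (E v).
  apply: contrapT => nex.
  have Hv v : vol (E v) <= gam%:E.
    by rewrite leNgt; apply/negP => h; apply: nex; exists v.
  have := vol_translate (measurableD (mA' e) (mB e)) (measurableD (mB e) (mA' e))
    (normr_ge0 rho) (ltW gam0) (bd _ _) (bd _ _) Hv.
  rewrite vol_diff_sym// fin_diff// -EFinM lee_fin => H.
  have : (fine (vol (A' e `\` B e)) * fine (vol (A' e `\` B e)) <=
      gam * (4 * `|rho|) ^+ #|D|)%R.
    by apply: H => x [] => [/A'rho|/Brho].
  apply/negP; rewrite -ltNge; apply: (@lt_le_trans _ _ (delta * delta)%R); last first.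
    by apply: ler_pM => //; exact: ltW.
  apply: (@le_lt_trans _ _ (gam * M)%R); first by apply: ler_wpM2l; [exact: ltW|rewrite /M lerDl].
  have -> : (gam * M = delta * delta / 2)%R by rewrite /gam; field; rewrite gt_eqF.
  have : (0 < delta * delta)%R by exact: mulr_gt0.
  lra.
have [u uv] := hh_to_axis i0 v.
have rA2 := reachable_step u rA'.
have gain e' := step_gain e' rA' uv.
have fin2 e' : vol (step u A' e' `\` B e') = (fine (vol (step u A' e' `\` B e')))%:E.
  exact: fin_diff.
have : (\sum_e fine (vol (step u A' e `\` B e)) + gam <= \sum_e fine (vol (A' e `\` B e)))%R.
  rewrite (bigD1 e)//= [leRHS](bigD1 e)//= addrAC; apply: lerD.
    rewrite -lee_fin EFinD -fin2 -(fin_diff e rA' (mB e)).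
    by apply: le_trans (gain e); rewrite leeD2l// ltW.
  apply: ler_sum => e' _; rewrite -lee_fin -fin2 -(fin_diff e' rA' (mB e')).
  by apply: le_trans (gain e'); rewrite leeDl// vol_ge0.
have := dle _ rA2; lra.
Qed.

(** Replacing a reachable tuple of total defect below [eps / (K + 1)] by the balls costs at most
    [eps]. *)
Theorem setform_star : setform A V <= setform (fun e => star (A e)) V.
Proof.
have C0 : (0 <= C)%R by rewrite -lee_fin (le_trans _ (VC (fun=> 0%R))).
pose c : R := ((2 * `|rho|) ^+ #|D| + 1)%R.
have c1 : (1 <= c)%R by rewrite /c lerDr exprn_ge0// mulr_ge0.
pose K : R := (#|I|%:R * (C * c ^+ #|I|))%R.
have K0 : (0 <= K)%R by rewrite !mulr_ge0// exprn_ge0//; lra.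
apply/lee_addgt0Pr => eps eps0.
have eta0 : (0 < eps / (K + 1))%R by rewrite divr_gt0//; lra.
have [A' rA' dA'] := reachable_defect eta0.
have [mA' A'rho volA' leA'] := rA'.
apply: (le_trans leA').
have Kc : (#|I|%:R * (C * (eps / (K + 1) * c ^+ #|I|)) <= eps)%R.
  have -> : (#|I|%:R * (C * (eps / (K + 1) * c ^+ #|I|)) = eps * (K / (K + 1)))%R.
    by set k1 := ((K + 1)^-1)%R; rewrite /K; ring.
  by rewrite ger_pMr// ler_pdivrMr; lra.
apply: (@le_trans _ _ (setform B V + (#|I|%:R * (C * (eps / (K + 1) * c ^+ #|I|)))%:E)); last first.
  by rewrite leeD2l// lee_fin.
apply: setform_telescope => //; last exact: ltW.
- move=> e; apply: (@le_trans _ _ ((2 * `|rho|) ^+ #|D|)%:E); last by rewrite lee_fin /c lerDl.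
  apply: vol_box_le => // x k /A'rho h; apply: lt_le_trans (ler_norm rho).
  exact: ballv_coord h.
- move=> e; rewrite fin_diff// lee_fin; apply: le_trans (ltW dA').
  rewrite (bigD1 e)//= lerDl; apply: sumr_ge0 => e' _; apply: fine_ge0.
  exact: vol_ge0.
Qed.

End greedy.

(** * Null sets and dilation averages *)

Section null_sets.
Import HBNNSimple.
Context d (T : measurableType d) (R : realType) (mu : {measure set T -> \bar R}).
Local Open Scope ereal_scope.

(* No measurability of f and g: the integral of a nonnegative function is by
   definition a supremum over the simple functions below it. *)
Lemma eq_integral_null (Z : set T) (f g : T -> \bar R) : measurable Z ->
  mu Z = 0 -> (forall x, 0 <= f x) -> (forall x, 0 <= g x) ->
  (forall x, ~ Z x -> f x = g x) -> \int[mu]_x f x = \int[mu]_x g x.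
Proof.
move=> mZ Z0 f0 g0 fg.
have aux (u v : T -> \bar R) : (forall x, 0 <= u x) -> (forall x, 0 <= v x) ->
    (forall x, ~ Z x -> u x = v x) -> \int[mu]_x u x <= \int[mu]_x v x.
  move=> u0 v0 uv; rewrite !ge0_integralTE//; apply: ge_ereal_sup.
  move=> _ [h hu <-].
  apply: ereal_sup_ubound.
  (* A simple function below [u], set to 0 on [Z], is below [v] and has the same integral. *)
  exists (proj_nnsfun h (measurableC mZ)) => /=.
    move=> x; rewrite /mindic indicE; have [xZ|xZ] := pselect (Z x).
      by rewrite memNset ?mulr0// => /(_ xZ).
    by rewrite mem_set// mulr1 -uv.
  rewrite -!integralT_nnsfun; apply: ge0_ae_eq_integral => //.
  - by apply/measurable_EFinP => /=; apply: measurable_funM;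
      [exact: measurable_funPT|exact: measurable_indic (measurableC mZ)].
  - by apply/measurable_EFinP; exact: measurable_funPT.
  - by move=> x _; rewrite lee_fin.
  - by move=> x _; rewrite lee_fin.
  - exists Z; split => // x /= h1; apply: contrapT => nZ; apply: h1 => _.
    by rewrite /mindic /= indicE mem_set// mulr1.
apply/eqP; rewrite eq_le !aux// => x nZ; exact/esym/fg.
Qed.

End null_sets.

Section itint_null.
Context (R : realType) (J : finType).
Local Open Scope ereal_scope.
Implicit Types (s : seq J) (g h : vec R J -> \bar R) (x : vec R J).

(** For almost every [t] the section of [Z] at [t] is null again, so the induction descends through
    the coordinates. As [g] and [h] may fail to be measurable, the exceptional [t] are handled by
    [eq_integral_null]. *)
Lemma eq_itint_null (Z : set (vec R J)) s g h x : measurable Z ->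
  itint s (fun y => (\1_Z y)%:E) x = 0 ->
  (forall y, 0 <= g y) -> (forall y, 0 <= h y) ->
  (forall y, ~ Z y -> g y = h y) -> itint s g x = itint s h x.
Proof.
move=> mZ + g0 h0 gh; elim: s x => [|i s IH] x /= Z0.
  apply: gh => Zx; move/eqP: Z0; rewrite indicE mem_set//= eqe.
  by apply/negP; rewrite oner_neq0.
pose F t := itint s (fun y => (\1_Z y)%:E) (upd x i t).
have mI : measurable_fun setT (fun y : vec R J => (\1_Z y)%:E : \bar R).
  exact: measurable_indicE.
have F0 t : 0 <= F t by apply: itint_ge0 => y; exact: indicE_ge0.
have mF : measurable_fun setT F.
  by apply: measurable_itint_upd => // y; exact: indicE_ge0.
have : ae_eq lebesgue_measure setT F (cst 0).
  apply/(ae_eq_integral_abs lebesgue_measure measurableT mF).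
  by under eq_integral do rewrite gee0_abs//.
case=> W [mW W0 FW].
apply: (eq_integral_null mW W0) => [t|t|t nW]; [exact: itint_ge0|exact: itint_ge0|].
apply: IH; apply: contrapT => nF; apply: nW; apply: FW => /= h1; apply: nF.
exact: h1.
Qed.

Lemma itint_coord0 (i0 : J) :
  itint (enum J) (fun y => (\1_[set y : vec R J | y i0 = 0%R] y)%:E) (fun=> 0%R) = 0
    :> \bar R.
Proof.
have mZ : measurable [set y : vec R J | y i0 = 0%R].
  by have := measurable_coord i0 measurableT (measurable_set1 (0 : R)%R); rewrite setTI.
have [s _ H] := @vol_fiber R J i0; rewrite -/(vol _) H//.
rewrite -[RHS](itint0 s (fun=> 0%R)); apply: eq_itint => y _.
rewrite (_ : [set t | _] = [set 0%R]) ?lebesgue_measure_set1//.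
by apply/seteqP; split=> t /=; rewrite updE.
Qed.

Lemma eq_itint_neq0 (i0 : J) g h : (forall y, 0 <= g y) -> (forall y, 0 <= h y) ->
  (forall y, y i0 != 0%R -> g y = h y) ->
  itint (enum J) g (fun=> 0%R) = itint (enum J) h (fun=> 0%R).
Proof.
move=> g0 h0 gh.
apply: (@eq_itint_null [set y | y i0 = 0%R]) => //.
- by have := measurable_coord i0 measurableT (measurable_set1 (0 : R)%R); rewrite setTI.
- exact: itint_coord0.
- by move=> y /eqP; exact: gh.
Qed.

End itint_null.

Section swap.
Context (R : realType).
Local Open Scope ereal_scope.
Notation mu := (@lebesgue_measure R).

(** A cut-off to the unit interval, weighted so that its average over dilations is finite and the
    same for every positive argument. *)
Definition cutpow (d r : R) : R := if (0 < r < 1)%R then (r `^ d)%R else 0%R.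

Lemma measurable_cutpow d : measurable_fun setT (cutpow d).
Proof.
rewrite (_ : cutpow d = fun r => (r `^ d * \1_(`]0%R, 1%R[%classic) r)%R).
  by apply: measurable_funM => //; exact: measurable_powR.
apply/funext => r; rewrite /cutpow indicE mem_setE in_itv /=.
by case: ifP; rewrite ?mulr1 ?mulr0.
Qed.

Lemma cutpow_ge0 d r : (0 <= cutpow d r)%R.
Proof. by rewrite /cutpow; case: ifP => // _; exact: powR_ge0. Qed.

(** A shift by [ln a] removes [a]. What remains is [1 / d] times the reflected density of the
    exponential law of rate [d], except at [t = 0], where the strict cut-off gives 0. *)
Lemma integral_cutpow_expR (d a : R) : (0 < d)%R -> (0 < a)%R ->
  \int[mu]_t (cutpow d (expR t * a))%:E = d^-1%:E.
Proof.
move=> d0 a0.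
have mc : measurable_fun setT (fun t => (cutpow d (expR t))%:E : \bar R).
  by apply/measurable_EFinP; apply: (measurableT_comp (measurable_cutpow d)).
have c0 t : 0 <= (cutpow d (expR t))%:E by rewrite lee_fin cutpow_ge0.
transitivity (\int[mu]_t (cutpow d (expR (t + ln a)))%:E).
  by apply: eq_integral => t _; rewrite expRD lnK ?posrE.
rewrite (integral_shift (ln a) mc c0).
have -> : d^-1%:E = d^-1%:E * \int[mu]_t (exponential_pdf d t)%:E.
  by rewrite integral_exponential_pdf// mule1.
have me : measurable_fun setT (fun t => (exponential_pdf d t)%:E : \bar R).
  by apply/measurable_EFinP; exact: measurable_exponential_pdf.
have e0 t : 0 <= (exponential_pdf d t)%:E.
  by rewrite lee_fin; apply: exponential_pdf_ge0; exact: ltW.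
rewrite -(integral_affine (a := -1) 0 _ me e0) ?oppr_eq0// normrN1 mul1e.
have ml : measurable_fun setT (fun t : R => (exponential_pdf d (-1 * t + 0))%:E : \bar R).
  apply: (measurableT_comp me); apply: (@measurable_funD _ _ _ setT (fun t : R => -1 * t)%R (fun=> 0%R)) => //.
  by apply: (@measurable_funM _ _ _ setT (fun=> -1)%R (fun t : R => t)).
have dV : 0 <= d^-1%:E by rewrite lee_fin invr_ge0 ltW.
rewrite -(ge0_integralZl lebesgue_measure measurableT ml (fun t _ => e0 _) dV).
apply: (@eq_integral_null _ _ _ mu [set 0%R]) => //.
- exact: lebesgue_measure_set1.
- by move=> t; rewrite mule_ge0// lee_fin invr_ge0 ltW.
move=> t /eqP t0; rewrite addr0 mulN1r -EFinM; congr EFin; rewrite /cutpow expR_gt0 /=.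
have [tn|tp] := ltP t 0%R.
  rewrite -expR0 ltr_expR tn -expRM exponential_pdfE ?oppr_ge0 ?ltW//.
  by rewrite mulrA mulVf ?gt_eqF// mul1r mulrNN mulrC.
have {}tp : (0 < t)%R by rewrite lt_neqAle eq_sym t0.
by rewrite -expR0 ltr_expR ltNge ltW//= lt0_exponential_pdf ?oppr_lt0// mulr0.
Qed.

Variables (D : finType) (H : vec R D -> \bar R).
Hypothesis mH : measurable_fun setT H.
Hypothesis H0 : forall x, 0 <= H x.
Hypothesis Hhom : forall s x, (0 < s)%R -> (s ^+ #|D|)%:E * H (vscale s x) = H x.

(* Averaging over the dilations x -> e^t x exchanges the two cut-offs. *)
Lemma itint_swap_cutoff (a1 a2 : vec R D -> R) (d1 d2 : R) :
  (0 < d1)%R -> (0 < d2)%R ->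
  measurable_fun setT a1 -> measurable_fun setT a2 ->
  (forall x, 0 < a1 x <-> 0 < a2 x)%R ->
  (forall s x, (0 < s)%R -> a1 (vscale s x) = (s * a1 x)%R) ->
  (forall s x, (0 < s)%R -> a2 (vscale s x) = (s * a2 x)%R) ->
  d2^-1%:E * itint (enum D) (fun x => H x * (cutpow d1 (a1 x))%:E) (fun=> 0%R) =
  d1^-1%:E * itint (enum D) (fun x => H x * (cutpow d2 (a2 x))%:E) (fun=> 0%R).
Proof.
move=> d10 d20 ma1 ma2 a12 h1 h2.
have pos c y : cutpow c y != 0%R -> (0 < y)%R.
  by rewrite /cutpow; case: ifP => [/andP[]//|]; rewrite eqxx.
have mc c (a : vec R D -> R) : measurable_fun setT a ->
    measurable_fun setT (fun x => (cutpow c (a x))%:E : \bar R).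
  by move=> ma; apply/measurable_EFinP; apply: (measurableT_comp (measurable_cutpow c)).
have m1 c a : measurable_fun setT a -> measurable_fun setT (fun x => H x * (cutpow c (a x))%:E).
  by move=> ma; apply: emeasurable_funM => //; exact: mc.
have p1 c (a : vec R D -> R) x : 0 <= H x * (cutpow c (a x))%:E.
  by rewrite mule_ge0// lee_fin cutpow_ge0.
have d1e : 0 <= d1^-1%:E by rewrite lee_fin invr_ge0 ltW.
have d2e : 0 <= d2^-1%:E by rewrite lee_fin invr_ge0 ltW.
(* The constant [1 / c2] is expanded as an integral over dilations. The flag [e] selects the sign of
   [t]: with opposite signs on the two sides, dilating [x] by the factor [expR (- t)] identifies the
   two integrals for every [t]. *)
have avg (e : bool) c1 c2 (b1 b2 : vec R D -> R) : (0 < c2)%R ->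
    measurable_fun setT b1 -> measurable_fun setT b2 ->
    (forall x, 0 < b1 x -> 0 < b2 x)%R ->
    c2^-1%:E * itint (enum D) (fun x => H x * (cutpow c1 (b1 x))%:E) (fun=> 0%R) =
    \int[mu]_t itint (enum D) (fun x => H x * (cutpow c1 (b1 x))%:E *
       (cutpow c2 (expR (if e then - t else t)%R * b2 x))%:E) (fun=> 0%R).
  move=> c20 mb1 mb2 b12.
  rewrite -itintZ//; [|exact: m1|by rewrite lee_fin invr_ge0 ltW].
  have mE : measurable_fun setT (fun p : R * vec R D =>
      (cutpow c2 (expR (if e then - p.1 else p.1)%R * b2 p.2))%:E : \bar R).
    apply/measurable_EFinP; apply: (measurableT_comp (measurable_cutpow c2)).
    apply: measurable_funM => //; last exact: (measurableT_comp mb2).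
    have me : measurable_fun setT (@expR R) by [].
    apply: (measurableT_comp me).
    case: e; last exact: measurable_fst.
    have mo : measurable_fun setT (@GRing.opp R) by exact: oppr_measurable.
    by apply: (measurableT_comp mo); exact: measurable_fst.
  rewrite (itint_integral lebesgue_measure _ (g := fun p : R * vec R D => H p.2 * (cutpow c1 (b1 p.2))%:E *
       (cutpow c2 (expR (if e then - p.1 else p.1)%R * b2 p.2))%:E)).
  - apply: eq_itint => x _.
    have mEx : measurable_fun setT (fun t : R => (cutpow c2 (expR (if e then - t else t)%R * b2 x))%:E : \bar R).
      have mt : measurable_fun setT (fun t : R => (t, x : vec R D)) by exact: measurable_fun_pair.
      exact: (measurableT_comp mE mt).
    have cE t : 0 <= (cutpow c2 (expR (if e then - t else t)%R * b2 x))%:E.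
      by rewrite lee_fin cutpow_ge0.
    rewrite /= (ge0_integralZl lebesgue_measure measurableT mEx (fun t _ => cE t) (p1 c1 b1 x)).
    have [c0|/pos cp] := eqVneq (cutpow c1 (b1 x)) 0%R.
      by rewrite c0 mule0 mul0e mule0.
    rewrite [LHS]muleC; congr (_ * _); rewrite -(integral_cutpow_expR c20 (b12 _ cp)).
    case: e mE mEx cE => mE mEx cE; last exact: erefl.
    have n1 : (-1 != 0 :> R)%R by rewrite oppr_eq0 oner_eq0.
    have mE' : measurable_fun setT (fun t : R => (cutpow c2 (expR t * b2 x))%:E : \bar R).
      apply/measurable_EFinP; apply: (measurableT_comp (measurable_cutpow c2)).
      by apply: measurable_funM => //.
    have cE' t : 0 <= (cutpow c2 (expR t * b2 x))%:E by rewrite lee_fin cutpow_ge0.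
    rewrite -[LHS](integral_affine 0 n1 mE' cE') normrN1 mul1e.
    by apply: eq_integral => t _; rewrite addr0 mulN1r.
  - apply: emeasurable_funM; last exact: mE.
    by apply: (measurableT_comp (m1 _ _ mb1)); exact: measurable_snd.
  - by move=> p; rewrite mule_ge0// lee_fin cutpow_ge0.
rewrite (avg false d1 d2 a1 a2 d20 ma1 ma2 (fun x => (a12 x).1)).
rewrite (avg true d2 d1 a2 a1 d10 ma2 ma1 (fun x => (a12 x).2)).
apply: eq_integral => t _ /=.
have et : (0 < expR (- t))%R by exact: expR_gt0.
pose G x := H x * (cutpow d1 (a1 x))%:E * (cutpow d2 (expR t * a2 x))%:E.
have mG : measurable_fun setT G.
  apply: emeasurable_funM; first exact: m1.
  by apply: (mc d2 (fun x => expR t * a2 x)%R); exact: measurable_funM.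
have G0 x : 0 <= G x by rewrite mule_ge0// lee_fin cutpow_ge0.
have := itint_scale (enum D) (fun=> 0%R) mG G0 et.
rewrite (_ : vscale _ (fun=> 0%R) = (fun=> 0%R)); last first.
  by apply/funext => k; rewrite /vscale mulr0.
move=> <-; rewrite -cardE -itintZ//.
- apply: eq_itint => x _; rewrite /G h1// h2// mulrA -expRD subrr expR0 mul1r.
  by rewrite 2!muleA Hhom// -muleA [in RHS]muleAC muleA.
- apply: (measurableT_comp mG); apply: measurable_vec => k.
  by apply: measurable_funM => //; exact: measurable_coord.
Qed.

End swap.

(** * The sphere functional *)

Section epow_theory.
Context (R : realType) (q : R).
Hypothesis q0 : (0 < q)%R.
Local Open Scope ereal_scope.

Lemma epow0 : epow 0 (- q) = +oo%E.
Proof. by rewrite /epow eqxx oppr_lt0 q0. Qed.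

Lemma epow_gt0E (t : R) : (0 < t)%R -> epow t (- q) = (t `^ (- q))%:E.
Proof. by move=> t0; rewrite /epow gt_eqF. Qed.

Lemma epow_gt0 (t : R) : (0 <= t)%R -> 0 < epow t (- q).
Proof.
rewrite le_eqVlt => /predU1P[<-|t0]; first by rewrite epow0 ltry.
by rewrite epow_gt0E// lte_fin powR_gt0.
Qed.

Lemma epow_ge0 (t : R) : 0 <= epow t (- q).
Proof. by rewrite /epow; case: ifP => _; rewrite ?le0y// lee_fin powR_ge0. Qed.

Lemma measurable_epow : measurable_fun setT (fun t : R => epow t (- q)).
Proof.
rewrite (_ : (fun t => _) = fun t : R => if t == 0%R then +oo else (t `^ (- q))%:E).
  apply: measurable_fun_ifT => //.
    exact: measurable_fun_eqr.
  by apply/measurable_EFinP; exact: measurable_powR.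
by apply/funext => t; rewrite /epow oppr_lt0 q0 andbT.
Qed.

Lemma epow_anti (s t : R) : (0 <= s)%R -> (s <= t)%R -> epow t (- q) <= epow s (- q).
Proof.
rewrite le_eqVlt => /predU1P[<- _|s0 st]; first by rewrite epow0 leey.
have t0 : (0 < t)%R by exact: lt_le_trans st.
rewrite !epow_gt0E// lee_fin !powRN lef_pV2 ?posrE ?powR_gt0//.
by apply: ge0_ler_powR => //; rewrite ?nnegrE; exact: ltW.
Qed.

Lemma epowZ (s t : R) : (0 < s)%R -> (0 <= t)%R ->
  epow (s * t) (- q) = (s `^ (- q))%:E * epow t (- q).
Proof.
move=> s0; rewrite le_eqVlt => /predU1P[<-|t0].
  by rewrite mulr0 epow0 gt0_muley// lte_fin powR_gt0.
by rewrite !epow_gt0E ?mulr_gt0// powRM ?ltW// EFinM.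
Qed.

(** The sequence increases to its supremum. The limit may be [+oo], at [t = 0], so the supremum is
    compared with each real [M] below it: a positive [M] is the value at some [r > t], and the
    perturbed argument is eventually at most [r]. *)
Lemma cvg_epow (t c : R) : (0 <= t)%R -> (0 <= c)%R ->
  epow (t + j.+1%:R^-1 * c)%R (- q) @[j --> \oo] --> epow t (- q).
Proof.
move=> t0 c0.
have nd : nondecreasing_seq (fun j : nat => epow (t + j.+1%:R^-1 * c)%R (- q)).
  move=> i j ij; apply: epow_anti; first by rewrite addr_ge0// mulr_ge0.
  by rewrite lerD2l ler_wpM2r// lef_pV2 ?posrE// ler_nat.
suff -> : epow t (- q) = ereal_sup (range (fun j : nat => epow (t + j.+1%:R^-1 * c)%R (- q))).
  exact: ereal_nondecreasing_cvgn.
apply/eqP; rewrite eq_le; apply/andP; split; last first.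
  apply: ge_ereal_sup => _ [j _ <-]; apply: epow_anti => //.
  by rewrite lerDl mulr_ge0.
have key (M : R) : M%:E < epow t (- q) ->
    M%:E <= ereal_sup (range (fun j : nat => epow (t + j.+1%:R^-1 * c)%R (- q))).
  move=> Mt; have [M0|M0] := leP M 0%R.
    apply: ereal_sup_ge; exists (epow (t + 1%:R^-1 * c)%R (- q)); first by exists 0%N.
    by apply: le_trans (epow_ge0 _); rewrite lee_fin.
  pose r := (M `^ (- q^-1))%R.
  have r0 : (0 < r)%R by exact: powR_gt0.
  have rM : (r `^ (- q))%R = M.
    by rewrite /r -powRrM mulrNN mulVf ?gt_eqF// powRr1// ltW.
  have tr : (t < r)%R.
    rewrite ltNge; apply/negP => rt; move: Mt; rewrite ltNge => /negP; apply.
    by rewrite -rM -epow_gt0E// epow_anti// ltW.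
  have [j jr] : exists j : nat, (c / (r - t) < j.+1%:R)%R.
    exists (Num.truncn (c / (r - t))).
    by rewrite truncnS_gt.
  apply: ereal_sup_ge; exists (epow (t + j.+1%:R^-1 * c)%R (- q)); first by exists j.
  rewrite -rM -epow_gt0E//; apply: epow_anti; first by rewrite addr_ge0// mulr_ge0.
  rewrite -lerBrDl mulrC ler_pdivrMr// mulrC -ler_pdivrMr ?subr_gt0//; exact: ltW.
case E : (epow t (- q)) => [M| |].
- apply/lee_subgt0Pr => e e0; rewrite -EFinB; apply: key.
  by rewrite E lte_fin ltrBlDr ltrDl.
- by rewrite leye_eq; apply/eqP/eqyP => M _; apply: key; rewrite E ltry.
- by have := epow_ge0 t; rewrite E.
Qed.

End epow_theory.

Section sphere_form.
Context (R : realType) (I D : finType) (i0 : D) (q : R).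
Hypothesis q0 : (0 < q)%R.
Local Open Scope ereal_scope.
Notation mu := (@lebesgue_measure R).
Notation VX := (vec R (I * D)%type).
Notation VW := (vec R D).
Implicit Types (L : seq (vec R I -> R)) (N : vec R I -> R) (eps : R) (X : VX)
  (w : VW) (p : VX * VW).

Definition pker eps L (p : VX * VW) : \bar R :=
  foldr (fun N g => epow (mnorm eps N p) (- q) * g) 1 L.

(** A function constant along rays, integrated over the punctured unit ball: [omega_n] times its
    mean over the sphere. *)
Definition sphV eps L (X : VX) : \bar R :=
  itint (enum D) (fun x => if (0 < vnorm x < 1)%R
    then pker eps L (X, vscale (vnorm x)^-1 x) else 0) (fun=> 0%R).

Lemma mnorm_nneg eps N (p : VX * VW) : (0 <= eps)%R -> seminorm N -> (0 <= mnorm eps N p)%R.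
Proof. by move=> e0 sN; rewrite addr_ge0 ?sn_ge0// mulr_ge0 ?vnorm_ge0. Qed.

Lemma mnormZ eps N X (s : R) w : (0 < s)%R -> seminorm N ->
  mnorm eps N (X, vscale s w) = (s * mnorm eps N (X, w))%R.
Proof.
move=> s0 sN; rewrite /mnorm /= (_ : dots X (vscale s w) = vscale s (dots X w)).
  by rewrite sn_homo// vnormZ gtr0_norm//; ring.
apply/funext => e; rewrite /dots /vscale /vdot mulr_sumr; apply: eq_bigr => k _.
by rewrite /vscale; ring.
Qed.

Lemma pker_ge0 eps L (p : VX * VW) : 0 <= pker eps L p.
Proof. by elim: L => //= N L IH; rewrite mule_ge0// epow_ge0. Qed.

Lemma measurable_pker eps L : List.Forall (@seminorm R I) L ->
  measurable_fun setT (pker eps L).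
Proof.
elim=> [|N L' sN _ IH] /=; first exact: measurable_cst.
apply: emeasurable_funM => //.
by apply: (measurableT_comp (measurable_epow q0)); exact: measurable_mnorm.
Qed.

Lemma pkerZ eps L X (s : R) w : (0 <= eps)%R -> (0 < s)%R -> List.Forall (@seminorm R I) L ->
  pker eps L (X, vscale s w) = (s `^ (- (q * (size L)%:R)))%:E * pker eps L (X, w).
Proof.
move=> e0 s0; elim=> [|N L' sN _ IH] /=; first by rewrite mulr0 oppr0 powRr0 mule1.
rewrite IH mnormZ// epowZ//; last exact: mnorm_nneg.
rewrite muleACA -EFinM -powRD; last by rewrite (gt_eqF s0) implybT.
by congr ((_ `^ _)%:E * _); rewrite -natr1; ring.
Qed.

Lemma pker_mono eps eps' L (p : VX * VW) : (0 <= eps)%R -> (eps <= eps')%R ->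
  List.Forall (@seminorm R I) L -> pker eps' L p <= pker eps L p.
Proof.
move=> e0 ee; elim=> [|N L' sN _ IH] //=.
apply: lee_pmul => //; rewrite ?epow_ge0 ?pker_ge0//.
apply: epow_anti => //; first exact: mnorm_nneg.
by rewrite lerD2l ler_wpM2r// vnorm_ge0.
Qed.

Lemma pker_gt0 eps L (p : VX * VW) : (0 <= eps)%R ->
  List.Forall (@seminorm R I) L -> 0 < pker eps L p.
Proof.
move=> e0; elim=> [|N L' sN _ IH] //=.
by rewrite mule_gt0//; apply: epow_gt0 => //; exact: mnorm_nneg.
Qed.

(** The limit may be taken factor by factor because no limit factor is 0, which excludes a product
    of 0 and [+oo]. *)
Lemma cvg_pker L (p : VX * VW) : List.Forall (@seminorm R I) L ->
  pker j.+1%:R^-1%R L p @[j --> \oo] --> pker 0 L p.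
Proof.
elim=> [|N L' sN sL IH] /=; first exact: cvg_cst.
apply: cvgeM => //.
- apply: neq0_mule_def; rewrite gt_eqF// mule_gt0//; last exact: pker_gt0.
  by apply: epow_gt0 => //; exact: mnorm_nneg.
- rewrite /mnorm mul0r addr0; apply: cvg_epow => //; first exact: sn_ge0.
  exact: vnorm_ge0.
Qed.

Lemma measurable_sphV_fun eps L : List.Forall (@seminorm R I) L ->
  measurable_fun setT (fun p : VX * VW => if (0 < vnorm p.2 < 1)%R
    then pker eps L (p.1, vscale (vnorm p.2)^-1 p.2) else 0).
Proof.
move=> sL; have mn : measurable_fun setT (fun p : VX * VW => vnorm p.2).
  by apply: measurable_vnorm; exact: measurable_snd.
apply: measurable_fun_ifT => //.
  by apply: measurable_and; apply: measurable_fun_ltr.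
apply: (measurableT_comp (measurable_pker eps sL)).
apply: measurable_fun_pair; first exact: measurable_fst.
apply: measurable_vec => k; apply: measurable_funM.
  rewrite (_ : (fun p : VX * VW => _) = (fun p : VX * VW => (vnorm p.2) `^ (-1))%R).
    exact: (measurableT_comp (measurable_powR (-1)) mn).
  by apply/funext => p; rewrite powR_inv1// vnorm_ge0.
exact: (measurableT_comp (measurable_coord k)).
Qed.

Lemma sphV_fun_ge0 eps L (p : VX * VW) : 0 <= (if (0 < vnorm p.2 < 1)%R
    then pker eps L (p.1, vscale (vnorm p.2)^-1 p.2) else 0).
Proof. by case: ifP => // _; exact: pker_ge0. Qed.

Lemma sphV_ge0 eps L X : 0 <= sphV eps L X.
Proof. by apply: itint_ge0 => x; exact: (sphV_fun_ge0 eps L (X, x)). Qed.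

Lemma measurable_sphV eps L : List.Forall (@seminorm R I) L ->
  measurable_fun setT (sphV eps L).
Proof.
move=> sL; apply: (measurable_itint (enum D) (measurable_sphV_fun eps sL)) => //.
exact: sphV_fun_ge0.
Qed.

Lemma measurable_sphV_fun1 eps L X : List.Forall (@seminorm R I) L ->
  measurable_fun setT (fun x : VW => if (0 < vnorm x < 1)%R
    then pker eps L (X, vscale (vnorm x)^-1 x) else 0).
Proof.
move=> sL; apply: (measurableT_comp (measurable_sphV_fun eps sL)
  (g := fun x : VW => (X, x))); exact: measurable_fun_pair.
Qed.

Lemma cvg_sphV L X : List.Forall (@seminorm R I) L ->
  sphV j.+1%:R^-1%R L X @[j --> \oo] --> sphV 0 L X.
Proof.
move=> sL; apply: cvg_itint.
- by move=> j; exact: measurable_sphV_fun1.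
- by move=> j x; exact: (sphV_fun_ge0 _ L (X, x)).
- move=> x i j ij; case: ifP => // _; apply: pker_mono => //.
  by rewrite lef_pV2 ?posrE// ler_nat.
- by move=> x; case: ifP => _; [exact: cvg_pker|exact: cvg_cst].
Qed.

Lemma sphV_mono eps eps' L X : (0 <= eps)%R -> (eps <= eps')%R ->
  List.Forall (@seminorm R I) L -> sphV eps' L X <= sphV eps L X.
Proof.
move=> e0 ee sL; apply: le_itint.
- exact: measurable_sphV_fun1.
- exact: measurable_sphV_fun1.
- by move=> x; exact: (sphV_fun_ge0 _ L (X, x)).
- by move=> x _; case: ifP => // _; exact: pker_mono.
- by move=> x; exact: (sphV_fun_ge0 _ L (X, x)).
Qed.

Lemma dots_hhX u (X : VX) (w : VW) : dots (hhX u X) w = dots X (hh u w).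
Proof. by apply/funext => e; rewrite /dots -vdot_hh_sym. Qed.

Lemma vscale_hh u (a : R) (w : VW) : hh u (vscale a w) = vscale a (hh u w).
Proof.
apply/funext => k; rewrite /hh /vscale.
have -> : vdot (fun j => a * w j)%R u = (a * vdot w u)%R.
  by rewrite /vdot mulr_sumr; apply: eq_bigr => j _; rewrite mulrA.
ring.
Qed.

(** Reflecting all rows of [X] amounts to reflecting [u], which preserves the norm and the integral
    over [u]. *)
Lemma sphV_hhX eps L u X : List.Forall (@seminorm R I) L ->
  sphV eps L (hhX u X) = sphV eps L X.
Proof.
move=> sL; rewrite /sphV -[RHS](itint_hh u); last first.
- by move=> x; exact: (sphV_fun_ge0 _ L (X, x)).
- exact: measurable_sphV_fun1.
have E w : pker eps L (hhX u X, w) = pker eps L (X, hh u w).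
  elim: L {sL} => [|N L IH]; first by [].
  by rewrite /= IH; congr (epow _ _ * _); rewrite /mnorm /= dots_hhX vnorm_hh.
apply: eq_itint => x _; rewrite /comp vnorm_hh; case: ifP => _; last by [].
by rewrite E vscale_hh.
Qed.

(** On the unit sphere the term [eps |w|] alone keeps every factor's argument at least [eps]. *)
Lemma pker_le (eps : R) L X (w : VW) : (0 < eps)%R -> vnorm w = 1%R ->
  List.Forall (@seminorm R I) L ->
  pker eps L (X, w) <= ((eps `^ (- q)) ^+ size L)%:E.
Proof.
move=> e0 w1; elim=> [|N L' sN _ IH] //=; rewrite exprS EFinM.
apply: lee_pmul => //; rewrite ?epow_ge0 ?pker_ge0// -epow_gt0E//.
apply: epow_anti => //; first exact: ltW.
by rewrite /mnorm /= w1 mulr1 lerDr sn_ge0.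
Qed.

Lemma vnorm_unit (x : VW) : (0 < vnorm x)%R -> vnorm (vscale (vnorm x)^-1 x) = 1%R.
Proof. by move=> x0; rewrite vnormZ gtr0_norm ?invr_gt0// mulVf// gt_eqF. Qed.

Lemma sphV_le eps L : (0 < eps)%R -> List.Forall (@seminorm R I) L ->
  exists C : R, forall X, sphV eps L X <= C%:E.
Proof.
move=> e0 sL; pose c := (((eps `^ (- q)) ^+ size L)%R).
have c0 : (0 <= c)%R by rewrite exprn_ge0// powR_ge0.
exists (c * omegav R D)%R => X; rewrite EFinM -(omegavE R i0).
rewrite /vol -itintZ//; [|exact: measurable_indicE (measurable_ballv _)].
apply: le_itint.
- exact: measurable_sphV_fun1.
- apply: emeasurable_funM => //; exact: measurable_indicE (measurable_ballv _).
- by move=> x; exact: (sphV_fun_ge0 _ L (X, x)).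
- move=> x _; case: ifPn => [/andP[x0 x1]|_]; last by rewrite mule_ge0// ?lee_fin// indicE_ge0.
  rewrite indicE mem_set// mule1; apply: pker_le => //; exact: vnorm_unit.
- by move=> x; rewrite mule_ge0// ?lee_fin// indicE_ge0.
Qed.

Lemma gker_pker eps K L (p : VX * VW) :
  gker K [seq (fun t => epow t (- q)) \o mnorm eps N | N <- L] p =
  pker eps L p * (\1_K p)%:E.
Proof. by elim: L => [|N L /= ->]; rewrite ?mul1e// muleA. Qed.

Lemma steiner_mnorms eps L : (0 < eps)%R -> List.Forall (@seminorm R I) L ->
  List.Forall (@steiner_qconcave R I D i0)
    [seq (fun t => epow t (- q)) \o mnorm eps N | N <- L].
Proof.
move=> e0; elim=> [|N L' sN _ IH] /=; first exact: List.Forall_nil.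
apply: List.Forall_cons => //; apply: steiner_qconcave_mnorm => //.
- exact: measurable_epow.
- by move=> t; exact: epow_ge0.
- by move=> s t; exact: epow_anti.
Qed.

(* The integrand is homogeneous of degree -n, so the ball cut-off may be traded for a
   cut-off in one of the norms, which is jointly convex along i0. *)
Lemma sphV_sform eps N L : (0 < eps)%R -> List.Forall (@seminorm R I) (N :: L) ->
  #|D|%:R = (q * (size (N :: L))%:R)%R -> forall X,
  sphV eps (N :: L) X = (q / #|D|%:R)%:E * itint (enum D) (fun w =>
    gker [set p | (mnorm eps N p < 1)%R]
      [seq (fun t => epow t (- q)) \o mnorm eps N | N <- L] (X, w)) (fun=> 0%R).
Proof.
move=> e0 sNL nq X.
have sN : seminorm N by case/List.Forall_cons_iff : sNL.
have sL : List.Forall (@seminorm R I) L by case/List.Forall_cons_iff : sNL.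
have n0 : (0 < #|D|%:R :> R)%R by rewrite ltr0n; apply/card_gt0P; exists i0.
pose H (x : VW) := pker eps (N :: L) (X, x).
have mX : measurable_fun setT (fun x : VW => (X, x)) by exact: measurable_fun_pair.
have mH : measurable_fun setT H.
  exact: (measurableT_comp (measurable_pker eps sNL) mX).
have H0 x : 0 <= H x by exact: pker_ge0.
have Hhom s x : (0 < s)%R -> (s ^+ #|D|)%:E * H (vscale s x) = H x.
  move=> s0; rewrite /H pkerZ ?(ltW e0)// -nq muleA -EFinM.
  rewrite -powR_mulrn ?ltW// -powRD; last by rewrite (gt_eqF s0) implybT.
  by rewrite subrr powRr0 mul1e.
have pos x : (0 < vnorm x <-> 0 < mnorm eps N (X, x))%R.
  split=> [x0|]; first by rewrite ltr_wpDl ?sn_ge0// mulr_gt0.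
  move=> m0; rewrite lt_neqAle eq_sym vnorm_ge0 andbT; apply/eqP => x0.
  move: m0; rewrite /mnorm /= x0 (vnorm_eq0 x0) mulr0 addr0.
  rewrite (_ : dots X _ = vscale 0 (dots X x)); last first.
    by apply/funext => e; rewrite /vscale mul0r /dots /vdot big1// => k _; rewrite mulr0.
  by rewrite sn_homo// normr0 mul0r ltxx.
have mm : measurable_fun setT (fun x => mnorm eps N (X, x)).
  exact: (measurableT_comp (measurable_mnorm eps sN) mX).
have mv : measurable_fun setT (@vnorm R D) by exact: measurable_vnorm.
(* The weight [|x|^n] makes the kernel constant along rays and yields the sphere integral; the
   weight [M_1^q] cancels the factor of [N] and leaves the indicator of [M_1 < 1]. The constants
   [1 / q] and [1 / n] combine to [q / n]. *)
have := itint_swap_cutoff mH H0 Hhom n0 q0 mv mm pos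
  (fun s x s0 => etrans (vnormZ s x) (congr1 (fun a => a * vnorm x)%R (gtr0_norm s0)))
  (fun s x s0 => mnormZ eps X x s0 sN).
have -> : itint (enum D) (fun x => H x * (cutpow #|D|%:R (vnorm x))%:E) (fun=> 0%R) =
    sphV eps (N :: L) X.
  apply: eq_itint => x _; rewrite /cutpow; case: ifPn => [/andP[x0 x1]|]; last by rewrite mule0.
  rewrite pkerZ ?invr_gt0// ?(ltW e0)// -nq muleC; congr (_ * _); congr EFin.
  by rewrite -powR_inv1 ?vnorm_ge0// -powRrM mulN1r opprK.
move=> E.
have -> : sphV eps (N :: L) X = q%:E * (q^-1%:E * sphV eps (N :: L) X).
  by rewrite muleA -EFinM divff ?gt_eqF// mul1e.
rewrite E muleA -EFinM; congr (_ * _).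
have sG : List.Forall (@steiner_qconcave R I D i0)
    [seq (fun t => epow t (- q)) \o mnorm eps N | N <- L].
  exact: steiner_mnorms.
(* The integrands can differ only at the origin, which lies in the null set where coordinate [i0]
   vanishes. *)
apply: (eq_itint_neq0 (i0 := i0)) => [x|x|x x0].
- by rewrite mule_ge0// lee_fin cutpow_ge0.
- exact: (gker_ge0 _ sG).
have {}x0 : (0 < vnorm x)%R.
  by apply: lt_le_trans (le_coord_vnorm x i0); rewrite normr_gt0.
have m0 : (0 < mnorm eps N (X, x))%R by apply/pos.
rewrite gker_pker /H /= (muleC (epow _ _)) -muleA; congr (_ * _).
rewrite epow_gt0E// -EFinM /cutpow m0 /= indicE /=.
case: ifPn => m1.
  by rewrite mem_set// -powRD ?addNr ?powRr0// (gt_eqF m0) implybT.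
by rewrite mulr0 memNset//; exact/negP.
Qed.

Lemma sphV_star_eps eps L (A : I -> set VW) rho : (0 < eps)%R ->
  List.Forall (@seminorm R I) L -> #|D|%:R = (q * (size L)%:R)%R ->
  (forall e, measurable (A e)) -> (forall e, A e `<=` ballv rho) ->
  setform A (sphV eps L) <= setform (fun e => star (A e)) (sphV eps L).
Proof.
move=> e0 sL nq mA Ar.
have [C HC] := sphV_le e0 sL.
apply: (setform_star (i0 := i0) (measurable_sphV eps sL) (sphV_ge0 eps L) HC
  (fun u X => sphV_hhX eps u X sL) _ mA Ar) => B mB [r Br].
(* An empty list would force [#|D| = 0]. *)
case: L sL nq {HC} => [|N L] sL nq.
  have n0 : (0 < #|D|%:R :> R)%R by rewrite ltr0n; apply/card_gt0P; exists i0.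
  by move: n0; rewrite nq mulr0 ltxx.
have sN : seminorm N by case/List.Forall_cons_iff : sL.
have sL' : List.Forall (@seminorm R I) L by case/List.Forall_cons_iff : sL.
have sG := steiner_mnorms e0 sL'.
have c0 : 0 <= (q / #|D|%:R)%:E by rewrite lee_fin divr_ge0// ltW.
have mK := stc_meas (steiner_convex_mnorm i0 e0 sN).
have mG := measurable_gker mK sG.
have gE (B' : I -> set VW) : (forall e, measurable (B' e)) ->
   setform B' (sphV eps (N :: L)) = (q / #|D|%:R)%:E * sform B'
  (gker [set p | (mnorm eps N p < 1)%R] [seq (fun t => epow t (- q)) \o mnorm eps N | N <- L]).
  move=> mB'; rewrite /sform /setform -itintZ//.
  - by apply: eq_itint => X _; rewrite (sphV_sform e0 sL nq) muleCA.
  - apply: emeasurable_funM.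
      by apply/measurable_EFinP; exact: measurable_prod_indic.
    apply: (measurable_itint (enum D) mG) => //; exact: gker_ge0 sG.
  - move=> X; rewrite mule_ge0 ?prod_indic_ge0//; apply: itint_ge0 => w.
    exact: gker_ge0 sG _.
rewrite !gE//; last by move=> e; exact: measurable_steiner.
apply: lee_wpmul2l => //; apply: le_sform_steiner => //.
  exact: steiner_convex_mnorm.
by move=> e x; exact: fiber_lty (Br e).
Qed.

End sphere_form.

Section star_measurable.
Context (R : realType) (D : finType).
Local Open Scope ereal_scope.
Notation VW := (vec R D).

Lemma measurable_star_gen d (T : measurableType d) (c : T -> \bar R) (x : T -> VW) :
  measurable_fun setT c -> measurable_fun setT x ->
  measurable [set t | (omegav R D * vnorm (x t) ^+ #|D|)%:E < c t].
Proof.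
move=> mc mx; apply: measurable_ltE => //; apply: measurable_funM => //.
by apply: measurable_funX; exact: measurable_vnorm.
Qed.

Lemma measurable_star (A : set VW) : measurable (star A).
Proof. exact: measurable_star_gen. Qed.

Definition layer (f : VW -> R) (r : R) : set VW := subgraph (fun x => (f x)%:E) r.

Variable f : VW -> R.
Hypothesis mf : measurable_fun setT f.

Let mfE : measurable_fun setT (fun x => (f x)%:E : \bar R).
Proof. by apply/measurable_EFinP. Qed.

Lemma measurable_layer1 r : measurable (layer f r).
Proof. exact: measurable_subgraph. Qed.

Lemma measurable_layer2 : measurable [set p : R * VW | layer f p.1 p.2].
Proof. exact: measurable_subgraph2. Qed.

Lemma measurable_star_layer : measurable [set p : R * VW | star (layer f p.1) p.2].
Proof.
apply: (measurable_star_gen (c := fun p : R * VW => vol (layer f p.1)) (x := snd)); last first.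
  exact: measurable_snd.
have mv : measurable_fun setT (fun r => vol (layer f r)).
  apply: (@measurable_itint _ _ _ R (enum D) (fun p : R * VW => (\1_(layer f p.1) p.2)%:E)
    (fun=> (fun=> 0%R))) => //.
  rewrite (_ : (fun p => _) = (fun p : R * VW => (\1_[set p : R * VW | layer f p.1 p.2] p)%:E)).
    exact: measurable_indicE measurable_layer2.
  by apply/funext => p; congr EFin; exact: eq_indic.
exact: (measurableT_comp mv measurable_fst).
Qed.

Lemma measurable_rearr (g : VW -> R) :
  (forall x, (g x)%:E = \int[lebesgue_measure]_r (\1_(star (layer f r)) x)%:E) ->
  measurable_fun setT g.
Proof.
move=> gE; apply/measurable_EFinP.
rewrite (_ : EFin \o g = fun x => \int[lebesgue_measure]_r (\1_(star (layer f r)) x)%:E).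
  apply: (measurable_fun_fubini_tonelli_F (m2 := lebesgue_measure) (fun p : VW * R =>
    (\1_(star (layer f p.2)) p.1)%:E)); last by move=> p; exact: indicE_ge0.
  rewrite (_ : (fun p => _) = (fun p : VW * R =>
     (\1_[set p : R * VW | star (layer f p.1) p.2] (p.2, p.1))%:E)).
    apply: (measurable_indic_comp measurable_star_layer); apply: measurable_fun_pair;
      [exact: measurable_snd|exact: measurable_fst].
  by apply/funext => p; congr EFin; exact: eq_indic.
by apply/funext => x; rewrite /= gE.
Qed.

End star_measurable.

(** * Limits in the kernel and in the sets *)

Section setform_limits.
Context (R : realType) (I D : finType) (i0 : D) (q : R).
Hypothesis q0 : (0 < q)%R.
Local Open Scope ereal_scope.
Notation VX := (vec R (I * D)%type).
Notation VW := (vec R D).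
Implicit Types (A B : I -> set VW) (V W : VX -> \bar R).

Lemma le_setform A B V W : (forall e, measurable (A e)) -> (forall e, measurable (B e)) ->
  measurable_fun setT V -> measurable_fun setT W ->
  (forall X, 0 <= V X) -> (forall X, V X <= W X) -> (forall e, A e `<=` B e) ->
  setform A V <= setform B W.
Proof.
move=> mA mB mV mW V0 VW AB.
have W0 X : 0 <= W X by exact: le_trans (VW X).
apply: le_itint.
- exact: measurable_setform.
- exact: measurable_setform.
- by move=> X; rewrite mule_ge0// prod_indic_ge0.
- move=> X _; apply: lee_pmul => //; first exact: prod_indic_ge0.
  rewrite lee_fin; apply: ler_prod => e _; rewrite !indicE ler0n /= ler_nat.
  by case: (boolP (_ \in A e)) => // /set_mem/AB/mem_set ->.
- by move=> X; rewrite mule_ge0// prod_indic_ge0.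
Qed.

Lemma setform_le_cvg A V (Vj : nat -> VX -> \bar R) c : (forall e, measurable (A e)) ->
  (forall j, measurable_fun setT (Vj j)) -> (forall j X, 0 <= Vj j X) ->
  (forall X, nondecreasing_seq (Vj ^~ X)) -> (forall X, Vj j X @[j --> \oo] --> V X) ->
  (forall j, setform A (Vj j) <= c) -> setform A V <= c.
Proof.
move=> mA mV V0 ndV cV Hc.
suff : setform A (Vj j) @[j --> \oo] --> setform A V.
  by move/cvge_to_le; apply; exact: nearW.
apply: cvg_itint.
- by move=> j; exact: measurable_setform.
- by move=> j X; rewrite mule_ge0// prod_indic_ge0.
- by move=> X i j ij; apply: lee_wpmul2l; [exact: prod_indic_ge0|exact: ndV].
- by move=> X; apply: cvgeZl => //.
Qed.

Lemma setform_le_ball A V c : (forall e, measurable (A e)) ->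
  measurable_fun setT V -> (forall X, 0 <= V X) ->
  (forall j : nat, setform (fun e => A e `&` ballv j%:R) V <= c) -> setform A V <= c.
Proof.
move=> mA mV V0 Hc.
have mAj j e : measurable (A e `&` ballv j%:R).
  by apply: measurableI => //; exact: measurable_ballv.
suff : setform (fun e => A e `&` ballv j%:R) V @[j --> \oo] --> setform A V.
  by move/cvge_to_le; apply; exact: nearW.
apply: cvg_itint.
- by move=> j; exact: measurable_setform.
- by move=> j X; rewrite mule_ge0// prod_indic_ge0.
- move=> X i j ij; apply: lee_wpmul2r => //; rewrite lee_fin; apply: ler_prod => e _.
  rewrite !indicE ler0n ler_nat /=; case: (boolP (_ \in A e `&` ballv i%:R)) => //.
  move=> /set_mem[Ae bi]; rewrite mem_set//; split => //.
  by apply: (lt_le_trans bi); rewrite ler_nat.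
- move=> X; apply: cvg_near_cst; near=> j; congr (_%:E * _).
  apply: eq_bigr => e _; apply: eq_indic; split=> [[]//|Ae]; split => //.
  apply: (@le_lt_trans _ _ (\sum_e vnorm (vrow X e))%R).
    by rewrite (bigD1 e)//= lerDl sumr_ge0// => e' _; exact: vnorm_ge0.
  apply: (@lt_le_trans _ _ (Num.truncn (\sum_e vnorm (vrow X e))).+1%:R).
    by rewrite truncnS_gt.
  rewrite ler_nat; near: j; exact: nbhs_infty_ge.
Unshelve. all: by end_near. Qed.

(** The sets are cut to balls of radius [j] and the kernel is perturbed by [eps = 1 / (i + 1)]. Only
    the left side needs a limit: on the right, the perturbed kernel and the symmetrized truncations
    already lie below their final counterparts. *)
Lemma sphV_star L A : List.Forall (@seminorm R I) L -> #|D|%:R = (q * (size L)%:R)%R ->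
  (forall e, measurable (A e)) ->
  setform A (sphV q 0 L) <= setform (fun e => star (A e)) (sphV q 0 L).
Proof.
move=> sL nq mA.
have mV eps : measurable_fun setT (sphV (D := D) q eps L) by exact: measurable_sphV.
have V0 eps X : 0 <= sphV (D := D) q eps L X by exact: sphV_ge0.
apply: setform_le_ball => // j.
have mAj e : measurable (A e `&` ballv j%:R).
  by apply: measurableI => //; exact: measurable_ballv.
apply: (setform_le_cvg (Vj := fun i => sphV q i.+1%:R^-1%R L)) => // [X i k ik|X|i].
- by apply: sphV_mono => //; rewrite lef_pV2 ?posrE// ler_nat.
- exact: cvg_sphV.
have e0 : (0 < i.+1%:R^-1 :> R)%R by rewrite invr_gt0.
apply: (le_trans (sphV_star_eps i0 q0 e0 sL nq mAj (rho := j%:R) (fun e => @subIsetr _ _ _))).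
apply: le_setform => //.
- by move=> e; exact: measurable_star.
- by move=> e; exact: measurable_star.
- by move=> X; apply: sphV_mono => //; exact: ltW.
- by move=> e; apply: star_mono; apply: le_vol => //; exact: subIsetl.
Qed.

End setform_limits.

(** * From sets to densities *)

Section layers.
Context (R : realType) (I D : finType).
Local Open Scope ereal_scope.
Notation mu := (@lebesgue_measure R).
Notation VX := (vec R (I * D)%type).
Notation VW := (vec R D).
Variable V : VX -> \bar R.
Hypothesis mV : measurable_fun setT V.
Hypothesis V0 : forall X, 0 <= V X.

Definition fform (f : I -> VW -> R) : \bar R :=
  itint (enum {: I * D}) (fun X => (\prod_e f e (vrow X e))%:E * V X) (fun=> 0%R).

(** Indices in [s] carry functions, the others sets, and one index is converted at a time. The
    layers [S] are left abstract because the same formula serves for a density and for its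
    rearrangement. *)
Let mix (s : seq I) (f : I -> VW -> R) (A : I -> set VW) : I -> VW -> R :=
  fun e => if e \in s then f e else \1_(A e).

Variables (S : I -> R -> set VW) (f : I -> VW -> R).
Hypothesis mS : forall e, measurable [set p : R * VW | S e p.1 p.2].
Hypothesis mf : forall e, measurable_fun setT (f e).
Hypothesis f0 : forall e x, (0 <= f e x)%R.
Hypothesis fS : forall e x, (f e x)%:E = \int[mu]_r (\1_(S e r) x)%:E.

Let mSx e x : measurable_fun setT (fun r => (\1_(S e r) x)%:E : \bar R).
Proof.
have mp : measurable_fun setT (fun r : R => (r, x)) by exact: measurable_fun_pair.
rewrite (_ : (fun r => _) = (fun r : R => (\1_[set p : R * VW | S e p.1 p.2] (r, x))%:E)).
  exact: measurable_indic_comp (mS e) mp.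
by apply/funext => r; congr EFin; exact: eq_indic.
Qed.

Let P s (A : I -> set VW) e X : R := (\prod_(e' | e' != e) mix s f A e' (vrow X e'))%R.

Let gl s A e (p : R * VX) := (\1_(S e p.1) (vrow p.2 e))%:E * ((P s A e p.2)%:E * V p.2).

Let P_ge0 s A e X : (0 <= P s A e X)%R.
Proof. by apply: prodr_ge0 => e' _; rewrite /mix; case: ifP. Qed.

Let gl_ge0 s A e p : 0 <= gl s A e p.
Proof. by rewrite mule_ge0 ?indicE_ge0// mule_ge0// lee_fin P_ge0. Qed.

Let measurable_gl s A e : (forall e, measurable (A e)) -> measurable_fun setT (gl s A e).
Proof.
move=> mA.
have mmix e' : measurable_fun setT (mix s f A e').
  by rewrite /mix; case: ifP => // _; exact: measurable_indic.
have mP : measurable_fun setT (P s A e).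
  rewrite /P; under eq_fun do rewrite big_mkcond; apply: measurable_prod => e' _.
  case: (e' != e) => //.
  exact: (measurableT_comp (mmix e') (measurable_vrow e')).
apply: emeasurable_funM.
  have mp : measurable_fun setT (fun p : R * VX => (p.1, vrow p.2 e)).
    apply: measurable_fun_pair; first exact: measurable_fst.
    by apply: (measurableT_comp (measurable_vrow e)); exact: measurable_snd.
  rewrite (_ : (fun p => _) =
    (fun p : R * VX => (\1_[set p : R * VW | S e p.1 p.2] (p.1, vrow p.2 e))%:E)).
    exact: measurable_indic_comp (mS e) mp.
  by apply/funext => p; congr EFin; exact: eq_indic.
apply: emeasurable_funM.
  by apply/measurable_EFinP; apply: (measurableT_comp mP); exact: measurable_snd.
by apply: (measurableT_comp mV); exact: measurable_snd.
Qed.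

Let fform_gl s A e r : e \notin s ->
  fform (mix s f (fun e' => if e' == e then S e r else A e')) =
  itint (enum {: I * D}) (fun X => gl s A e (r, X)) (fun=> 0%R).
Proof.
move=> es; apply: eq_itint => X _; rewrite /gl muleA -EFinM; congr (_%:E * _).
rewrite (bigD1 e)//= {1}/mix (negbTE es) eqxx; congr (_ * _)%R.
by apply: eq_bigr => e' ee; rewrite /mix (negbTE ee).
Qed.

Lemma measurable_fform_layer s A e : (forall e, measurable (A e)) -> e \notin s ->
  measurable_fun setT (fun r => fform (mix s f (fun e' => if e' == e then S e r else A e'))).
Proof.
move=> mA es; under eq_fun do rewrite (fform_gl _ _ es).
apply: (@measurable_itint _ _ _ R (enum {: I * D}) (gl s A e) (fun=> (fun=> 0%R))) => //.
exact: measurable_gl.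
Qed.

Lemma fform_layer s A e : (forall e, measurable (A e)) -> e \notin s ->
  fform (mix (e :: s) f A) =
  \int[mu]_r fform (mix s f (fun e' => if e' == e then S e r else A e')).
Proof.
move=> mA es.
under [RHS]eq_integral do rewrite (fform_gl _ _ es).
rewrite (itint_integral lebesgue_measure _ (g := gl s A e)); [|exact: measurable_gl|exact: gl_ge0].
apply: eq_itint => X _.
transitivity ((\int[mu]_r (\1_(S e r) (vrow X e))%:E) * ((P s A e X)%:E * V X)).
  rewrite -fS muleA -EFinM; congr (_%:E * _).
  rewrite (bigD1 e)//= {1}/mix mem_head; congr (_ * _)%R.
  by apply: eq_bigr => e' ee; rewrite /mix inE (negbTE ee).
have h1 : 0 <= (P s A e X)%:E * V X by rewrite mule_ge0// lee_fin.
by rewrite -(ge0_integralZr lebesgue_measure measurableT (mSx e (vrow X e))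
  (fun r _ => indicE_ge0 _ _ _) h1).
Qed.

End layers.

Section rearrangement.
Context (R : realType) (I D : finType).
Local Open Scope ereal_scope.
Notation mu := (@lebesgue_measure R).
Notation VX := (vec R (I * D)%type).
Notation VW := (vec R D).
Variable V : VX -> \bar R.
Hypothesis mV : measurable_fun setT V.
Hypothesis V0 : forall X, 0 <= V X.
Hypothesis HV : forall A : I -> set VW, (forall e, measurable (A e)) ->
  setform A V <= setform (fun e => star (A e)) V.

Variables (f g : I -> VW -> R).
Hypothesis mf : forall e, measurable_fun setT (f e).
Hypothesis f0 : forall e x, (0 <= f e x)%R.
Hypothesis g0 : forall e x, (0 <= g e x)%R.
Hypothesis gE : forall e x, (g e x)%:E = \int[mu]_r (\1_(star (layer (f e) r)) x)%:E.

Let mlayer2 e := measurable_layer2 (mf e).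

Let mstar2 e := measurable_star_layer (mf e).

Let mg e : measurable_fun setT (g e) := measurable_rearr (mf e) (@gE e).

Let fE e x : (f e x)%:E = \int[mu]_r (\1_(layer (f e) r) x)%:E.
Proof. by rewrite (layer_cake (f := fun x => (f e x)%:E))// lee_fin. Qed.

(** Both sides are mixtures over the same height [r], so the inequality for sets passes to one
    density after another. *)
Lemma fform_star : fform V f <= fform V g.
Proof.
have mix_ge0 (h : I -> VW -> R) : (forall e x, (0 <= h e x)%R) -> 0 <= fform V h.
  move=> h0; apply: itint_ge0 => X; rewrite mule_ge0// lee_fin prodr_ge0//.
have key s : uniq s -> forall A, (forall e, measurable (A e)) ->
   fform V (fun e => if e \in s then f e else \1_(A e)) <=
   fform V (fun e => if e \in s then g e else \1_(star (A e))).
  elim: s => [|e s IH] /= us A mA; first exact: HV.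
  case/andP: us => es us.
  rewrite (fform_layer mV V0 mlayer2 mf f0 fE mA es).
  rewrite (fform_layer mV V0 mstar2 mg g0 gE (A := fun e => star (A e)) _ es); last first.
    by move=> e'; exact: measurable_star.
  have mAr r e' : measurable (if e' == e then layer (f e) r else A e').
    by case: ifP => _ //; exact: measurable_layer1.
  apply: ge0_le_integral => //.
  - by move=> r _; apply: mix_ge0 => e' x; case: ifP.
  - exact: (measurable_fform_layer (S := fun e => layer (f e)) mV V0 mlayer2 mf f0 mA es).
  - have mstarA e' : measurable (star (A e')) by exact: measurable_star.
    exact: (measurable_fform_layer (S := fun e r => star (layer (f e) r))
      mV V0 mstar2 mg g0 (A := fun e => star (A e)) mstarA es).
  - move=> r _; apply: (le_trans (IH us _ (mAr r))).
    rewrite le_eqVlt; apply/orP; left; apply/eqP; congr fform; apply/funext => e'.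
    by case: ifP => // _; case: ifP.
(* Once [s] lists every index no set is left, and [setT] is a placeholder. *)
have := key (enum I) (enum_uniq I) (fun=> setT) (fun=> measurableT).
by rewrite (_ : (fun e => _) = f) ?[X in _ <= fform V X](_ : _ = g)//;
  apply/funext => e; rewrite mem_enum.
Qed.

End rearrangement.

(** * Transfer to row vectors *)

Section rows.
Context (R : realType) (n : nat).
Local Open Scope ereal_scope.
Notation VW := (vec R 'I_n).

Definition rv (y : VW) : 'rV[R]_n := (\row_k y k)%R.
Definition vr (x : 'rV[R]_n) : VW := fun k => x ord0 k.

Lemma vrK x : rv (vr x) = x.
Proof. by apply/rowP => k; rewrite mxE. Qed.

Lemma dotv_rv x y : dotv (rv x) (rv y) = vdot x y.
Proof. by apply: eq_bigr => k _; rewrite !mxE. Qed.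

Lemma normE_rv y : normE (rv y) = vnorm y.
Proof. by rewrite /normE dotv_rv. Qed.

Lemma rvZ (a : R) y : (a *: rv y)%R = rv (vscale a y).
Proof. by apply/rowP => k; rewrite !mxE. Qed.

Lemma rv_neq0 y : (rv y != 0)%R = (0 < vnorm y)%R.
Proof.
rewrite lt_neqAle vnorm_ge0 andbT [in RHS]eq_sym; congr negb; apply/eqP/eqP => [y0|y0].
  rewrite -normE_rv y0 /normE /dotv big1 ?sqrtr0// => k _.
  by rewrite mxE mul0r.
by apply/rowP => k; rewrite !mxE (vnorm_eq0 y0).
Qed.

Lemma int_coordsE s (g : 'rV[R]_n -> \bar R) y : int_coords s g (rv y) = itint s (g \o rv) y.
Proof.
elim: s y => [//|i s IH] y /=; apply: eq_integral => t _.
rewrite -IH; congr int_coords; apply/rowP => k; rewrite !mxE /upd.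
by case: eqP.
Qed.

Lemma rv0 : rv (fun=> 0%R) = 0%R.
Proof. by apply/rowP => k; rewrite !mxE. Qed.

Lemma intRnE (g : 'rV[R]_n -> \bar R) : intRn g = itint (enum 'I_n) (g \o rv) (fun=> 0%R).
Proof. by rewrite /intRn -rv0 int_coordsE. Qed.

Lemma volRnE (A : set 'rV[R]_n) : volRn A = vol (rv @^-1` A).
Proof. by rewrite /volRn intRnE; apply: eq_itint => y _ /=; congr EFin; exact: eq_indic. Qed.

Lemma int_famE (I : finType) (s : seq I) (G : (I -> 'rV[R]_n) -> \bar R) (X : vec R (I * 'I_n)%type) :
  int_fam s G (fun e => rv (vrow X e)) = itint (blk 'I_n s) (fun X => G (fun e => rv (vrow X e))) X.
Proof.
elim: s X => [//|e s IH] X; rewrite itint_blk_cons /= intRnE.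
apply: eq_itint => x _; rewrite -IH /=; congr int_fam; apply/funext => e'.
by case: eqVneq => [->|ee]; rewrite ?vrow_bins ?vrow_binsN.
Qed.

Lemma intRnIE (I : finType) (G : (I -> 'rV[R]_n) -> \bar R) :
  intRnI G = itint (blk 'I_n (enum I)) (fun X => G (fun e => rv (vrow X e))) (fun=> 0%R).
Proof.
rewrite /intRnI -int_famE; congr int_fam; apply/funext => e.
by apply/rowP => k; rewrite !mxE.
Qed.

Let box (c : {ffun 'I_n -> rat} * rat) : set VW :=
  [set y | forall k, (`|y k - ratr (c.1 k)| < ratr c.2)%R].

Let measurable_box c : measurable (box c).
Proof.
rewrite (_ : box c = \bigcap_k [set y | (`|y k - ratr (c.1 k)| < ratr c.2)%R]).
  apply: fin_bigcap_measurable => [|k _]; first exact: finite_finset.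
  rewrite (_ : [set y | _] = [set y : VW | (`|y k - ratr (c.1 k)|%R)%:E < (ratr c.2)%:E]).
    apply: measurable_ltE => //; apply: measurableT_comp => //.
    by apply: measurable_funB => //; exact: measurable_coord.
  by apply/seteqP; split=> y /=; rewrite lte_fin.
by apply/seteqP; split=> [y h k _|y h k]; [exact: (h k)|exact: (h k Logic.I)].
Qed.

(** An open set is the countable union of the rational boxes it contains, and boxes belong to the
    product sigma-algebra. *)
Lemma measurable_open_rv (O : set 'rV[R]_n) : open O -> measurable (rv @^-1` O).
Proof.
move=> oO.
pose F c := if `[<box c `<=` rv @^-1` O>] then box c else set0.
rewrite (_ : rv @^-1` O = \bigcup_c F c).
  apply: countable_bigcupT_measurable; first exact: countableP.
  by move=> c; rewrite /F; case: ifP => _; [exact: measurable_box|exact: measurable0].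
apply/seteqP; split=> [y Oy|y [c _]]; last first.
  by rewrite /F; case: asboolP => // Hc; exact: Hc.
move: oO; rewrite openE => /(_ _ Oy); rewrite /interior => /nbhs_ballP[e /= e0 He].
(* Below [e / 2], so that two points of a box of half-side [ratr r] differ by less than [e] in each
   coordinate. *)
have [r re] : exists r : rat, ((0 : R) < ratr r < e / 2)%R.
  have [r] := rat_in_itvoo (divr_gt0 e0 (ltr0Sn R 1)).
  by rewrite in_itv/= => ?; exists r.
have [c Hc] : exists c : {ffun 'I_n -> rat}, forall k, (`|y k - ratr (c k)| < ratr r)%R.
  have H k : exists q : rat, (`|y k - ratr q| < ratr r)%R.
    have : (y k - ratr r < y k + ratr r)%R by case/andP: re => ? _; lra.
    move=> /rat_in_itvoo[q]; rewrite in_itv/= => /andP[? ?]; exists q.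
    by rewrite ltr_norml; apply/andP; split; lra.
  have /choice[c Hc] := H; exists (finfun c) => k; by rewrite ffunE.
exists (c, r) => //; rewrite /F; case: asboolP => // nO; exfalso; apply: nO.
move=> z zc; apply: He; split=> // i k; rewrite !mxE /ball/=.
have := zc k; have := Hc k; case/andP: re => _; rewrite /= => re h1 h2.
rewrite (_ : _ - _ = (y k - ratr (c k)) - (z k - ratr (c k)))%R; last by ring.
by apply: le_lt_trans (ler_normB _ _) _; lra.
Qed.

Lemma measurable_borel_rv (A : set 'rV[R]_n) : borelRn A -> measurable (rv @^-1` A).
Proof.
move=> bA; have := bA [set B | measurable (rv @^-1` B)]; apply; split.
- split=> /=.
  + by rewrite preimage_set0.
  + by move=> B mB; rewrite setTD preimage_setC; exact: measurableC.
  + by move=> F mF; rewrite preimage_bigcup; exact: bigcupT_measurable.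
- exact: measurable_open_rv.
Qed.

End rows.
Arguments rv {R n} y.
Arguments vr {R n} x.

(** * Null sets and Borel versions of densities *)

Section vol_null.
Context (R : realType) (D : finType).
Local Open Scope ereal_scope.
Notation VW := (vec R D).

Lemma vol0 : vol (set0 : set VW) = 0 :> \bar R.
Proof.
rewrite /vol -[RHS](itint0 (enum D) (fun=> 0%R)); apply: eq_itint => y _.
by rewrite indicE in_set0.
Qed.

Lemma volU_null (A B : set VW) : measurable A -> measurable B ->
  vol A = 0 -> vol B = 0 -> vol (A `|` B) = 0.
Proof.
move=> mA mB A0 B0; have mU := measurableU _ _ mA mB.
apply/eqP; rewrite eq_le vol_ge0 andbT (volD mU mA).
rewrite (_ : (A `|` B) `&` A = A); last by rewrite setIC setUC setKU.
rewrite A0 add0e -B0; apply: le_vol => //; first exact: measurableD.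
by move=> y [[]].
Qed.

(** Finite unions are null by induction, and monotone convergence gives the countable union. *)
Lemma vol_bigcup_null (Z : nat -> set VW) : (forall j, measurable (Z j)) ->
  (forall j, vol (Z j) = 0) -> vol (\bigcup_j Z j) = 0.
Proof.
move=> mZ Z0; pose U k := \bigcup_(j < k) Z j.
have mU k : measurable (U k) by exact: bigcup_measurable.
have U0 k : vol (U k) = 0.
  elim: k => [|k IH]; first by rewrite /U bigcup_mkord big_ord0 vol0.
  rewrite /U bigcup_mkord big_ord_recr -bigcup_mkord.
  exact: (volU_null (mU k) (mZ k) IH (Z0 k)).
have : vol (U k) @[k --> \oo] --> vol (\bigcup_j Z j).
  apply: cvg_itint.
  - by move=> k; exact: measurable_indicE.
  - by move=> k y; exact: indicE_ge0.
  - move=> y i j ij; rewrite lee_fin !indicE ler_nat.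
    case: (boolP (y \in U i)) => // /set_mem[l li Zl]; rewrite mem_set//.
    by exists l => //; exact: leq_trans ij.
  - move=> y; have [[l _ Zl]|nZ] := pselect ((\bigcup_j Z j) y).
      apply: cvg_near_cst; exists l.+1 => // k /= lk; congr EFin; apply: eq_indic.
      by split=> _; exists l.
    apply: cvg_near_cst; exists 0%N => // k _; congr EFin; apply: eq_indic.
    by split=> [[l _ Zl]|//]; exists l.
under eq_fun do rewrite U0.
by move=> /(cvg_lim (@ereal_hausdorff R)) <-; rewrite lim_cst//; exact: ereal_hausdorff.
Qed.

End vol_null.

Section borel_version.
Context (R : realType) (n : nat).
Local Open Scope ereal_scope.
Notation mu := (@lebesgue_measure R).
Notation VW := (vec R 'I_n).

(** Densities are only Lebesgue measurable, while the manipulations of iterated integrals ask for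
    measurability in the product sigma-algebra; [f0] is a substitute that has it. *)
Record version (f : 'rV[R]_n -> R) (f0 : VW -> R) (Z : set VW) := Version {
  ver_null : measurable Z;
  ver_vol : vol Z = 0;
  ver_meas : measurable_fun setT f0;
  ver_ge0 : forall y, (0 <= f0 y)%R;
  ver_eq : forall y, ~ Z y -> f (rv y) = f0 y
}.

(** Measurability of [f] is applied to the half-lines above the rationals. The countably many
    exceptional sets make up [Z], and [f0] is [f] set to 0 on [Z]; its superlevel sets are countable
    unions of the rational ones. *)
Lemma exists_version (f : 'rV[R]_n -> R) : measurable_fun_Rn f -> (forall x, 0 <= f x)%R ->
  exists f0 Z, version f f0 Z.
Proof.
move=> mf f0.
have H (r : rat) : exists BZ : set VW * set VW, [/\ measurable BZ.1, measurable BZ.2, vol BZ.2 = 0 &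
    forall y, ~ BZ.2 y -> (ratr r < f (rv y))%R <-> BZ.1 y].
  have mr : measurable (`](ratr r : R)%R, +oo[%classic : set R) by [].
  have [B [Z [bB bZ Z0 BZ]]] := mf _ mr.
  exists (rv @^-1` B, rv @^-1` Z); split=> /=.
  - exact: measurable_borel_rv.
  - exact: measurable_borel_rv.
  - by rewrite -volRnE.
  - move=> y nZ; split=> [h|By]; apply: contrapT => nB; apply: nZ; apply: BZ.
      by left; split=> //; rewrite /preimage/= in_itv/= h.
    by right; split=> //; rewrite /preimage/= in_itv/= andbT.
have /choice[BZ HBZ] := H.
pose Zj (j : nat) : set VW := if unpickle j is Some r then (BZ r).2 else set0.
pose Z := \bigcup_j Zj j.
have mZj j : measurable (Zj j).
  by rewrite /Zj; case: unpickle => // r; case: (HBZ r).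
have mZ : measurable Z by exact: bigcupT_measurable.
have ZBZ r : (BZ r).2 `<=` Z.
  by move=> y h; exists (pickle r); rewrite /Zj ?pickleK.
exists (fun y => if `[<Z y>] then 0%R else f (rv y)), Z; split => //.
- by apply: vol_bigcup_null => // j; rewrite /Zj; case: unpickle => [r|]; [case: (HBZ r)|exact: vol0].
- apply: (measurability (@RGenOInfty.G R) (RGenOInfty.measurableE R)).
  move=> _ [_ [a ->] <-]; rewrite setTI.
  have [a0|a0] := ltP a 0%R.
    rewrite (_ : _ @^-1` _ = setT)//; apply/seteqP; split=> // y _ /=.
    by rewrite in_itv/= andbT; case: asboolP => // _; exact: lt_le_trans (f0 _).
  rewrite (_ : _ @^-1` _ = \bigcup_(r : rat) (if (a < ratr r)%R then (BZ r).1 `\` Z else set0)).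
    apply: bigcupT_measurable_rat => r; case: ifP => // _.
    by apply: measurableD => //; case: (HBZ r).
  apply/seteqP; split=> y /=; rewrite ?in_itv/= ?andbT.
    case: asboolP => [_|nZ h]; first by rewrite ltNge a0.
    have [r] := rat_in_itvoo h; rewrite in_itv/= => /andP[ar rf].
    exists r => //; rewrite ar; split => //; have [_ _ _ Hr] := HBZ r.
    by apply/Hr => // /ZBZ.
  move=> [r _]; case: ifP => // ar [Br nZ]; case: asboolP => // _.
  have [_ _ _ Hr] := HBZ r; apply: (lt_trans ar); apply/Hr => // /ZBZ//.
- by move=> y; case: asboolP.
- by move=> y nZ; case: asboolP.
Qed.

Lemma version_vol f f0 Z t : version f f0 Z ->
  volRn [set x | (t < f x)%R] = vol [set y | (t < f0 y)%R].
Proof.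
move=> v; rewrite volRnE; apply: (eq_itint_null (ver_null v) (ver_vol v)).
- by move=> y; exact: indicE_ge0.
- by move=> y; exact: indicE_ge0.
- by move=> y nZ; congr EFin; apply: eq_indic; rewrite /preimage /= (ver_eq v).
Qed.

Lemma omegaE : omega n = omegav R 'I_n.
Proof.
rewrite /omega volRnE; congr (fine (vol _)); apply/seteqP.
by split=> y; rewrite /preimage /unit_ballRn /ballv /= normE_rv.
Qed.

(** [sym_rearr] takes the finite part of an extended integral. The essential bound makes that
    integral finite: layers above the maximum of [M] and 0 are null and symmetrize to the empty
    set. *)
Lemma sym_rearrE f f0 Z y : (0 < n)%N -> version f f0 Z ->
  (exists M : R, volRn [set x | (M < f x)%R] = 0) ->
  (sym_rearr f (rv y))%:E = \int[mu]_r (\1_(star (layer f0 r)) y)%:E.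
Proof.
move=> n0 v [M HM].
have mf0E : measurable_fun setT (fun x => (f0 x)%:E : \bar R).
  by apply/measurable_EFinP; exact: ver_meas v.
have layer_lt0 r : (r < 0)%R -> layer f0 r = set0.
  by move=> r0; rewrite -subset0 => x [] /=; rewrite leNgt r0.
have star0 : star (set0 : set VW) = set0.
  rewrite -subset0 => x; rewrite /star /= vol0 lte_fin ltNge mulr_ge0//.
    exact/ltW/omegav_gt0/(Ordinal n0).
  by rewrite exprn_ge0// vnorm_ge0.
have E : \int[mu]_(t in [set t : R | (0 <= t)%R])
      (\1_(sym_rearr_set [set y | (t < f y)%R]) (rv y))%:E =
    \int[mu]_r (\1_(star (layer f0 r)) y)%:E.
  rewrite integral_mkcond; apply: eq_integral => r _; rewrite patchE.
  case: ifPn => [/set_mem /= r0|/negP h].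
    congr EFin; apply: eq_indic; rewrite /sym_rearr_set /star /= omegaE normE_rv card_ord.
    rewrite (version_vol _ v) (_ : layer f0 r = [set y | (r < f0 y)%R])//.
    by apply/seteqP; split=> x /=; rewrite /layer /subgraph /= lte_fin; [case|split].
  rewrite layer_lt0 ?star0 ?indicE ?in_set0//.
  by rewrite ltNge; apply/negP => r0; apply: h; exact: mem_set.
rewrite /sym_rearr E fineK// ge0_fin_numE; last by apply: integral_ge0 => r _; exact: indicE_ge0.
pose K := Num.max M 0%R.
apply: (@le_lt_trans _ _ (\int[mu]_r (\1_(`[0%R, K]%classic) r)%:E)).
  apply: ge0_le_integral => //.
  - rewrite (_ : (fun r => _) = (fun r : R =>
        (\1_[set p : R * VW | star (layer f0 p.1) p.2] (r, y))%:E)).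
      have mst := measurable_star_layer (ver_meas v).
      by apply: (measurable_indic_comp mst); exact: measurable_fun_pair.
    by apply/funext => r; congr EFin; exact: eq_indic.
  - exact: measurable_indicE.
  - move=> r _; rewrite lee_fin !indicE ler_nat.
    have [r0|r0] := ltP r 0%R; first by rewrite layer_lt0// star0 in_set0.
    have [rK|rK] := leP r K; first by rewrite [X in (_ <= nat_of_bool X)%N]mem_set ?leq_b1//= in_itv/= r0.
    rewrite (_ : star _ = set0) ?in_set0// -star0.
    apply/seteqP; split; apply: star_mono; rewrite vol0 ?vol_ge0//.
    rewrite -HM (version_vol _ v); apply: le_vol.
    + exact: measurable_subgraph.
    + rewrite (_ : [set y | _] = [set x | M%:E < (f0 x)%:E]); last first.
        by apply/seteqP; split=> x /=; rewrite lte_fin.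
      exact: measurable_ltE.
    + move=> x [_] /=; rewrite lte_fin; apply: lt_trans.
      by apply: le_lt_trans rK; rewrite /K le_max lexx.
rewrite integral_indicT// lebesgue_measure_itv/=.
by case: ifP => _; rewrite ?ltry// -EFinB ltry.
Qed.

End borel_version.

(** * Support functions *)

Section support_function.
Context (R : realType) (m : nat) (C : set 'rV[R]_m).
Hypothesis bC : sym_convex_body C.

Let h : vec R 'I_m -> R := fun y => supp_fun C (rv y).

Lemma body_nonempty : C !=set0.
Proof. by have [_ _ [x Cx] _] := bC; exists x; exact: interior_subset. Qed.

Lemma body_bounded : exists2 M : R, 0 <= M & forall c i, C c -> `|c ord0 i| <= M.
Proof.
have [_ cC _ _] := bC.
have H i : exists M : R, 0 <= M /\ forall c, C c -> `|c ord0 i| <= M.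
  have cc : compact ((fun c : 'rV[R]_m => c ord0 i) @` C).
    apply: continuous_compact => //; apply: continuous_subspaceT.
    exact: coord_continuous.
  have [M [_ HM]] := compact_bounded cc.
  have HM1 : M < `|M| + 1 by apply: le_lt_trans (ler_norm M) _; rewrite ltrDl.
  exists (`|M| + 1); split; first by rewrite addr_ge0.
  by move=> c Cc; apply: (HM _ HM1); exists c.
have /choice[M HM] := H; exists (\sum_i M i).
  by apply: sumr_ge0 => i _; case: (HM i).
move=> c i Cc; have [M0 Mi] := HM i; apply: (le_trans (Mi _ Cc)).
by rewrite (bigD1 i)//= lerDl sumr_ge0// => j _; case: (HM j).
Qed.

Let E (y : vec R 'I_m) := [set dotv c (rv y) | c in C].

Lemma dotv_le (M : R) (c : 'rV[R]_m) (y : vec R 'I_m) : (forall i, `|c ord0 i| <= M) ->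
  `|dotv c (rv y)| <= M * \sum_i `|y i|.
Proof.
move=> cM; rewrite /dotv mulr_sumr; apply: (le_trans (ler_norm_sum _ _ _)).
by apply: ler_sum => i _; rewrite normrM mxE ler_wpM2r.
Qed.

Let hasE y : has_sup (E y).
Proof.
split; first by have [c Cc] := body_nonempty; exists (dotv c (rv y)), c.
have [M M0 HM] := body_bounded; exists (M * \sum_i `|y i|) => _ [c Cc <-].
by apply: (le_trans (ler_norm _)); apply: dotv_le => i; exact: HM.
Qed.

Let h_ge c y : C c -> dotv c (rv y) <= h y.
Proof. by move=> Cc; apply: (sup_upper_bound (hasE y)); exists c. Qed.

Let h_le y (a : R) : (forall c, C c -> dotv c (rv y) <= a) -> h y <= a.
Proof.
move=> H; apply: ge_sup; first by case: (hasE y).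
by move=> _ [c Cc <-]; exact: H.
Qed.

Let dotvN (c : 'rV[R]_m) (y : vec R 'I_m) : dotv (- c) (rv y) = - dotv c (rv y) :> R.
Proof. by rewrite /dotv -sumrN; apply: eq_bigr => i _; rewrite !mxE mulNr. Qed.

Let h_ge0 y : 0 <= h y.
Proof.
have [_ _ _ sC] := bC; have [c Cc] := body_nonempty.
have := h_ge y Cc; have := h_ge y (sC _ Cc); rewrite dotvN; lra.
Qed.

Let h_add x y : h (vadd x y) <= h x + h y.
Proof.
apply: h_le => c Cc; rewrite (_ : dotv _ _ = dotv c (rv x) + dotv c (rv y)).
  by apply: lerD; exact: h_ge.
by rewrite /dotv -big_split; apply: eq_bigr => i _; rewrite !mxE mulrDr.
Qed.

Let h_scale_le (a : R) y : h (vscale a y) <= `|a| * h y.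
Proof.
have [_ _ _ sC] := bC.
apply: h_le => c Cc; rewrite (_ : dotv _ _ = a * dotv c (rv y)); last first.
  by rewrite /dotv mulr_sumr; apply: eq_bigr => i _; rewrite !mxE /vscale; ring.
have [a0|a0] := leP 0 a.
  by rewrite ger0_norm// ler_wpM2l// h_ge.
have na0 : 0 <= - a by rewrite oppr_ge0 ltW.
rewrite ltr0_norm//; have := ler_wpM2l na0 (h_ge y (sC _ Cc)).
by rewrite dotvN mulrNN.
Qed.

Let h_scale (a : R) y : h (vscale a y) = `|a| * h y.
Proof.
apply/eqP; rewrite eq_le h_scale_le /=.
have [->|a0] := eqVneq a 0; first by rewrite normr0 mul0r h_ge0.
have := h_scale_le a^-1 (vscale a y).
rewrite (_ : vscale _ (vscale a y) = y); last first.
  by apply/funext => k; rewrite /vscale mulrA mulVf// mul1r.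
by rewrite normfV mulrC ler_pdivlMr ?normr_gt0// mulrC.
Qed.

(** Subadditivity together with boundedness of the body makes [h] continuous, so its strict
    superlevel sets are open. *)
Let measurable_h : measurable_fun setT h.
Proof.
have [M M0 HM] := body_bounded.
have op (a : R) : open [set x : 'rV[R]_m | a < supp_fun C x].
  rewrite openE => x /= ax; apply/nbhs_ballP.
  pose d := supp_fun C x - a; have d0 : 0 < d by rewrite subr_gt0.
  (* If the entries of [x - y] are below [e], then [h (x - y) <= M m e < d]; the [+ 1] covers the
     case [M m = 0]. *)
  pose e := d / (M * m%:R + 1).
  have k0 : 0 < M * m%:R + 1 by rewrite ltr_wpDl// mulr_ge0.
  have e0 : 0 < e by rewrite divr_gt0.
  exists e => // y [_ xy] /=.
  have := h_add (vadd (vr x) (vscale (-1) (vr y))) (vr y).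
  rewrite (_ : vadd _ (vr y) = vr x); last first.
    by apply/funext => k; rewrite /vadd /vscale; ring.
  have : h (vadd (vr x) (vscale (-1) (vr y))) < d.
    apply: (@le_lt_trans _ _ (M * (e * m%:R))).
      apply: h_le => c Cc; apply: (le_trans (ler_norm _)).
      apply: (le_trans (dotv_le _ (fun i => HM c i Cc))); rewrite ler_wpM2l//.
      apply: (@le_trans _ _ (\sum_(i < m) e)).
        apply: ler_sum => i _; have := xy ord0 i; rewrite /ball /= /vadd /vscale /vr.
        by rewrite mulN1r => /ltW.
      by rewrite sumr_const card_ord mulr_natr.
    have -> : d = e * (M * m%:R + 1) by rewrite /e divfK ?gt_eqF.
    by rewrite mulrCA ltr_pM2l// ltrDl.
  rewrite /h !vrK /d; lra.
apply: (measurability (@RGenOInfty.G R) (RGenOInfty.measurableE R)).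
move=> _ [_ [a ->] <-]; rewrite setTI.
rewrite (_ : _ @^-1` _ = rv @^-1` [set x : 'rV[R]_m | a < supp_fun C x]).
  exact: measurable_open_rv.
by apply/seteqP; split=> y; rewrite /preimage /= in_itv/= andbT.
Qed.

(** [phi] selects the entries that the body reads among those of a larger family. *)
Lemma seminorm_supp (I : finType) (phi : 'I_m -> I) :
  seminorm (fun v : vec R I => supp_fun C (\row_j v (phi j))).
Proof.
pose s (v : vec R I) : vec R 'I_m := fun j => v (phi j).
split.
- apply: (measurableT_comp measurable_h (g := s)); apply: measurable_vec => j.
  exact: measurable_coord.
- by move=> v; exact: (h_ge0 (s v)).
- move=> l x y /andP[l0 l1].
  have := h_add (vscale l (s x)) (vscale (1 - l) (s y)); rewrite !h_scale.
  by rewrite !ger0_norm// subr_ge0.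
- by move=> a x; exact: (h_scale a (s x)).
Qed.

End support_function.

(** * Proof of the inequalities *)

Section powers.
Context (R : realType).
Local Open Scope ereal_scope.

(** Here the integrality of [n / q] enters: the [n]-th power of the radial function becomes the
    [k]-th power of a sum or an integral. For [S = +oo] both sides are infinite, since [k] cannot be
    0. *)
Lemma expe_poweR (S : \bar R) (q : R) (k n : nat) : (0 < q)%R -> 0 <= S -> (0 < n)%N ->
  n%:R = (q * k%:R)%R -> (poweR S q^-1) ^+ n = S ^+ k.
Proof.
move=> q0 S0 n0 nq.
case: S S0 => [s| |//]; rewrite ?lee_fin => s0.
  rewrite poweR_EFin -!EFin_expe; congr EFin.
  by rewrite -powR_mulrn ?powR_ge0// -powRrM nq mulrA mulVf ?gt_eqF// mul1r powR_mulrn.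
have k0 : (0 < k)%N.
  by rewrite lt0n; apply/eqP => k0; move: n0; rewrite -(ltr0n R) nq k0 mulr0 ltxx.
rewrite poweRyr ?invr_eq0 ?gt_eqF//.
have oo j : (+oo : \bar R) ^+ j.+1 = +oo.
  by elim: j => [|j IH]; [|rewrite expeS IH mulyy].
by rewrite -(prednK n0) -(prednK k0) !oo.
Qed.

(** Equal monomials are not collected when a [k]-th power is expanded, so every term is a product of
    [k] factors in the shape of [pker]. *)
Fixpoint words (T : Type) (r : seq T) (k : nat) : seq (seq T) :=
  if k is k'.+1 then [seq i :: w | i <- r, w <- words r k'] else [:: [::]].

Lemma size_words (T : eqType) (r : seq T) k w : w \in words r k -> size w = k.
Proof.
elim: k w => [|k IH] w /=; first by rewrite inE => /eqP ->.
by move=> /allpairsP[[i v] /= [_ /IH vk ->]] /=; rewrite vk.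
Qed.

Lemma expe_sum_words (T : Type) (r : seq T) (b : T -> \bar R) k : (forall i, 0 <= b i) ->
  (\sum_(i <- r) b i) ^+ k = \sum_(w <- words r k) foldr (fun i g => b i * g) 1 w.
Proof.
move=> b0.
have f0 w : 0 <= foldr (fun i g => b i * g) 1 w.
  by elim: w => [|i w IH] /=; rewrite ?lee_fin// mule_ge0.
elim: k => [|k IH]; first by rewrite /= big_seq1.
rewrite expeS IH [words _ k.+1]/= big_allpairs_dep ge0_sume_distrl//.
by apply: eq_bigr => i _; rewrite ge0_sume_distrr.
Qed.

(** Tonelli over [k] independent copies of the variable, one row per copy. *)
Lemma power_itint (K : finType) (phi : vec R K -> \bar R) (k : nat) :
  measurable_fun setT phi -> (forall y, 0 <= phi y) ->
  (itint (enum K) phi (fun=> 0%R)) ^+ k =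
  itint (enum {: 'I_k * K}) (fun X => foldr (fun l g => phi (vrow X l) * g) 1 (enum 'I_k)) (fun=> 0%R).
Proof.
move=> mphi phi0.
have mf es : measurable_fun setT (fun X : vec R ('I_k * K)%type => foldr (fun l g => phi (vrow X l) * g) 1 es).
  elim: es => [|l es IH] /=; first exact: measurable_cst.
  by apply: emeasurable_funM => //; exact: (measurableT_comp mphi (measurable_vrow l)).
have f0 es (X : vec R ('I_k * K)%type) : 0 <= foldr (fun l g => phi (vrow X l) * g) 1 es.
  by elim: es => [|l es IH] /=; rewrite ?lee_fin// mule_ge0.
have key (es : seq 'I_k) (X : vec R ('I_k * K)%type) : uniq es ->
    itint (blk K es) (fun X => foldr (fun l g => phi (vrow X l) * g) 1 es) X =
    (itint (enum K) phi (fun=> 0%R)) ^+ size es.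
  elim: es X => [|l es IH] X; first by [].
  rewrite cons_uniq => /andP[les ues]; rewrite itint_blk_cons [size _]/= expeS muleC.
  rewrite -itintZ//; last by rewrite expe_ge0// itint_ge0.
  apply: eq_itint => x _.
  transitivity (phi (vrow (bins l X x) l) * itint (blk K es)
      (fun X => foldr (fun l g => phi (vrow X l) * g) 1 es) (bins l X x)).
    rewrite -(itintZ (blk K es) _ (mf es) (f0 es) (phi0 _)).
    apply: eq_itint => Y YX /=; congr (phi _ * _); apply/funext => j.
    by rewrite /vrow YX// mem_blk.
  by rewrite IH// vrow_bins muleC.
rewrite (itint_enum_blk _ (mf (enum 'I_k)) (f0 (enum 'I_k))) key ?enum_uniq//.
by rewrite -cardE card_ord.
Qed.

End powers.

Section translation.
Context (R : realType) (n : nat).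
Hypothesis n0 : (0 < n)%N.
Local Open Scope ereal_scope.
Notation VW := (vec R 'I_n).

(** The factor [omega n] cancels the normalization of the surface measure. *)
Lemma star_volE (rho : 'rV[R]_n -> \bar R) : star_vol rho =
  itint (enum 'I_n) (fun y => if (0 < vnorm y < 1)%R
    then rho (rv (vscale (vnorm y)^-1 y)) ^+ n else 0) (fun=> 0%R).
Proof.
rewrite /star_vol /sphere_int muleA -EFinM omegaE divff; last first.
  by rewrite gt_eqF//; exact: (omegav_gt0 R (Ordinal n0)).
rewrite mul1e intRnE; apply: eq_itint => y _ /=.
by rewrite normE_rv rv_neq0 andbC rvZ.
Qed.

Section families.
Variables (I : finType) (W : vec R (I * 'I_n)%type -> \bar R).
Hypothesis W0 : forall X, 0 <= W X.
Variables (F : I -> 'rV[R]_n -> R) (f : I -> VW -> R) (Z : I -> set VW).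
Hypothesis F0 : forall e x, (0 <= F e x)%R.
Hypothesis ver : forall e, version (F e) (f e) (Z e).

Lemma itint_row_null (e : I) (A : set VW) : measurable A -> vol A = 0 ->
  itint (blk 'I_n (enum I)) (fun X => (\1_A (vrow X e))%:E) (fun=> 0%R) = 0.
Proof.
move=> mA A0.
have mg : measurable_fun setT (fun X : vec R (I * 'I_n)%type => (\1_A (vrow X e))%:E : \bar R).
  by apply: measurable_indic_comp => //; exact: measurable_vrow.
have g0 (X : vec R (I * 'I_n)%type) : 0 <= (\1_A (vrow X e) : R)%:E by exact: indicE_ge0.
rewrite -(itint_enum_blk _ mg g0).
have ub : uniq [seq (e, k) | k <- enum 'I_n].
  by rewrite map_inj_uniq ?enum_uniq// => ? ? [].
rewrite (perm_itint _ mg g0 (enum_uniq _) (perm_filter_cat (enum_uniq _) ub _)); last first.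
  by move=> p _; rewrite mem_enum.
rewrite itint_cat -[RHS](itint0 [seq j <- enum {: I * 'I_n} | j \notin [seq (e, k) | k <- enum 'I_n]] (fun=> 0%R)).
apply: eq_itint => X _; rewrite itint_block -A0 /vol.
by apply: eq_itint => x _; rewrite vrow_bins.
Qed.

(** The configurations in which some row lies in its exceptional set form a finite union of null
    sets. *)
Lemma itint_version :
  itint (blk 'I_n (enum I)) (fun X => W X * (\prod_e F e (rv (vrow X e)))%:E) (fun=> 0%R) =
  itint (blk 'I_n (enum I)) (fun X => W X * (\prod_e f e (vrow X e))%:E) (fun=> 0%R).
Proof.
pose U := [set X : vec R (I * 'I_n)%type | exists e, Z e (vrow X e)].
pose B (e : I) := [set X : vec R (I * 'I_n)%type | Z e (vrow X e)].
have mB e : measurable (B e).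
  by have := measurable_vrow e measurableT (ver_null (ver e)); rewrite setTI.
have UE : U = \bigcup_e B e.
  by apply/seteqP; split=> X /= [e]; [exists e|move=> _; exists e].
have mU : measurable U.
  by rewrite UE; apply: fin_bigcup_measurable => //; exact: finite_finset.
have mI (A : set (vec R (I * 'I_n)%type)) : measurable A ->
    measurable_fun setT (fun X => (\1_A X)%:E : \bar R) by exact: measurable_indicE.
apply: (@eq_itint_null _ _ U) => //.
- apply/eqP; rewrite eq_le; apply/andP; split; last first.
    by apply: itint_ge0 => X; exact: indicE_ge0.
  apply: (@le_trans _ _ (itint (blk 'I_n (enum I))
     (fun X => \sum_(e <- enum I) (\1_(B e) X)%:E) (fun=> 0%R))).
    apply: le_itint.
    + exact: mI.
    + by apply: emeasurable_sum => e; exact: mI.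
    + by move=> X; exact: indicE_ge0.
    + move=> X _; rewrite indicE; case: (boolP (X \in U)) => [/set_mem[e Be]|_]; last first.
        by apply: sume_ge0 => e _; exact: indicE_ge0.
      rewrite (big_rem e) ?mem_enum//= [X in _ <= X + _](_ : _ = 1%:E); last first.
        by rewrite indicE mem_set.
      by rewrite leeDl//; apply: sume_ge0 => e' _; exact: indicE_ge0.
    + by move=> X; apply: sume_ge0 => e _; exact: indicE_ge0.
  rewrite itint_sum; [|by move=> e; exact: mI|by move=> e X; exact: indicE_ge0].
  rewrite big1// => e _; rewrite -(itint_row_null e (ver_null (ver e)) (ver_vol (ver e))).
  by apply: eq_itint => X _; congr EFin; exact: eq_indic.
- by move=> X; rewrite mule_ge0// lee_fin prodr_ge0.
- by move=> X; rewrite mule_ge0// lee_fin prodr_ge0// => e _; exact: ver_ge0 (ver e) _.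
- move=> X nU; congr (_ * _%:E); apply: eq_bigr => e _.
  by rewrite (ver_eq (ver e))// => h; apply: nU; exists e.
Qed.

Lemma itint_fform : measurable_fun setT W ->
  itint (blk 'I_n (enum I)) (fun X => W X * (\prod_e F e (rv (vrow X e)))%:E) (fun=> 0%R) =
  fform W f.
Proof.
move=> mW; rewrite itint_version -itint_enum_blk.
- by apply: eq_itint => X _; rewrite muleC.
- apply: emeasurable_funM => //; apply/measurable_EFinP; apply: measurable_prod => e _.
  exact: (measurableT_comp (ver_meas (ver e)) (measurable_vrow e)).
- by move=> X; rewrite mule_ge0// lee_fin prodr_ge0// => e _; exact: ver_ge0 (ver e) _.
Qed.

End families.

Lemma sym_rearr_ge0 (f : 'rV[R]_n -> R) x : (0 <= sym_rearr f x)%R.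
Proof. by apply: fine_ge0; apply: integral_ge0 => t _; rewrite lee_fin. Qed.

Lemma version_rearr f f0 Z : in_Pn f -> version f f0 Z ->
  version (sym_rearr f) (fun y : VW => sym_rearr f (rv y)) set0.
Proof.
move=> [_ _ _ fM] v; split.
- exact: measurable0.
- exact: vol0.
- by apply: (measurable_rearr (ver_meas v)) => y; exact: sym_rearrE v fM.
- by move=> y; exact: sym_rearr_ge0.
- by [].
Qed.

End translation.

Section conclusion.
Context (R : realType) (n : nat) (q : R) (k : nat).
Hypothesis n0 : (0 < n)%N.
Hypothesis q0 : (0 < q)%R.
Hypothesis nq : n%:R = (q * k%:R)%R.
Local Open Scope ereal_scope.
Notation mu := (@lebesgue_measure R).
Notation VW := (vec R 'I_n).

Lemma expeMn (a b : \bar R) j : (a * b) ^+ j = a ^+ j * b ^+ j.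
Proof. by elim: j => [|j IH]; rewrite ?expe0 ?mule1// !expeS IH muleACA. Qed.

Lemma fform_sphV_sum (I : finType) (T : Type) (r : seq T) (Lw : T -> seq (vec R I -> R))
    (c : R) (f : I -> VW -> R) : (0 <= c)%R ->
  (forall w, List.Forall (@seminorm R I) (Lw w)) ->
  (forall e, measurable_fun setT (f e)) -> (forall e x, (0 <= f e x)%R) ->
  fform (fun X => \sum_(w <- r) c%:E * sphV q 0 (Lw w) X) f =
  \sum_(w <- r) c%:E * fform (sphV q 0 (Lw w)) f.
Proof.
move=> c0 sL mf f0; rewrite /fform.
have mP : measurable_fun setT (fun X : vec R (I * 'I_n)%type => (\prod_e f e (vrow X e))%:E : \bar R).
  apply/measurable_EFinP; apply: measurable_prod => e _.
  exact: (measurableT_comp (mf e) (measurable_vrow e)).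
have P0 (X : vec R (I * 'I_n)%type) : 0 <= (\prod_e f e (vrow X e))%:E.
  by rewrite lee_fin prodr_ge0.
have mPV w : measurable_fun setT (fun X : vec R (I * 'I_n)%type =>
    (\prod_e f e (vrow X e))%:E * sphV q 0 (Lw w) X).
  by apply: emeasurable_funM => //; exact: measurable_sphV.
have PV0 w (X : vec R (I * 'I_n)%type) : 0 <= (\prod_e f e (vrow X e))%:E * sphV q 0 (Lw w) X.
  by rewrite mule_ge0// sphV_ge0.
transitivity (itint (enum {: I * 'I_n}) (fun X => \sum_(w <- r)
    (c%:E * ((\prod_e f e (vrow X e))%:E * sphV q 0 (Lw w) X))) (fun=> 0%R)).
  apply: eq_itint => X _; rewrite ge0_sume_distrr; last first.
    by move=> w _; rewrite mule_ge0 ?sphV_ge0.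
  by apply: eq_bigr => w _; rewrite muleCA.
rewrite itint_sum.
- by apply: eq_bigr => w _; rewrite (itintZ _ _ (mPV w) (PV0 w)).
- by move=> w; apply: emeasurable_funM => //; exact: mPV.
- by move=> w X; rewrite mule_ge0.
Qed.

Lemma fform_sphV_le (I : finType) (L : seq (vec R I -> R)) (f g : I -> VW -> R) :
  List.Forall (@seminorm R I) L -> size L = k ->
  (forall e, measurable_fun setT (f e)) -> (forall e x, (0 <= f e x)%R) ->
  (forall e x, (0 <= g e x)%R) ->
  (forall e x, (g e x)%:E = \int[mu]_r (\1_(star (layer (f e) r)) x)%:E) ->
  fform (sphV q 0 L) f <= fform (sphV q 0 L) g.
Proof.
move=> sL szL mf f0 g0 gE.
apply: fform_star => //.
- exact: measurable_sphV.
- by move=> X; exact: sphV_ge0.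
- move=> A mA; apply: (sphV_star (Ordinal n0) q0 sL) => //.
  by rewrite card_ord szL.
Qed.

Section empirical.
Variables (N : nat) (m : 'I_N -> nat) (C : forall i : 'I_N, set 'rV[R]_(m i)).
Arguments C : clear implicits.
Hypothesis bC : forall i, sym_convex_body (C i).

(** Block [i] is read from the inner products of the whole family; the common domain lets one word
    combine different bodies. *)
Let Nf (i : 'I_N) (v : vec R (emp_index m)) : R :=
  supp_fun (C i) (\row_j v (Tagged (fun i => 'I_(m i)) j))%R.

Let sNf (w : seq 'I_N) : List.Forall (@seminorm R (emp_index m)) [seq Nf i | i <- w].
Proof.
elim: w => [|i w IH] /=; first exact: List.Forall_nil.
by apply: List.Forall_cons => //; exact: seminorm_supp.
Qed.

Let W (X : vec R (emp_index m * 'I_n)%type) : \bar R :=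
  \sum_(w <- words (index_enum 'I_N) k) ((N%:R^-1) ^+ k)%:E * sphV q 0 [seq Nf i | i <- w] X.

Let Nk0 : (0 <= (N%:R^-1) ^+ k :> R)%R.
Proof. by rewrite exprn_ge0. Qed.

Let W0 X : 0 <= W X.
Proof. by apply: sume_ge0 => w _; rewrite mule_ge0 ?sphV_ge0. Qed.

Let mW : measurable_fun setT W.
Proof.
apply: emeasurable_sum => w; apply: emeasurable_funM => //; exact: measurable_sphV.
Qed.

Lemma star_vol_emp (X : vec R (emp_index m * 'I_n)%type) :
  star_vol (ZdiamE_rho (- q) C (fun e => rv (vrow X e))) = W X.
Proof.
have mh w : measurable_fun setT (fun y : VW => if (0 < vnorm y < 1)%R
    then pker q 0 [seq Nf i | i <- w] (X, vscale (vnorm y)^-1 y) else 0).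
  exact: measurable_sphV_fun1.
have h0 w (y : VW) : 0 <= (if (0 < vnorm y < 1)%R
    then pker q 0 [seq Nf i | i <- w] (X, vscale (vnorm y)^-1 y) else 0).
  by case: ifP => // _; exact: pker_ge0.
transitivity (itint (enum 'I_n) (fun y : VW => \sum_(w <- words (index_enum 'I_N) k)
   ((N%:R^-1) ^+ k)%:E * (if (0 < vnorm y < 1)%R
    then pker q 0 [seq Nf i | i <- w] (X, vscale (vnorm y)^-1 y) else 0)) (fun=> 0%R)).
  rewrite star_volE//; apply: eq_itint => y _; case: ifP => _; last first.
    by rewrite big1// => w _; rewrite mule0.
  set u := vscale _ _.
  have eE i : epow (supp_fun (C i) (\row_(j < m i)
      dotv (rv (vrow X (Tagged (fun i => 'I_(m i)) j))) (rv u))%R) (- q) =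
      epow (mnorm 0 (Nf i) (X, u)) (- q).
    rewrite /mnorm mul0r addr0 /Nf; congr (epow (supp_fun _ _) _).
    by apply/rowP => j; rewrite !mxE dotv_rv.
  rewrite /ZdiamE_rho invrN opprK (expe_poweR (k := k) q0 _ n0 nq); last first.
    by rewrite mule_ge0 ?lee_fin ?invr_ge0//; apply: sume_ge0 => i _; exact: epow_ge0.
  under eq_bigr do rewrite eE.
  rewrite expeMn -EFin_expe expe_sum_words; last by move=> i; exact: epow_ge0.
  rewrite ge0_sume_distrr.
    apply: eq_bigr => w _; congr (_ * _).
    by elim: w => [//|i w IH] /=; rewrite IH.
  move=> w _; elim: w => [|i w IH] /=; first by rewrite lee_fin.
  by rewrite mule_ge0// epow_ge0.
rewrite itint_sum.
- by apply: eq_bigr => w _; rewrite (itintZ _ _ (mh w) (h0 w)).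
- by move=> w; apply: emeasurable_funM => //; exact: mh.
- by move=> w y; rewrite mule_ge0.
Qed.

Lemma exp_vol_fform (F : forall i : 'I_N, 'I_(m i) -> 'rV[R]_n -> R)
    (f : emp_index m -> VW -> R) (Z : emp_index m -> set VW) :
  (forall i j x, (0 <= F i j x)%R) ->
  (forall e, version (F (tag e) (tagged e)) (f e) (Z e)) ->
  exp_vol_ZdiamE (- q) C F =
  \sum_(w <- words (index_enum 'I_N) k) ((N%:R^-1) ^+ k)%:E * fform (sphV q 0 [seq Nf i | i <- w]) f.
Proof.
move=> F0 ver; rewrite /exp_vol_ZdiamE intRnIE -fform_sphV_sum//; last 2 first.
- by move=> e; exact: ver_meas (ver e).
- by move=> e; exact: ver_ge0 (ver e).
rewrite -(itint_fform W0 (F := fun e => F (tag e) (tagged e)) (fun e => F0 _ _) ver mW).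
by apply: eq_itint => X _; rewrite star_vol_emp.
Qed.

Theorem exp_vol_le (F : forall i : 'I_N, 'I_(m i) -> 'rV[R]_n -> R) :
  (forall i j, in_Pn (F i j)) ->
  exp_vol_ZdiamE (- q) C F <= exp_vol_ZdiamE (- q) C (fun i j => sym_rearr (F i j)).
Proof.
move=> PF.
have F0 i j x : (0 <= F i j x)%R by case: (PF i j).
have H (e : emp_index m) : exists fZ : (VW -> R) * set VW,
    version (F (tag e) (tagged e)) fZ.1 fZ.2.
  have [mF _ _ _] := PF (tag e) (tagged e).
  by have [f [Z v]] := exists_version mF (F0 _ _); exists (f, Z).
have /choice[fZ ver] := H.
have gE e y : (sym_rearr (F (tag e) (tagged e)) (rv y))%:E =
    \int[mu]_r (\1_(star (layer (fZ e).1 r)) y)%:E.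
  by have [_ _ _ M] := PF (tag e) (tagged e); exact: sym_rearrE (ver e) M.
rewrite (exp_vol_fform F0 ver).
rewrite (exp_vol_fform (f := fun e y => sym_rearr (F (tag e) (tagged e)) (rv y)) (Z := fun=> set0)).
- rewrite big_seq [leRHS]big_seq; apply: lee_sum => w wk; apply: lee_wpmul2l => //.
  apply: fform_sphV_le => //.
  + by rewrite size_map; exact: size_words wk.
  + by move=> e; exact: ver_meas (ver e).
  + by move=> e; exact: ver_ge0 (ver e).
  + by move=> e y; exact: sym_rearr_ge0.
- by move=> i j x; exact: sym_rearr_ge0.
- by move=> e; exact: (version_rearr n0 (PF _ _) (ver e)).
Qed.

End empirical.

Section deterministic.
Variables (m : nat) (C : set 'rV[R]_m).
Hypothesis bC : sym_convex_body C.

(** Factor [l] reads the [l]-th of [k] independent copies of the [m] points, so distinct factors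
    depend on distinct points. *)
Let Nl (l : 'I_k) (v : vec R ('I_k * 'I_m)%type) : R := supp_fun C (\row_j v (l, j))%R.

Let sNl (s : seq 'I_k) : List.Forall (@seminorm R ('I_k * 'I_m)%type) [seq Nl l | l <- s].
Proof.
elim: s => [|l s IH] /=; first exact: List.Forall_nil.
by apply: List.Forall_cons => //; exact: (seminorm_supp bC (fun j => (l, j))).
Qed.

Let L := [seq Nl l | l <- enum 'I_k].

Variables (f : 'rV[R]_n -> R) (f0 : VW -> R) (Z : set VW).
Hypothesis f_ge0 : forall x, (0 <= f x)%R.
Hypothesis ver : version f f0 Z.

Notation VY := (vec R ('I_m * 'I_n)%type).
Notation VX := (vec R (('I_k * 'I_m) * 'I_n)%type).

Let w0 (u : VW) (Y : VY) : \bar R := epow (supp_fun C (\row_j dots Y u j)%R) (- q).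
Let phi (u : VW) (Y : VY) : \bar R := (\prod_(j < m) f0 (vrow Y j))%:E * w0 u Y.

Let mw0 u : measurable_fun setT (w0 u).
Proof.
apply: (measurableT_comp (measurable_epow q0)).
apply: (measurableT_comp (sn_meas (seminorm_supp bC id)) (g := fun Y : VY => dots Y u)).
exact: measurable_dots.
Qed.

Let mphi u : measurable_fun setT (phi u).
Proof.
apply: emeasurable_funM; last exact: mw0.
apply/measurable_EFinP; apply: measurable_prod => e _.
exact: (measurableT_comp (ver_meas ver) (measurable_vrow e)).
Qed.

Let phi0 u Y : 0 <= phi u Y.
Proof.
rewrite mule_ge0 ?epow_ge0// lee_fin prodr_ge0// => j _; exact: ver_ge0 ver _.
Qed.

Let rhopE (u : VW) : Zdiam_rhop (- q) C f (rv u) =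
  itint (enum {: 'I_m * 'I_n}) (phi u) (fun=> 0%R).
Proof.
rewrite /Zdiam_rhop intRnIE.
have w00 Y : 0 <= w0 u Y by exact: epow_ge0.
rewrite -[RHS](itint_fform w00 (F := fun=> f) (fun=> f_ge0) (fun=> ver) (mw0 u)).
apply: eq_itint => Y _; congr (epow (supp_fun _ _) _ * _).
by apply/rowP => j; rewrite !mxE dotv_rv.
Qed.

Let g (u : VW) (X : VX) : \bar R := (\prod_e f0 (vrow X e))%:E * pker q 0 L (X, u).

Let P0 (X : VX) : 0 <= (\prod_e f0 (vrow X e))%:E.
Proof. rewrite lee_fin prodr_ge0// => e _; exact: ver_ge0 ver _. Qed.

Let mP : measurable_fun setT (fun X : VX => (\prod_e f0 (vrow X e))%:E : \bar R).
Proof.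
apply/measurable_EFinP; apply: measurable_prod => e _.
exact: (measurableT_comp (ver_meas ver) (measurable_vrow e)).
Qed.

(** The power formula treats a whole copy of the points as one row, the form treats each single
    point as one row; this regroups the indices. *)
Let assoc (p : 'I_k * ('I_m * 'I_n)) : ('I_k * 'I_m) * 'I_n := ((p.1, p.2.1), p.2.2).
Let G (x : vec R ('I_k * ('I_m * 'I_n))%type) : VX := fun p => x (p.1.1, (p.1.2, p.2)).

Let rhop_pow (u : VW) : (Zdiam_rhop (- q) C f (rv u)) ^+ k =
  itint (enum {: ('I_k * 'I_m) * 'I_n}) (g u) (fun=> 0%R).
Proof.
rewrite rhopE (power_itint k (mphi u) (phi0 u)).
have mg : measurable_fun setT (g u).
  apply: emeasurable_funM => //.
  have mXu : measurable_fun setT (fun X : VX => (X, u)) by exact: measurable_fun_pair.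
  exact: (measurableT_comp (measurable_pker (D := 'I_n) q0 0 (sNl (enum 'I_k))) mXu).
have g0 X : 0 <= g u X by rewrite mule_ge0// pker_ge0.
have ps : perm_eq (enum {: ('I_k * 'I_m) * 'I_n}) (map assoc (enum {: 'I_k * ('I_m * 'I_n)})).
  apply: uniq_perm; first exact: enum_uniq.
    by rewrite map_inj_uniq ?enum_uniq// => -[a [b c]] [a' [b' c']] [-> -> ->].
  move=> [[a b] c]; rewrite mem_enum; apply/esym/mapP.
  by exists (a, (b, c)); rewrite ?mem_enum.
rewrite (perm_itint _ mg g0 (enum_uniq _) ps).
transitivity (itint (enum {: 'I_k * ('I_m * 'I_n)}) (g u \o G) (fun=> 0%R)); last first.
  symmetry; apply: (itint_map (phi := assoc) (G := G)) => x [a [b c]] t _.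
  by apply/funext => -[[a' b'] c']; rewrite /G /upd /assoc /= !xpair_eqE andbA.
apply: eq_itint => x _.
have fold (s : seq 'I_k) : foldr (fun l h => phi u (vrow x l) * h) 1 s =
    (\prod_(l <- s) \prod_j f0 (vrow (vrow x l) j))%:E * pker q 0 [seq Nl l | l <- s] (G x, u).
  elim: s => [|l s IH]; first by rewrite big_nil mul1e.
  rewrite big_cons EFinM /= IH /phi muleACA; congr (_ * (epow _ _ * _)).
  by rewrite /mnorm mul0r addr0.
rewrite fold /= /g; congr (_%:E * _).
by rewrite big_enum /= pair_big /=; apply: eq_big => [[l j]|[l j] _].
Qed.

(** Once the power is expanded over independent copies, Tonelli exchanges the integral over
    directions with the one over the points. *)
Lemma star_vol_fform : star_vol (Zdiam_rho (- q) C f) =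
  fform (sphV q 0 L) (fun=> f0).
Proof.
rewrite star_volE//.
pose h (p : VW * VX) : \bar R := (\prod_e f0 (vrow p.2 e))%:E *
  (if (0 < vnorm p.1 < 1)%R then pker q 0 L (p.2, vscale (vnorm p.1)^-1 p.1) else 0).
have sL : List.Forall (@seminorm R ('I_k * 'I_m)%type) L by exact: sNl.
have mh : measurable_fun setT h.
  apply: emeasurable_funM; first exact: (measurableT_comp mP measurable_snd).
  have msw : measurable_fun setT (fun p : VW * VX => (p.2, p.1)).
    by apply: measurable_fun_pair; [exact: measurable_snd|exact: measurable_fst].
  exact: (measurableT_comp (measurable_sphV_fun (D := 'I_n) q0 0 sL) msw).
have h0 p : 0 <= h p.
  by rewrite mule_ge0//; case: ifP => // _; exact: pker_ge0.
transitivity (itint (enum 'I_n) (fun y => itint (enum {: ('I_k * 'I_m) * 'I_n})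
   (fun X => h (y, X)) (fun=> 0%R)) (fun=> 0%R)).
  apply: eq_itint => y _; rewrite /h /=; case: ifP => _; last first.
    rewrite -[LHS](itint0 (enum {: ('I_k * 'I_m) * 'I_n}) (fun=> 0%R)).
    by apply: eq_itint => X _; rewrite mule0.
  rewrite /Zdiam_rho invrN opprK (expe_poweR (k := k) q0 _ n0 nq) ?rhop_pow//.
  by rewrite rhopE; exact: itint_ge0.
rewrite (itintC _ _ _ _ mh h0); apply: eq_itint => X _; rewrite /h /=.
have m1 := measurable_sphV_fun1 (D := 'I_n) q0 0 X sL.
by rewrite (itintZ _ _ m1)// => y; exact: (sphV_fun_ge0 (D := 'I_n) q 0 L (X, y)).
Qed.

End deterministic.

Theorem star_vol_le (m : nat) (C : set 'rV[R]_m) (f : 'rV[R]_n -> R) :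
  sym_convex_body C -> in_Pn f ->
  star_vol (Zdiam_rho (- q) C f) <= star_vol (Zdiam_rho (- q) C (sym_rearr f)).
Proof.
move=> bC Pf; have [mf f_ge0 _ fM] := Pf.
have [f0 [Z ver]] := exists_version mf f_ge0.
rewrite (star_vol_fform bC f_ge0 ver).
rewrite (star_vol_fform bC (sym_rearr_ge0 f) (version_rearr n0 Pf ver)).
apply: fform_sphV_le.
- elim: (enum 'I_k) => [|l s IH] /=; first exact: List.Forall_nil.
  by apply: List.Forall_cons => //; exact: (seminorm_supp bC (fun j => (l, j))).
- by rewrite size_map -cardE card_ord.
- by move=> _; exact: ver_meas ver.
- by move=> _; exact: ver_ge0 ver.
- by move=> _ y; exact: sym_rearr_ge0.
- by move=> _ y; exact: sym_rearrE ver fM.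
Qed.

End conclusion.

Theorem theorem2p3 (R : realType) (n : nat) : (0 < n)%N ->
  (forall (m : nat) (C : set 'rV[R]_m) (f : 'rV[R]_n -> R) (p : R),
     (1 <= m)%N -> in_Pn f -> sym_convex_body C ->
     -1 < p < 0 -> (exists k : nat, n%:R / (- p) = k%:R) ->
     (star_vol (Zdiam_rho p C f) <= star_vol (Zdiam_rho p C (sym_rearr f)))%E)
  /\
  (forall (N : nat) (m : 'I_N -> nat) (C : forall i : 'I_N, set 'rV[R]_(m i))
          (F : forall i : 'I_N, 'I_(m i) -> 'rV[R]_n -> R) (p : R),
     (n < N)%N ->
     (forall i, n.+1 <= m i)%N ->
     (forall i, sym_convex_body (C i)) ->
     (forall i j, in_Pn (F i j)) ->
     -1 <= p < 0 -> (exists k : nat, n%:R / (- p) = k%:R) ->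
     (exp_vol_ZdiamE p C F <=
      exp_vol_ZdiamE p C (fun i j => sym_rearr (F i j)))%E).
Proof.
move=> n0; split.
- move=> m C f p _ Pf bC /andP[_ p0] [k pk].
  have q0 : 0 < - p by rewrite oppr_gt0.
  rewrite -(opprK p); apply: (star_vol_le (k := k) n0 q0) => //.
  by rewrite -pk mulrCA divff ?mulr1// gt_eqF.
- move=> N m C F p _ _ bC PF /andP[_ p0] [k pk].
  have q0 : 0 < - p by rewrite oppr_gt0.
  rewrite -(opprK p); apply: (exp_vol_le (k := k) n0 q0) => //.
  by rewrite -pk mulrCA divff ?mulr1// gt_eqF.
Qed.
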